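(* Let $h=2n+1\ge3$ be odd and let $\tau$ be an $h$-bar-core. Let $\tau(0)\lhd\tau(1)\lhd\cdots\lhd\tau(n)$ be the partitions in $\mathcal P_{\tau,1}$ (there are exactly $n+1$ of them, totally ordered by dominance, and all except $\tau(n)$ are restricted). Then for $0\le r\le n$ and $0\le s\le n-1$, $$\mathrm d_{\tau(r)\tau(s)}=\begin{cases}1&\text{if }r=s\\ q&\text{if }r=s+1\text{ and }h\in\tau(r)\\ q^2&\text{if }r=s+1\text{ and }h\notin\tau(r)\\0&\text{otherwise,}\end{cases}$$ where $h\in\tau(r)$ means that $h$ is a part of $\tau(r)$.
   Context: **Partitions.** Fix an odd integer $h=2n+1\ge3$. A partition is a weakly decreasing sequence $\lambda=(\lambda_1,\lambda_2,\dots)$ of non-negative integers with finite sum $|\lambda|$. Its Young diagram is $[\lambda]=\{(r,c)\in\mathbb N^2: c\le\lambda_r\}$, $\mathbb N=\{1,2,\dots\}$; elements of $\mathbb N^2$ are nodes ($r$ = row, $c$ = column). Dominance order: for $|\lambda|=|\mu|$, $\lambda\unlhd\mu$ iff $\lambda_1+\dots+\lambda_r\le\mu_1+\dots+\mu_r$ for all $r$; $\lhd$ is the strict version. $\lambda$ is $h$-strict if for every $r$ either $\lambda_r>\lambda_{r+1}$ or $\lambda_r\equiv0\pmod h$. An $h$-strict $\lambda$ is restricted if for every $r$ either $\lambda_{r+1}>\lambda_r-h$ or $\lambda_{r+1}=\lambda_r-h\not\equiv0\pmod h$. **Bar-cores.** Removing an $h$-bar from an $h$-strict partition means obtaining a smaller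 $h$-strict partition by either replacing a part $x\ge h$ with $x-h$ and reordering, or removing two parts which sum to $h$. An $h$-bar-core is an $h$-strict partition from which no $h$-bar can be removed. The $h$-bar-core of $\lambda$ is obtained by removing $h$-bars repeatedly until impossible (well defined); the $h$-bar-weight is the number of $h$-bars removed. $\mathcal P_{\tau,w}$ is the set of $h$-strict partitions with $h$-bar-core $\tau$ and $h$-bar-weight $w$. **Fock space.** The residue of a node $(r,c)$ is the smaller of the residues of $c-1$ and $-c$ modulo $h$, an element of $\{0,\dots,n\}$; an $i$-node is a node of residue $i$. For $\lambda$ $h$-strict, the removable $i$-nodes of $\lambda$ are the nodes of $[\lambda]\setminus[\mu]$, where $\mu$ is the smallest $h$-strict partition with $[\mu]\subseteq[\lambda]$ and $[\lambda]\setminus[\mu]$ consisting of $i$-nodes. The addable $i$-nodes of $\lambda$ are the $i$-nodes that can be added to $\lambda$ (possibly together with other $i$-nodes) to give a larger $h$-strict partition. Let $q$ be an indeterminate, $q_0=q$, $q_i=q^2$ for $0<i<n$, $q_n=q^4$. $\mathscr F$ is the $\mathbb C(q)$-vector space with basis the set of all $h$-strict partitions. If $\mu$ is $h$-strict and is obtained from $\lambda$ by adding one $i$-node $(r,c)$, let $s$ be the number of addable $i$-nodes of $\mu$ in columns to the left of column $c$ minus the number of removable $i$-nodes of $\lambda$ in columns to the left of column $c$; put $N_i(\lambda,\mu)=q_i^s$, except that if $i=0$ and $c=mh+1$ with $m\ge1$, put $N_0(\lambda,\mu)=q^s(1-(-q^2)^{b})$, where $b$ is the number of parts of $\lambda$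 equal to $mh$. Define linear operators $f_i$ ($0\le i\le n$) on $\mathscr F$ by $f_i\lambda=\sum_\mu N_i(\lambda,\mu)\mu$, summing over all $h$-strict $\mu$ obtained by adding one $i$-node to $\lambda$. (This is the level 1 $q$-deformed Fock space of type $A^{(2)}_{2n}$.) **Canonical basis.** A vector is bar-invariant if it is a $\mathbb C(q+q^{-1})$-linear combination of vectors $f_{i_1}\cdots f_{i_r}\varnothing$ ($r\ge0$). For each restricted $h$-strict $\mu$ there is a unique bar-invariant vector $G(\mu)=\sum_\lambda \mathrm d_{\lambda\mu}\lambda$ with $\mathrm d_{\mu\mu}=1$ and every other $\mathrm d_{\lambda\mu}$ a polynomial in $q$ divisible by $q$. *)

(* Defs.v *)
From HB Require Import structures.
From mathcomp Require Import all_boot all_order all_algebra finmap.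
From mathcomp Require Import boolp classical_sets cardinality reals.
From mathcomp Require Import complex.
From mathcomp.multinomials Require Import monalg.

Set Implicit Arguments.
Unset Strict Implicit.
Unset Printing Implicit Defensive.

Import Order.TTheory GRing.Theory Num.Theory.

Local Open Scope ring_scope.
Local Open Scope complex_scope.

(* The odd integer h = 2n+1. *)
Definition hh (n : nat) : nat := n.*2.+1.

(* A partition is the sequence of its nonzero parts.  Rows are numbered from 0
   and columns from 1; [nth 0 l r] is the length of row r, equal to 0 beyond
   the last part. *)
Definition is_partition (l : seq nat) : bool := sorted geq l && (0%N \notin l).

Definition h_strict (h : nat) (l : seq nat) : bool :=
  [forall r : 'I_(size l),
     (nth 0%N l r.+1 < nth 0%N l r)%N || (h %| nth 0%N l r)%N].

Record hspart (n : nat) := HSPart {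
  parts :> seq nat;
  hspartP : is_partition parts && h_strict (hh n) parts }.

HB.instance Definition _ n := [isSub for @parts n].
HB.instance Definition _ n := [Choice of hspart n by <:].

Lemma empty_hspart_subproof n :
  is_partition [::] && h_strict (hh n) [::].
Proof. by apply/forallP; case. Qed.

Definition empty_hspart n : hspart n := HSPart (empty_hspart_subproof n).

(* The inequality l_{r+1} > l_r - h is in the integers, hence the sums. *)
Definition restricted n (l : hspart n) : Prop :=
  forall r : nat,
    (nth 0 l r < nth 0 l r.+1 + hh n)%N \/
    (nth 0 l r = nth 0 l r.+1 + hh n /\ ~~ (hh n %| nth 0 l r))%N.

Definition dominated (l m : seq nat) : Prop :=
  sumn l = sumn m /\ forall r : nat, (sumn (take r l) <= sumn (take r m))%N.

Definition strictly_dominated (l m : seq nat) : Prop :=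
  dominated l m /\ l <> m.

Section BarCores.
Variable n : nat.
Local Notation h := (hh n).

Definition bar_removal (l m : hspart n) : Prop :=
  (exists (x : nat) (s : seq nat),
     [/\ (h <= x)%N, perm_eq l (x :: s) &
         perm_eq m (if x == h then s else (x - h)%N :: s)]) \/
  (exists x y : nat, (x + y = h)%N /\ perm_eq l [:: x, y & m]).

Definition is_bar_core (l : hspart n) : Prop :=
  forall m : hspart n, ~ bar_removal l m.

Fixpoint bar_removals (w : nat) (l m : hspart n) : Prop :=
  if w is w'.+1 then
    exists k : hspart n, bar_removal l k /\ bar_removals w' k m
  else l = m.

(* The set P_{tau,w}. *)
Definition with_core_weight (tau : hspart n) (w : nat) : set (hspart n) :=
  [set l | is_bar_core tau /\ bar_removals w l tau].

End BarCores.

Section Nodes.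
Variable n : nat.
Local Notation h := (hh n).

(* The node in row r and column c is (r, c). *)
Definition diagram (l : seq nat) : set (nat * nat) :=
  [set x | (1 <= x.2 <= nth 0 l x.1)%N].

(* The two arguments of minn are the residues of c - 1 and of - c modulo h,
   for c >= 1. *)
Definition residue (c : nat) : nat :=
  minn (c.-1 %% h) ((h - c %% h) %% h).

Definition inodes (i : nat) : set (nat * nat) :=
  [set x | residue x.2 = i].

Definition removable_to (i : nat) (l m : hspart n) : Prop :=
  (diagram m `<=` diagram l)%classic /\
  (diagram l `\` diagram m `<=` inodes i)%classic.

Definition removable_nodes (i : nat) (l : hspart n) : set (nat * nat) :=
  [set x | exists m : hspart n,
     [/\ removable_to i l m,
         forall k, removable_to i l k -> (diagram m `<=` diagram k)%classic &
         (diagram l `\` diagram m)%classic x]].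

Definition addable_nodes (i : nat) (l : hspart n) : set (nat * nat) :=
  [set x | exists m : hspart n,
     removable_to i m l /\ (diagram m `\` diagram l)%classic x].

(* The sets to which this is applied are finite. *)
Definition count_left (c : nat) (A : set (nat * nat)) : nat :=
  #|` fset_set (A `&` [set x | (x.2 < c)%N])%classic |.

End Nodes.

Section FockSpace.
Variables (R : realType) (n : nat).
Local Notation h := (hh n).

(* The field C(q). *)
Local Notation Cq := {fraction {poly R[i]}}.

Definition poly_in_q (p : {poly R[i]}) : Cq := FracField.tofrac p.

Definition q : Cq := poly_in_q 'X.

Local Notation Fock := {malg Cq[hspart n]}.

Definition q_ (i : nat) : Cq :=
  if i == 0%N then q else if i == n then q ^+ 4 else q ^+ 2.

(* N_i(l, m), where m is obtained from l by adding an i-node in column c. *)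
Definition fock_coef (i : nat) (l m : hspart n) (c : nat) : Cq :=
  let s := ((count_left c (addable_nodes i m))%:Z
            - (count_left c (removable_nodes i l))%:Z)%R in
  if [&& i == 0%N, (1 < c)%N & c == 1 %[mod h]]
  then q ^ s * (1 - (- q ^+ 2) ^+ count_mem c.-1 l)
  else q_ i ^ s.

(* [incr_nth l r] is l with a node added at the end of row r (r = size l
   starting a new row); [insub] discards it unless it is an h-strict
   partition. *)
Definition f_basis (i : nat) (l : hspart n) : Fock :=
  \sum_(r < (size l).+1)
     let c := (nth 0%N l r).+1 in
     if residue n c == i then
       if insub (incr_nth l r) is Some m then << fock_coef i l m c *g m >>
       else 0
     else 0.

Definition f_op (i : nat) (v : Fock) : Fock :=
  \sum_(l <- msupp v) v@_l *: f_basis i l.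

(* f_{i_1} ... f_{i_r} applied to the empty partition. *)
Definition f_word (w : seq 'I_n.+1) : Fock :=
  foldr (fun (i : 'I_n.+1) v => f_op i v) << empty_hspart n >> w.

(* The subfield C(q + q^-1). *)
Definition eval_sym (p : {poly R[i]}) : Cq :=
  (map_poly (fun a => poly_in_q a%:P) p).[q + q^-1].

Definition in_Cqsym (x : Cq) : Prop :=
  exists a b : {poly R[i]}, b != 0 /\ x = eval_sym a / eval_sym b.

Definition bar_invariant (v : Fock) : Prop :=
  exists s : seq (Cq * seq 'I_n.+1),
    (forall cw, cw \in s -> in_Cqsym cw.1) /\
    v = \sum_(cw <- s) cw.1 *: f_word cw.2.

Definition is_canonical (mu : hspart n) (G : Fock) : Prop :=
  [/\ bar_invariant G, G@_mu = 1 &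
      forall l, l != mu ->
        exists p : {poly R[i]}, G@_l = poly_in_q ('X * p)].

(* G(mu), which is a vector with the defining property; for restricted mu such
   a vector exists and is unique. *)
Definition Gvec (mu : hspart n) : Fock := xget 0 [set v | is_canonical mu v]%classic.

(* d_{l mu} *)
Definition dnum (l mu : hspart n) : Cq := (Gvec mu)@_l.

End FockSpace.

Arguments q {R}.
Arguments dnum R {n} l mu.

(* t(0), ..., t(n) are the elements of P_{tau,1}, strictly increasing in the
   dominance order. *)
Definition weight1_enum n (tau : hspart n) (t : 'I_n.+1 -> hspart n) : Prop :=
  (forall l, with_core_weight tau 1 l <-> exists r, l = t r) /\
  (forall r s : 'I_n.+1, (r < s)%N -> strictly_dominated (t r) (t s)).

(* Main.v *)
(** With respect to the norm in which the basis vector of l has length the product of the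
    numbers beta 1, ..., beta (mult x l) over the multiples x of h, f_i has an adjoint, which
    up to a power of q is an operator e_i with [e_i, f_i] = the q-integer of the weight.  Hence
    a vector killed by f_i in a weight space of weight - a d_i is recovered from e_i^a by f_i^a,
    and the bar-invariant vectors are stable under the e_i.  The charges and the size of a
    partition determine its weight, and DD l (4h times the number of bars) is a quadratic
    function of them; as DD >= 0, strings through blocks of weight 0 and 1 are short.  So
    divided powers of f_i carry cores to cores and the vectors t(r) + q^c t(r+1) to one
    another, by induction on the size of the core, until a few strings are computed by hand.
    A bar-invariant vector has on the t(r) the coefficients x_r + q^c x_{r-1} with x_r in
    C(q + 1/q), and elements of C(q + 1/q) that are polynomials in q are constants. *)
Require Import Defs.
From HB Require Import structures.
From mathcomp Require Import all_boot all_order all_algebra finmap.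
From mathcomp Require Import boolp classical_sets cardinality reals.
From mathcomp Require Import complex.
From mathcomp.multinomials Require Import monalg.
From mathcomp Require Import zify ring.

Set Implicit Arguments.
Unset Strict Implicit.
Unset Printing Implicit Defensive.

Import Order.TTheory GRing.Theory Num.Theory.

Local Open Scope ring_scope.

(** Everything turns on one inequality. Adding an i-node changes [DD] by 2h(wt - d_i), removing one
    by -2h(wt + d_i). In a block with one bar [DD] is 4h, so wt + d_i <= 2 as soon as some i-node
    can be removed. If wt + d_i = 2, the removal ends at a core; this occurs for i = 0 in weight 1
    and for 0 < i < n in weight 0, never for i = n. Otherwise the weight is -a d_i with a > 0, and
    f_i kills the block unless i = 0 and a = 1, where adding a 0-node may lead to a core. These
    exceptions are the strings computed by hand; in all other cases a divided power of f_i matches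
    two blocks bijectively. Adjointness gives the coefficients of the matching only up to sign, and
    positivity of the matrix of f_i at q = 1/2 fixes the sign. The exponent 1 at the part h goes
    back to the weight 1 of the empty partition for i = 0; the exponent 2 elsewhere is the weight of
    the other end of a bar. Vectors are arbitrary functions on partitions, since each value of f_i u
    or e_i u is a finite sum. *)

(** * Strict partitions as multisets of parts *)

Section StrictPartitions.
Local Open Scope nat_scope.
Variable n : nat.
Local Notation h := (hh n).
Implicit Types (l m : hspart n) (s : seq nat).

Definition mult (y : nat) s : nat := count_mem y s.

Lemma mem_mult y s : (y \in s) = (0 < mult y s).
Proof. by rewrite /mult -has_count has_pred1. Qed.

Lemma mult_cons y x s : mult y (x :: s) = (y == x) + mult y s.
Proof. by rewrite /mult /= eq_sym. Qed.

Lemma mult_rem y x s : mult y (rem x s) = mult y s - (y == x).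
Proof.
rewrite /mult count_rem /= eq_sym; case: (eqVneq y x) => [<-|]; last by rewrite andbF.
by rewrite andbT mem_mult /mult; case: (count _ s).
Qed.

Lemma mult_perm s1 s2 y : perm_eq s1 s2 -> mult y s1 = mult y s2.
Proof. by move=> /permP/(_ (pred1 y)). Qed.

Lemma geq_trans : transitive geq.
Proof. by move=> y x z; rewrite /geq /= => yx zy; apply: leq_trans yx. Qed.

Lemma part_neq0 l : 0 \notin parts l.
Proof. by case/andP: (hspartP l) => /andP[]. Qed.

Lemma parts_sorted l : sorted geq (parts l).
Proof. by case/andP: (hspartP l) => /andP[]. Qed.

(** In terms of multiplicities h-strictness does not depend on the order of the parts, so partitions
    can be handled as multisets, up to [perm_eq]. *)
Lemma h_strict_countP s : sorted geq s -> 0 \notin s ->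
  h_strict h s <-> forall y, ~~ (h %| y) -> count_mem y s <= 1.
Proof.
move=> s_sorted s_neq0.
have hsP : h_strict h s <->
    forall r, r < size s -> (nth 0 s r.+1 < nth 0 s r) || (h %| nth 0 s r).
  split=> [/forallP H r rs|H]; first exact: (H (Ordinal rs)).
  by apply/forallP => -[r rs]; apply: H.
rewrite hsP {hsP}; elim: s s_sorted s_neq0 => [|x s IH] // xs_sorted.
rewrite inE negb_or => /andP[x_neq0 s_neq0].
have s_sorted := path_sorted xs_sorted; have {}IH := IH s_sorted s_neq0.
have xmax y : y \in s -> y <= x.
  by move=> ys; have /allP := order_path_min geq_trans xs_sorted; apply.
split=> [H y hy /=|H [|r] /= rs].
- have /IH/(_ y hy) cy : forall r, r < size s ->
      (nth 0 s r.+1 < nth 0 s r) || (h %| nth 0 s r).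
    by move=> r rs; apply: (H r.+1).
  case: eqP => [xy|_] //=; rewrite -[_ <= 1]/(1 + count_mem y s <= 1 + 0) leq_add2l leqn0.
  rewrite (count_memPn _) //; apply/negP => ys.
  have /= := H 0 isT; rewrite xy (negPf hy) orbF.
  case: s {IH H xs_sorted s_neq0 cy} xmax ys s_sorted => [//|z s] xmax.
  rewrite inE /= => /orP[/eqP->|ys]; first by rewrite ltnn.
  move=> zs; have /allP/(_ y ys) := order_path_min geq_trans zs.
  by rewrite /= => /leq_ltn_trans H /H; rewrite ltnn.
- case: (boolP (h %| x)) => hx; rewrite ?orbT // orbF.
  have /= := H x hx; rewrite eqxx -[1 + _ <= 1]/(1 + count_mem x s <= 1 + 0) leq_add2l leqn0.
  case: s {IH H xs_sorted s_sorted s_neq0 rs} xmax => [|z s] xmax /=.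
    by move=> _; rewrite lt0n eq_sym.
  case: (eqVneq z x) => //= zx _; rewrite ltn_neqAle zx; apply: xmax.
  exact: mem_head.
- apply: (IH.2 _ r rs) => y hy; have /= := H y hy.
  by apply: leq_trans; rewrite leq_addl.
Qed.

Lemma mult_le1 l y : ~~ (h %| y) -> mult y l <= 1.
Proof.
have [] := andP (hspartP l) => /andP[s_sorted s_neq0] hs.
exact: (h_strict_countP s_sorted s_neq0).1.
Qed.

Lemma mult01 l y : (h %| y) = false -> mult y l = 0 \/ mult y l = 1.
Proof. by move=> hy; have := @mult_le1 l y; rewrite hy => /(_ isT); lia. Qed.

Lemma hspart_ext l m :
  (forall y, 0 < y -> mult y l = mult y m) -> l = m.
Proof.
move=> H; apply/val_inj => /=.
apply: (sorted_eq geq_trans _ (parts_sorted l) (parts_sorted m)).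
  by move=> x y; rewrite /geq /= => /andP[? ?]; apply/eqP; rewrite eqn_leq; apply/andP.
apply/allP => y _ /=; case: y => [|y].
  by rewrite !(count_memPn (part_neq0 _)).
by apply/eqP; rewrite -/(mult _ _) H.
Qed.

(** A sequence violating the conditions of [mkhs_perm] gives the empty partition. *)
Definition mkhs s : hspart n := insubd (empty_hspart n) (sort geq s).

Lemma mkhs_perm s : 0 \notin s -> (forall y, ~~ (h %| y) -> mult y s <= 1) ->
  perm_eq (mkhs s) s.
Proof.
move=> s0 sc; rewrite /mkhs.
have ss : sorted geq (sort geq s) by apply: sort_sorted => x y; rewrite /geq /= leq_total.
have s0' : 0 \notin sort geq s by rewrite mem_sort.
rewrite [parts _]insubdK ?perm_sort //.
change (is_true (is_partition (sort geq s) && h_strict h (sort geq s))).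
rewrite /is_partition ss s0' /=.
by apply/(h_strict_countP ss s0') => y hy; rewrite -/(mult _ _) (mult_perm y (permEl (perm_sort _ _))) sc.
Qed.

End StrictPartitions.

(** * Moves: adding or removing one node *)

Section Moves.
Local Open Scope nat_scope.
Variable n : nat.
Local Notation h := (hh n).
Implicit Types (l m : hspart n) (x y z : nat).

(* The move x replaces a part x by x + 1, or adds a part 1 when x = 0.  A node
   in column c is added or removed by the move c - 1. *)
Definition upok x l :=
  ((x == 0) || (x \in parts l)) && ((x.+1 \notin parts l) || (h %| x.+1)).
Definition dnok x l := (x.+1 \in parts l) && ((x \notin parts l) || (h %| x)).
Definition up x l : hspart n := mkhs n (x.+1 :: rem x l).
Definition dn x l : hspart n :=
  mkhs n (if x == 0 then rem 1 l else x :: rem x.+1 l).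

Lemma mult0 l : mult 0 l = 0.
Proof. exact/count_memPn/part_neq0. Qed.

Lemma rem0_notin (s : seq nat) x : 0 \notin s -> 0 \notin rem x s.
Proof. by apply: contra; apply: mem_rem. Qed.

Lemma up_perm x l : upok x l -> perm_eq (up x l) (x.+1 :: rem x l).
Proof.
case/andP=> _ hx; apply: mkhs_perm.
  by rewrite inE negb_or /=; apply: rem0_notin; apply: part_neq0.
move=> y hy; have := mult_le1 l hy; rewrite mult_cons mult_rem.
case: (eqVneq y x.+1) hx => [xy|_ _]; last by lia.
by subst y; rewrite (negPf hy) orbF mem_mult; lia.
Qed.

Lemma dn_perm x l : dnok x l ->
  perm_eq (dn x l) (if x == 0 then rem 1 l else x :: rem x.+1 l).
Proof.
case/andP=> lx hx; apply: mkhs_perm.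
  case: eqP => x0; first exact/rem0_notin/part_neq0.
  by rewrite inE negb_or eq_sym; apply/andP; split; [apply/eqP | apply/rem0_notin/part_neq0].
move=> y hy; have := mult_le1 l hy; case: eqP => x0.
  by rewrite mult_rem; lia.
rewrite mult_cons mult_rem; case: (eqVneq y x) hx => [<-|_]; last by lia.
by rewrite (negPf hy) orbF mem_mult; lia.
Qed.

Lemma mult_up x l y : upok x l -> 0 < y ->
  mult y (up x l) + (y == x) = mult y l + (y == x.+1).
Proof.
move=> hx y0; rewrite (mult_perm _ (up_perm hx)) mult_cons mult_rem.
case/andP: hx; rewrite mem_mult => hx _.
case: (eqVneq y x) => [yx|_]; last by lia.
by subst y; lia.
Qed.

Lemma mult_dn x l y : dnok x l -> 0 < y ->
  mult y (dn x l) + (y == x.+1) = mult y l + (y == x).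
Proof.
move=> hx y0; rewrite (mult_perm _ (dn_perm hx)); case/andP: hx; rewrite mem_mult => hx _.
case: eqP => x0; rewrite ?mult_cons mult_rem.
  by subst x; case: (eqVneq y 1) hx => [->|_ _]; lia.
by case: (eqVneq y x.+1) hx => [->|_ _]; lia.
Qed.

Lemma sum_up (V : zmodType) (F : nat -> V) x l : F 0 = 0%R -> upok x l ->
  (\sum_(y <- up x l) F y = \sum_(y <- l) F y - F x + F x.+1)%R.
Proof.
move=> F0 hx; rewrite (perm_big _ (up_perm hx)) /= big_cons addrC; congr (_ + _)%R.
case/andP: hx => /orP[/eqP->|lx] _.
  by rewrite rem_id ?part_neq0 // F0 subr0.
by rewrite (perm_big _ (perm_to_rem lx)) /= big_cons [(F x + _)%R]addrC addrK.
Qed.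

Lemma hnS (z : nat) : h %| z -> ~~ (h %| z.+1) || (n == 0).
Proof. by move=> hz; rewrite -addn1 dvdn_addr // dvdn1 /hh; lia. Qed.

Lemma dnok_up x l : upok x l -> dnok x (up x l).
Proof.
move=> hx; rewrite /dnok !mem_mult.
have := mult_up (y := x.+1) hx isT; rewrite eqxx => c1.
apply/andP; split; first by lia.
case: (posnP x) => [->|x0]; first by rewrite dvdn0 orbT.
have := mult_up hx x0; rewrite eqxx => c2.
by case: (boolP (h %| x)) => hh; rewrite ?orbT //; have := mult_le1 l hh; lia.
Qed.

Lemma upok_dn x l : dnok x l -> upok x (dn x l).
Proof.
move=> hx; rewrite /upok !mem_mult.
have := mult_dn (y := x.+1) hx isT; rewrite eqxx => c1.
apply/andP; split.
  case: (posnP x) => [->|x0] //; have := mult_dn hx x0; rewrite eqxx => c2; lia.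
case: (boolP (h %| x.+1)) => hh; rewrite ?orbT //; have := mult_le1 l hh; lia.
Qed.

Lemma upK x l : upok x l -> dn x (up x l) = l.
Proof.
move=> hx; apply: hspart_ext => y y0.
have := mult_up hx y0; have := mult_dn (dnok_up hx) y0; lia.
Qed.

Lemma dnK x l : dnok x l -> up x (dn x l) = l.
Proof.
move=> hx; apply: hspart_ext => y y0.
have := mult_dn hx y0; have := mult_up (upok_dn hx) y0; lia.
Qed.

Lemma mem_up x l y : upok x l -> y != x -> y != x.+1 ->
  (y \in parts (up x l)) = (y \in parts l).
Proof.
move=> hx yx yx1; case: (posnP y) => [->|y0]; first by rewrite !(negPf (part_neq0 _)).
by rewrite !mem_mult; have := mult_up hx y0; rewrite (negbTE yx) (negbTE yx1) !addn0 => ->.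
Qed.

Lemma mem_dn x l y : dnok x l -> y != x -> y != x.+1 ->
  (y \in parts (dn x l)) = (y \in parts l).
Proof. by move=> hx *; rewrite -[in RHS](dnK hx) mem_up // upok_dn. Qed.

Lemma mem_up_src x l : upok x l -> 0 < x -> (x \in parts (up x l)) = (1 < mult x l).
Proof.
by move=> hx x0; have := mult_up hx x0; rewrite eqxx mem_mult (ltn_eqF (ltnSn x)); lia.
Qed.

Lemma mem_up_tgt x l : upok x l -> x.+1 \in parts (up x l).
Proof. by move/dnok_up/andP=> []. Qed.

Lemma mem_dn_src x l : dnok x l -> (x.+1 \in parts (dn x l)) = (1 < mult x.+1 l).
Proof.
by move=> hx; have := mult_dn hx (ltn0Sn x); rewrite eqxx mem_mult (gtn_eqF (ltnSn x)); lia.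
Qed.

Lemma mem_dn_tgt x l : dnok x l -> (x == 0) || (x \in parts (dn x l)).
Proof. by move/upok_dn/andP=> []. Qed.

Lemma mult_up_src x l : upok x l -> (0 < x) -> (mult x (up x l)).+1 = mult x l.
Proof. by move=> ux x0; have := mult_up ux x0; rewrite eqxx; lia. Qed.

Lemma mult_up_tgt x l : upok x l -> mult x.+1 (up x l) = (mult x.+1 l).+1.
Proof. by move=> ux; have := mult_up ux (ltn0Sn x); rewrite eqxx; lia. Qed.

Lemma mult_up_far x l y : upok x l -> y != x -> y != x.+1 -> mult y (up x l) = mult y l.
Proof.
move=> ux yx yx1; case: (posnP y) => [->|y0]; first by rewrite !mult0.
by have := mult_up ux y0; rewrite (negbTE yx) (negbTE yx1) !addn0.
Qed.

Lemma mult_dn_src x l : dnok x l -> (mult x.+1 (dn x l)).+1 = mult x.+1 l.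
Proof. by move=> dx; rewrite -[in RHS](dnK dx) mult_up_tgt // upok_dn. Qed.

(** The conditions of the two moves can interfere only when the moves are adjacent, z + 1 = x or z =
    x + 1. This is the combinatorial part of the commutation of e_i and f_j off the diagonal. *)
Lemma up_dn_ok x z l : x != z ->
  upok x l && dnok z (up x l) = dnok z l && upok x (dn z l).
Proof.
move=> xz; apply/andP/andP => -[].
- move=> ux dz; have dzl : dnok z l.
    move: dz; rewrite /dnok => /andP[].
    have [z1x|zx] := eqVneq z.+1 x.
      subst x; rewrite mem_up_src // => /ltnW; rewrite -mem_mult => -> /=.
      by rewrite mem_up //; lia.
    rewrite mem_up //; last by lia.
    move=> -> /=; have [zx1|zx1] := eqVneq z x.+1; last by rewrite mem_up // eq_sym.
    by rewrite zx1 mem_up_tgt //= => ->; rewrite orbT.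
  split=> //; move: (ux) dz; rewrite /upok => /andP[x1 x2] /andP[z1 z2].
  have [z1x|zx] := eqVneq z.+1 x.
    subst x; rewrite mem_dn_src // -mem_up_src // z1 orbT /= mem_dn //; lia.
  have xz1 : x != z.+1 by rewrite eq_sym.
  rewrite /upok (mem_dn (y := x)) // x1 /=.
  have [zx1|zx1] := eqVneq z x.+1; last by rewrite mem_dn //; lia.
  by rewrite zx1 in z2 *; move: z2; rewrite mem_up_tgt //= => ->; rewrite orbT.
- move=> dz ux; have uxl : upok x l.
    move: ux; rewrite /upok => /andP[].
    have [z1x|zx] := eqVneq z.+1 x.
      subst x; rewrite mem_dn_src //= => /ltnW; rewrite -mem_mult => -> /=.
      by rewrite mem_dn //; lia.
    have xz1 : x != z.+1 by rewrite eq_sym.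
    rewrite mem_dn // => -> /=.
    have [zx1|zx1] := eqVneq z x.+1; last by rewrite mem_dn //; lia.
    by subst z; have := mem_dn_tgt dz; rewrite /= => -> /= ->; rewrite orbT.
  split=> //; move: (dz) ux; rewrite /dnok => /andP[z1 z2] /andP[x1 x2].
  have [z1x|zx] := eqVneq z.+1 x.
    subst x; rewrite /= in x1; rewrite /dnok mem_up_src // -mem_dn_src // x1 /= mem_up //; lia.
  have zx1' : z.+1 != x.+1 by rewrite eqSS eq_sym.
  rewrite /dnok (mem_up (y := z.+1)) // z1 /=.
  have [zx1|zx1] := eqVneq z x.+1; last by rewrite mem_up // eq_sym.
  subst z; have := mem_dn_tgt dz; rewrite /= => hd.
  by move: x2; rewrite hd /= => ->; rewrite orbT.
Qed.

Lemma up_dnC x z l : upok x l -> dnok z (up x l) -> dnok z l -> upok x (dn z l) ->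
  dn z (up x l) = up x (dn z l).
Proof.
move=> ux dz dzl uxd; apply: hspart_ext => y y0.
have := mult_up ux y0; have := mult_dn dz y0; have := mult_dn dzl y0.
have := mult_up uxd y0; lia.
Qed.

End Moves.

(** * Residues of moves, weights and the Cartan matrix *)

Section Edges.
Variable n : nat.
Hypothesis n_gt0 : (0 < n)%N.
Local Notation h := (hh n).
Implicit Types (l m : hspart n) (i j k x y z : nat).

Lemma modhS y : ((y.+1 %% h) = if (y %% h).+1 == h then 0 else (y %% h).+1)%N.
Proof.
rewrite -addn1 -modnDml addn1; have: (y %% h < h)%N by rewrite ltn_mod.
case: eqP => [->|]; first by rewrite modnn.
by move=> ne lt; rewrite modn_small //; move: ne lt; rewrite /hh; lia.
Qed.

Definition ed i x := residue n x.+1 == i.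

Lemma edE i x : (i <= n)%N -> ed i x = (x %% h == i)%N || (x %% h + i == n.*2)%N.
Proof.
move=> ni; rewrite /ed /residue /= modhS.
have: (x %% h < h)%N by rewrite ltn_mod.
case: (eqVneq (x %% h).+1 h) => [e|ne] lt.
  by rewrite subn0 modnn; move: e lt; rewrite /hh; lia.
rewrite (modn_small (m := (h - (x %% h).+1)%N)); move: ne lt; rewrite /hh; lia.
Qed.

Lemma ed_inj i j x : (i <= n)%N -> (j <= n)%N -> ed i x -> ed j x -> i = j.
Proof. by move=> _ _ /eqP <- /eqP. Qed.

(* The pairing of the residues of k and y in the lattice where the residue - k
   is opposite to the residue k. *)
Definition bq k y : int := (k %% h == y %% h)%N%:Z - (h %| k + y)%N%:Z.

Lemma bqE k y : (k < h)%N ->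
  bq k y = (k == y %% h)%N%:Z - ((k + y %% h == 0) || (k + y %% h == h))%N%:Z.
Proof.
move=> kh; rewrite /bq (modn_small kh) /dvdn -modnDmr.
have: (y %% h < h)%N by rewrite ltn_mod.
move: (y %% h)%N => r rh; congr (_ - (nat_of_bool _)%:Z).
have [lt|ge] := ltnP (k + r) h; first by rewrite modn_small //; lia.
have -> : (k + r = (k + r - h) + h)%N by lia.
by rewrite modnDr modn_small; lia.
Qed.

(** Half the squared length of the simple root alpha_i, so that q_i = q^(dd i). Below, [W i y] is
    the contribution of a part y to the weight, and [AA] is the symmetrised Cartan matrix. *)
Definition dd i : nat := if i == 0%N then 1 else if i == n then 4 else 2.
Definition W i y : int := 2 * (bq i y - bq i.+1 y).
Definition AA i j : int := W i j - W i j.+1.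

Lemma W0 i : W i 0 = 0.
Proof. by rewrite /W /bq !mod0n !addn0 /dvdn !subrr. Qed.

Lemma bq_mod k x y : (x = y %[mod h])%N -> bq k x = bq k y.
Proof. by move=> e; rewrite /bq e /dvdn -modnDmr e modnDmr. Qed.

Lemma bqC k y : bq k y = bq y k.
Proof. by rewrite /bq eq_sym addnC. Qed.

Lemma bq_opp k x y : (h %| x + y)%N -> bq k x = - bq k y.
Proof.
move=> xy; have e0 : ((x + y) %% h = 0)%N by apply/eqP.
have E1 : (k %% h == x %% h)%N = (h %| k + y)%N by rewrite -(eqn_modDr y) e0.
have E2 : (k %% h == y %% h)%N = (h %| k + x)%N.
  by rewrite -(eqn_modDr x) [(y + x)%N]addnC e0.
by rewrite /bq E1 E2 opprB.
Qed.

Lemma W_dvd i y : (h %| y)%N -> W i y = 0.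
Proof.
move=> hy; have e : (y = 0 %[mod h])%N by rewrite mod0n; apply/eqP.
by rewrite -(W0 i) /W !(bq_mod _ e).
Qed.

(** A move of residue j has x congruent to j or to -(j + 1); negation exchanges the two cases and
    [bq] is odd. *)
Lemma W_ed i j x : (j <= n)%N -> ed j x -> W i x - W i x.+1 = AA i j.
Proof.
move=> nj; rewrite edE // /AA /W => /orP[] /eqP e.
  have e1 : (x = j %[mod h])%N by rewrite e modn_small // /hh; lia.
  have e2 : (x.+1 = j.+1 %[mod h])%N by rewrite -addn1 -modnDml e1 modnDml addn1.
  by rewrite !(bq_mod _ e1) !(bq_mod _ e2).
have d : (h %| x + j.+1)%N.
  by rewrite /dvdn -modnDml addnS e -/h modnn.
have d1 : (h %| x.+1 + j)%N by rewrite addSnnS.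
by rewrite !(bq_opp _ d) !(bq_opp _ d1); ring.
Qed.

Lemma AA_sym i j : AA i j = AA j i.
Proof.
by rewrite /AA /W [bq j i]bqC [bq j i.+1]bqC [bq j.+1 i]bqC [bq j.+1 i.+1]bqC; ring.
Qed.

Lemma bq_diag k : (k < h)%N -> bq k k = (k != 0%N)%:Z.
Proof. by move=> kh; rewrite bqE // modn_small // eqxx; move: kh; rewrite /hh; lia. Qed.

Lemma AA_diag i : (i <= n)%N -> AA i i = (2 * dd i)%N%:Z.
Proof.
move=> ni; rewrite /AA /W /dd [bq i.+1 i]bqC !bq_diag; try (rewrite /hh; lia).
have -> : bq i i.+1 = - (i == n)%:Z.
  by rewrite bqE ?modn_small; rewrite /hh; lia.
by case: (eqVneq i 0%N) => [->|]; case: (eqVneq i n) => //; lia.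
Qed.

Lemma WE0 y : W 0 y = 2 * (y %% h == n.*2)%N%:Z - 2 * (y %% h == 1)%N%:Z.
Proof.
rewrite /W (_ : bq 0 y = 0); last by rewrite /bq mod0n eq_sym; ring.
rewrite bqE; last by rewrite /hh; lia.
have -> : (1 + y %% h == 0)%N = false by [].
have -> : (1 + y %% h == h)%N = (y %% h == n.*2)%N by rewrite /hh; lia.
by rewrite eq_sym /=; ring.
Qed.

Lemma WE i y : (0 < i <= n)%N -> (0 < y)%N ->
  W i y = (dd i)%:Z * ((ed i y)%:Z - (ed i y.-1)%:Z).
Proof.
move=> /andP[i0 ni] y0; have ih : (i < h)%N by rewrite /hh; lia.
have ih1 : (i.+1 < h)%N by rewrite /hh; lia.
rewrite /W /dd !bqE // !edE //.
rewrite (gtn_eqF i0); case: y y0 => [//|y] _ /=; rewrite modhS.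
have lt : (y %% h < h)%N by rewrite ltn_mod.
move: (y %% h)%N lt => r lt.
have [e|ne] := eqVneq r.+1 h.
  have -> : r = n.*2 by move: e; rewrite /hh; lia.
  rewrite /hh; case: eqP; lia.
have -> : (i + r.+1 == 0)%N = false by lia.
have -> : (i + r.+1 == h)%N = (r + i == n.*2)%N by rewrite /hh; lia.
have -> : ((i + r.+1).+1 == h)%N = (r.+1 + i == n.*2)%N by rewrite /hh; lia.
rewrite eqSS ![_ == r]eq_sym [i == r.+1]eq_sym /=.
case: (eqVneq i n) => [->|ne2].
  have -> : (r + n == n.*2)%N = (r == n) by lia.
  have -> : (r.+1 + n == n.*2)%N = (r.+1 == n) by lia.
  by rewrite !orbb; ring.
have [r1|] := eqVneq r.+1 i; have [r2|] := eqVneq (r.+1 + i)%N n.*2;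
  have [r3|] := eqVneq r i; have [r4|] := eqVneq (r + i)%N n.*2; move=> /=; lia.
Qed.

(** The weight of the parts below x, which is the exponent in f_i. The extra 1 for i = 0 is the
    weight of the empty partition, placed as if it came from a part 0. *)
Definition wl i x l : int :=
  ((i == 0%N) && (0 < x)%N)%:Z + \sum_(y <- parts l) (if (y < x)%N then W i y else 0).
Definition wt i l : int := (i == 0%N)%:Z + \sum_(y <- parts l) W i y.

Lemma wl_up i j x z l : (i <= n)%N -> (j <= n)%N -> ed j x -> upok x l ->
  (z <= x)%N -> wl i z (up x l) = wl i z l.
Proof.
move=> ni nj e ux zx; rewrite /wl sum_up //=; last by rewrite W0 if_same.
have -> : (x < z)%N = false by lia.
have -> : (x.+1 < z)%N = false by lia.
by rewrite subr0 addr0.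
Qed.

(** For z = x + 1 the new part x + 1 is not counted in [wl]; this does no harm when h divides it,
    because [W] vanishes on multiples of h. *)
Lemma wl_up_gt i j x z l : (i <= n)%N -> (j <= n)%N -> ed j x -> upok x l ->
  (x < z)%N -> (z == x.+1) ==> (h %| z)%N -> wl i z (up x l) = wl i z l - AA i j.
Proof.
move=> ni nj e ux xz hz; rewrite /wl sum_up //=; last by rewrite W0 if_same.
rewrite xz -(W_ed i nj e); case: (eqVneq z x.+1) hz => [->|ne _] /=.
  rewrite ltnn addr0 => hx; rewrite -!addrA; congr (_ + (_ + _)).
  by rewrite (W_dvd i hx) subr0.
have -> : (x.+1 < z)%N by lia.
by ring.
Qed.

Lemma wl_dn i j x z l : (i <= n)%N -> (j <= n)%N -> ed j x -> dnok x l ->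
  (z <= x)%N -> wl i z (dn x l) = wl i z l.
Proof. by move=> ni nj e dx zx; rewrite -(wl_up ni nj e (upok_dn dx) zx) dnK. Qed.

Lemma wl_dn_gt i j x z l : (i <= n)%N -> (j <= n)%N -> ed j x -> dnok x l ->
  (x < z)%N -> (z == x.+1) ==> (h %| z)%N -> wl i z (dn x l) = wl i z l + AA i j.
Proof.
move=> ni nj e dx zx hz.
by rewrite -[in RHS](dnK dx) (wl_up_gt ni nj e (upok_dn dx)) // subrK.
Qed.

Lemma wt_up i j x l : (i <= n)%N -> (j <= n)%N -> ed j x -> upok x l ->
  wt i (up x l) = wt i l - AA i j.
Proof.
by move=> ni nj e ux; rewrite /wt sum_up ?W0 // -(W_ed i nj e); ring.
Qed.

Lemma wt_dn i j x l : (i <= n)%N -> (j <= n)%N -> ed j x -> dnok x l ->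
  wt i (dn x l) = wt i l + AA i j.
Proof.
by move=> ni nj e dx; rewrite -[in RHS](dnK dx) (wt_up ni nj e (upok_dn dx)) subrK.
Qed.

Lemma leq_sumn l y : y \in parts l -> (y <= sumn l)%N.
Proof. by move=> ly; rewrite (perm_sumn (perm_to_rem ly)) /= leq_addr. Qed.

Lemma upok_bound x l : upok x l -> (x <= sumn l)%N.
Proof. by case/andP=> /orP[/eqP->//|/leq_sumn]. Qed.

Lemma dnok_bound x l : dnok x l -> (x < sumn l)%N.
Proof. by case/andP=> /leq_sumn. Qed.

Lemma sumn_up x l : upok x l -> sumn (up x l) = (sumn l).+1.
Proof.
move=> ux; rewrite (perm_sumn (up_perm ux)) /=; case/andP: ux => /orP[/eqP->|lx] _.
  by rewrite rem_id ?part_neq0.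
by rewrite (perm_sumn (perm_to_rem lx)).
Qed.

Lemma sumn_dn x l : dnok x l -> (sumn (dn x l)).+1 = sumn l.
Proof. by move=> dx; rewrite -(sumn_up (upok_dn dx)) dnK. Qed.

End Edges.

(** * Partial weights and the position of the edges of each residue *)

Section SumsOverParts.
Variable n : nat.
Hypothesis n_gt0 : (0 < n)%N.
Local Notation h := (hh n).
Implicit Types (l m : hspart n) (i j k x y z : nat).

Lemma sum_eq_mult (c : int) x l :
  \sum_(y <- parts l) (if y == x then c else 0) = (mult x l)%:Z * c.
Proof.
rewrite /mult; elim: (parts l) => [|y s IH]; first by rewrite big_nil mul0r.
by rewrite big_cons IH /=; case: eqP => _; rewrite /= ?PoszD; ring.
Qed.

Lemma wlS i x l : wl i x.+1 l = wl i x l + ((i == 0%N) && (x == 0%N))%:Z + (mult x l)%:Z * W n i x.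
Proof.
rewrite /wl -sum_eq_mult -[RHS]addrA [RHS]addrACA -big_split /=; congr (_ + _).
  by case: i => [|i] /=; case: x.
apply: eq_bigr => y _; rewrite ltnS leq_eqVlt; case: (eqVneq y x) => [->|_] /=.
  by rewrite ltnn add0r.
by rewrite addr0.
Qed.

Lemma wl0 i l : wl i 0 l = 0.
Proof. by rewrite /wl andbF big1. Qed.

Lemma wl_wt i x l : (sumn l < x)%N -> wl i x l = wt i l.
Proof.
move=> lx; rewrite /wl /wt; congr (_ + _); first by rewrite (leq_ltn_trans _ lx) ?andbT.
rewrite [LHS]big_seq [RHS]big_seq; apply: eq_bigr => y ly.
by rewrite (leq_ltn_trans (leq_sumn ly) lx).
Qed.

Lemma mult_gt_sumn x l : (sumn l < x)%N -> mult x l = 0%N.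
Proof.
by move=> lx; apply/eqP; rewrite -leqn0 leqNgt -mem_mult; apply/negP => /leq_sumn; lia.
Qed.

(** For i > 0 the moves of residue i are isolated, while those of residue 0 come in pairs around the
    positive multiples of h. This is why residue 0 is treated apart throughout. *)
Lemma edS_disj i x : (0 < i <= n)%N -> ed n i x -> ed n i x.+1 = false.
Proof.
move=> /andP[i0 ni]; rewrite !edE // modhS // => H; apply/negbTE; move: H.
have := ltn_mod x h; case: (eqVneq (x %% h).+1 h); rewrite /hh; lia.
Qed.

Lemma ed_mid_dvd i x : (0 < i <= n)%N -> ed n i x -> (h %| x)%N = false.
Proof. by move=> /andP[i0 ni]; rewrite !edE // /dvdn; case: eqP => [->|//]; lia. Qed.

Lemma ed_mid_dvdS i x : (0 < i <= n)%N -> ed n i x -> (h %| x.+1)%N = false.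
Proof.
move=> /andP[i0 ni]; rewrite !edE // /dvdn modhS //.
by case: (eqVneq (x %% h).+1 h) => //; rewrite /hh; lia.
Qed.

Lemma ed0E x : ed n 0 x = (h %| x)%N || (h %| x.+1)%N.
Proof.
rewrite edE // /dvdn modhS // addn0; congr orb.
by case: (eqVneq (x %% h).+1 h); rewrite /hh; lia.
Qed.

End SumsOverParts.

(** * The operators f_i, their adjoints, and the commutation off the diagonal *)

Section Operators.
Variables (n : nat) (F : fieldType) (v : F).
Local Notation h := (hh n).
Implicit Types (l m : hspart n) (i j k x y z : nat) (u : hspart n -> F).

Definition beta k : F := 1 - (- v ^+ 2) ^+ k.
(** The factor of N_0 at a column mh + 1: before the move there was one more part x than in m. The
    v^-1 makes up for the difference between [wl] and the exponent of the definition, see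
    [count_nodes]. In [loce] the factor is distributed so that [loc_normc] holds. *)
Definition locf x m : F :=
  if (0 < x)%N && (h %| x)%N then v^-1 * beta (mult x m).+1 else 1.
Definition loce x l : F :=
  if (0 < x)%N && (h %| x)%N then v^-1
  else if (h %| x.+1)%N then beta (mult x.+1 l).+1 else 1.

(* The matrix of f_i acting on coefficients, and the transposed matrix for the
   norm <l, l> = \prod_x beta 1 ... beta (mult x l), x ranging over the
   multiples of h. *)
Definition fop i u m : F :=
  \sum_(0 <= x < (sumn m).+1 | ed n i x && dnok x m)
    v ^ wl i x m * locf x m * u (dn x m).
Definition fadj i u l : F :=
  \sum_(0 <= x < (sumn l).+1 | ed n i x && upok x l)
    v ^ wl i x l * loce x l * u (up x l).

(** Moves beyond the size of the partition are impossible, so the range can be enlarged, and sums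
    belonging to different partitions share one range. *)
Lemma fopE N i u m : (sumn m < N)%N ->
  fop i u m = \sum_(x < N) if ed n i x && dnok x m
                           then v ^ wl i x m * locf x m * u (dn x m) else 0.
Proof.
move=> mN; rewrite /fop -[RHS](big_mkord xpredT (fun x => if ed n i x && dnok x m
  then v ^ wl i x m * locf x m * u (dn x m) else 0)).
rewrite -big_mkcond /= (big_nat_widen _ _ _ _ _ mN); apply: eq_bigl => x.
by apply: andb_idr => /andP[_ /dnok_bound]; lia.
Qed.

Lemma fadjE N i u l : (sumn l < N)%N ->
  fadj i u l = \sum_(x < N) if ed n i x && upok x l
                            then v ^ wl i x l * loce x l * u (up x l) else 0.
Proof.
move=> mN; rewrite /fadj -[RHS](big_mkord xpredT (fun x => if ed n i x && upok x l
  then v ^ wl i x l * loce x l * u (up x l) else 0)).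
rewrite -big_mkcond /= (big_nat_widen _ _ _ _ _ mN); apply: eq_bigl => x.
by apply: andb_idr => /andP[_ /upok_bound].
Qed.

Hypotheses (n_gt0 : (0 < n)%N) (v0 : v != 0).

(** One move affects the factor of the other only when z = x + 1 is a multiple of h, and then both
    orders see the multiplicity of z raised by 1. *)
Lemma loc_comm x z l : x != z -> upok x l -> dnok z (up x l) -> dnok z l ->
    upok x (dn z l) ->
  loce x l * locf z (up x l) = locf z l * loce x (dn z l).
Proof.
move=> xz ux dz dzl uxl; rewrite /locf /loce.
have [zx|zx] := eqVneq z x.+1.
  subst z => /=; case: (boolP (h %| x.+1)%N) => hx.
    have -> : (h %| x)%N = false.
      apply/negP => /(hnS) ; rewrite hx (gtn_eqF n_gt0) //.
    have e1 : mult x.+1 (up x l) = (mult x.+1 l).+1 by apply: mult_up_tgt.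
    have e2 : mult x.+1 (dn x.+1 l) = (mult x.+1 l).+1.
      by have := mult_dn dzl (ltn0Sn x); rewrite eqxx (ltn_eqF (ltnSn _)); lia.
    by rewrite !andbF e1 e2; ring.
  by rewrite mulr1 mul1r.
have md : mult x.+1 (dn z l) = mult x.+1 l.
  have := mult_dn dzl (ltn0Sn x); rewrite eqSS (negPf xz) eq_sym (negPf zx); lia.
have zx' : z != x by rewrite eq_sym.
rewrite md (mult_up_far ux zx' zx).
by case: ifP => hx; case: ifP => hz; rewrite ?mulr1 ?mul1r //; apply: mulrC.
Qed.

(** Only the move in the larger column sees the other one. Whichever it is, exchanging the two moves
    costs the same [AA i j]. *)
Lemma wl_comm i j x z l : (i <= n)%N -> (j <= n)%N -> x != z -> ed n i x -> ed n j z ->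
  upok x l -> dnok z (up x l) -> dnok z l -> upok x (dn z l) ->
  wl i x l + wl j z (up x l) = - AA n i j + (wl j z l + wl i x (dn z l)).
Proof.
move=> ni nj xz ex ez ux dz dzl uxl.
case: (ltngtP x z) xz => // xz _.
- rewrite (wl_dn n_gt0 ni nj ez dzl (ltnW xz)).
  rewrite (wl_up_gt n_gt0 nj ni ex ux xz); first by rewrite [AA n j i]AA_sym; ring.
  apply/implyP => /eqP zx; subst z; apply: contraT => hx.
  move: (dz); rewrite /dnok => /andP[_]; rewrite mem_up_tgt //= => hx'.
  by rewrite hx' in hx.
- rewrite (wl_up n_gt0 nj ni ex ux (ltnW xz)).
  rewrite (wl_dn_gt n_gt0 ni nj ez dzl xz); first by ring.
  apply/implyP => /eqP zx; subst x; apply: contraT => hx.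
  move: (ux) (dzl) (uxl) (dz); rewrite /upok /= => /andP[l1 _] _ /andP[].
  by rewrite mem_dn_src // ltnNge mult_le1.
Qed.

Definition diag i x l : F :=
  if ed n i x then
    (if upok x l then v ^ wl i x l * v ^ wl i x l * (loce x l * locf x (up x l)) else 0)
    - v ^- (2 * dd n i) *
      (if dnok x l then v ^ wl i x l * v ^ wl i x l * (locf x l * loce x (dn x l)) else 0)
  else 0.

(** Both compositions are expanded over pairs (x, z) of moves. The terms with x <> z agree up to the
    constant power of v; those with x = z return to l and leave the scalars [diag]. *)
Lemma fadj_fop i j u l : (i <= n)%N -> (j <= n)%N ->
  fadj i (fop j u) l = v ^ (- AA n i j) * fop j (fadj i u) l +
    (if i == j then \sum_(x < (sumn l).+2) diag i x l else 0) * u l.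
Proof.
move=> ni nj; set N := (sumn l).+2.
pose c x z := [&& ed n i x, ed n j z, upok x l & dnok z (up x l)].
pose T x z := if c x z then
  v ^ wl i x l * loce x l * (v ^ wl j z (up x l) * locf z (up x l) * u (dn z (up x l))) else 0.
pose d x z := [&& ed n i x, ed n j z, dnok z l & upok x (dn z l)].
pose S x z := if d x z then
  v ^ wl j z l * locf z l * (v ^ wl i x (dn z l) * loce x (dn z l) * u (up x (dn z l))) else 0.
have -> : fadj i (fop j u) l = \sum_(x < N) \sum_(z < N) T x z.
  rewrite (fadjE (N := N)) //; apply: eq_bigr => x _.
  case: (boolP (ed n i x && upok x l)) => [/andP[ex ux]|nc]; last first.
    rewrite big1 // => z _; rewrite /T /c; case: ifP => // /and4P[ex _ ux _].
    by rewrite ex ux in nc.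
  rewrite (fopE (N := N)) ?sumn_up // big_distrr; apply: eq_bigr => z _.
  by rewrite /T /c ex ux /=; case: ifP; rewrite ?mulr0.
have -> : fop j (fadj i u) l = \sum_(x < N) \sum_(z < N) S x z.
  rewrite exchange_big (fopE (N := N)) //; apply: eq_bigr => z _.
  case: (boolP (ed n j z && dnok z l)) => [/andP[ex ux]|nc]; last first.
    rewrite big1 // => x _; rewrite /S /d; case: ifP => // /and4P[_ ex ux _].
    by rewrite ex ux in nc.
  rewrite (fadjE (N := N)); last by have := sumn_dn ux; rewrite /N; lia.
  rewrite big_distrr; apply: eq_bigr => x _.
  by rewrite /S /d ex ux /=; case: ifP; rewrite ?mulr0.
have TS (x z : 'I_N) : x != z -> T x z = v ^ (- AA n i j) * S x z.
  move=> xz; have xz' : (x != z :> nat) by [].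
  have cd : c x z = d x z.
    by rewrite /c /d; do 2![case: (ed _ _ _) => //=]; apply: up_dn_ok.
  rewrite /T /S -cd; case: ifP => [cxz|_]; last by rewrite mulr0.
  have /and4P[ex ez dzl uxl] : d x z by rewrite -cd.
  have /and4P[_ _ ux dz] := cxz.
  rewrite up_dnC // !mulrA; congr (_ * _).
  transitivity (v ^ (wl i x l + wl j z (up x l)) * (loce x l * locf z (up x l))).
    by rewrite expfzDr //; ring.
  by rewrite loc_comm // (wl_comm ni nj xz') // !expfzDr //; ring.
(* A move has only one residue, so the terms with x = z vanish unless i = j. *)
have TSd (x : 'I_N) : T x x - v ^ (- AA n i j) * S x x = (if i == j then diag i x l else 0) * u l.
  rewrite /T /S /c /d /diag; case: (eqVneq i j) => [eij|ne]; last first.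
    case: (boolP (ed n i x)) => ex; last by rewrite !mulr0 mul0r subr0.
    case: (boolP (ed n j x)) => ex' /=; last by rewrite !mulr0 mul0r subr0.
    by case/eqP: ne; apply: ed_inj ex ex'.
  subst j; case: (boolP (ed n i x)) => ex /=; last by rewrite mulr0 mul0r subr0.
  rewrite AA_diag //.
  have -> : upok x l && dnok x (up x l) = upok x l by apply: andb_idr; apply: dnok_up.
  have -> : dnok x l && upok x (dn x l) = dnok x l by apply: andb_idr; apply: upok_dn.
  rewrite mulrBl; congr (_ - _).
    case: ifP => // ux; last by rewrite mul0r.
    by rewrite upK // (wl_up n_gt0 ni ni ex ux) //; ring.
  rewrite exprnN -[RHS]mulrA; congr (_ * _); case: ifP => // dx; last by rewrite mul0r.
  by rewrite dnK // (wl_dn n_gt0 ni ni ex dx) //; ring.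
apply/eqP; rewrite addrC -subr_eq big_distrr -sumrB /=; apply/eqP.
have -> : (if i == j then \sum_(x < N) diag i x l else 0) =
          \sum_(x < N) (if i == j then diag i x l else 0).
  by case: (i == j) => //; rewrite big1.
rewrite big_distrl; apply: eq_bigr => x _ /=.
rewrite big_distrr -sumrB (bigD1 x) //= TSd big1 ?addr0 //.
by move=> z zx; rewrite TS 1?eq_sym // subrr.
Qed.

End Operators.

(** * The diagonal terms sum to the q-integer of the weight *)

Section Diagonal.
Variables (n : nat) (F : fieldType) (v : F).
Hypotheses (n_gt0 : (0 < n)%N) (v0 : v != 0).
Local Notation h := (hh n).
Implicit Types (l m : hspart n) (i j k x y z : nat) (u : hspart n -> F).

(** The function [psi] is [wl] with each edge counted as a whole: at a cut between x and x + 1 the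
    upper end x + 1 is included too. With this correction the diagonal terms telescope. *)
Lemma diag_mid_step i x l (psi : nat -> int) : (0 < i <= n)%N ->
    (forall z, psi z = wl i z l - (if (0 < z)%N && ed n i z.-1 then (dd n i * mult z l)%N%:Z else 0)) ->
  (v ^+ (2 * dd n i) - 1) * diag v i x l = (v ^ psi x.+1) ^+ 2 - (v ^ psi x) ^+ 2.
Proof.
move=> ni psiE; rewrite !psiE /= wlS /diag.
have -> : (i == 0%N) && (x == 0%N) = false by case: (i) ni.
have [->|x0] := posnP x.
  have -> : ed n i 0 = false by rewrite edE ?mod0n; move: ni; lia.
  by rewrite mult0 /= mulr0 mul0r !addr0 ?subr0 subrr.
rewrite (WE n_gt0 ni x0) /=; have [ex|nex] := boolP (ed n i x); last first.
  rewrite mulr0; case: (ed n i x.-1); rewrite /= ?subr0 ?subrr ?mulr0 ?addr0 ?subrr //.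
  by apply/eqP; rewrite eq_sym subr_eq0; apply/eqP; congr ((v ^ _) ^+ 2); rewrite PoszM; ring.
have -> : ed n i x.-1 = false.
  apply: contraTF ex => ex; by rewrite -[x](prednK x0) (edS_disj n_gt0 ni ex).
have hx := ed_mid_dvd n_gt0 ni ex; have hx1 := ed_mid_dvdS n_gt0 ni ex.
rewrite ?subr0 ?addr0 /upok /dnok !mem_mult hx hx1 !orbF (gtn_eqF x0) /= /loce /locf hx hx1 !andbF.
set V := v ^ wl i x l; set d := dd n i.
have vd : v ^+ d != 0 by rewrite expf_neq0.
have e2 : v ^+ (2 * d) = (v ^+ d) ^+ 2 by rewrite mulnC exprM.
have [->|->] := mult01 l hx; have [->|->] := mult01 l hx1; rewrite /= ?mul0r ?mulr0 ?muln0 ?muln1 ?mul1r ?mulr1 ?addr0 ?subr0 ?sub0r ?mulr0 ?subrr //.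
- rewrite expfzDr // -/V -exprnN e2; field.
  by rewrite vd.
- by rewrite expfzDr // -/V -exprnP e2; ring.
- by rewrite addrK subrr.
Qed.

(** Both moves around the multiple x of h depend on its multiplicity, and it is their sum that
    telescopes. The identity holds with the power of -v^2 given by the multiplicity replaced by a
    free variable. *)
Lemma ed0_two x l : (0 < x)%N -> (h %| x)%N ->
  (v ^+ 2 - 1) * (diag v 0 x.-1 l + diag v 0 x l) =
  (v ^ wl 0 x.+2 l) ^+ 2 - (v ^ wl 0 x.-1 l) ^+ 2.
Proof.
case: x => [//|x] _ hx /=.
have hx0 : (h %| x)%N = false.
  by apply/negP => /hnS; rewrite hx (gtn_eqF n_gt0).
have hx2 : (h %| x.+2)%N = false.
  by apply/negP => H; have := hnS hx; rewrite H (gtn_eqF n_gt0).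
have x0 : (0 < x)%N by case: (x) hx0.
have rx : (x %% h = n.*2)%N.
  have := ed0E n_gt0 x; rewrite hx orbT edE // addn0 => /orP[/eqP r0|/eqP //].
  by move: hx0; rewrite /dvdn r0.
have e2 : W n 0 x.+2 = - 2.
  rewrite WE0 // !modhS // rx; have -> : n.*2.+1 == h by [].
  by rewrite /hh; move: n_gt0; case: (n).
have e1 : W n 0 x.+1 = 0 by apply: W_dvd.
have e0 : W n 0 x = 2.
  by rewrite WE0 // rx eqxx; move: n_gt0; case: (n) => // k _; rewrite doubleS.
rewrite !wlS e0 e1 e2 (gtn_eqF x0) /= !addr0 mulr0 addr0.
rewrite /diag !ed0E // hx hx0 hx2 /= ?orbT /upok /dnok !mem_mult hx hx0 hx2 ?orbT ?orbF /= (gtn_eqF x0) /=.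
set V := v ^ wl 0 x l.
rewrite /loce /locf hx hx0 hx2 x0 /= ?andbF /=.
have w1 : v ^ wl 0 x.+1 l = V * v ^ ((mult x l)%:Z * 2).
  by rewrite -expfzDr // wlS e0 (gtn_eqF x0) /= addr0.
rewrite w1 (@expfzDr _ v (wl 0 x l + (mult x l)%:Z * 2)) // (@expfzDr _ v (wl 0 x l)) // -/V /dd eqxx muln1.
have bS k : beta v k.+1 = 1 + v ^+ 2 * (- v ^+ 2) ^+ k.
  by rewrite /beta exprS mulNr opprK.
have dnE : (0 < mult x.+1 l)%N -> mult x l = 0%N -> mult x.+1 (dn x l) = (mult x.+1 l).-1.
  move=> m1 m0; have dx : dnok x l by rewrite /dnok !mem_mult m1 m0.
  by rewrite -(mult_dn_src dx).
have upE : (0 < mult x.+1 l)%N -> mult x.+2 l = 0%N ->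
    mult x.+1 (up x.+1 l) = (mult x.+1 l).-1.
  move=> m1 m0; have ux : upok x.+1 l by rewrite /upok !mem_mult m1 m0.
  by rewrite -(mult_up_src ux isT).
have [ma|ma] := mult01 l hx0; have [mc|mc] := mult01 l hx2; move: dnE upE; rewrite ma mc /=;
  case: (mult x.+1 l) => [|b] /= dnE upE; rewrite ?dnE ?upE // ?mul0r ?mul1r ?expr0z ?bS /=.
all: try have -> : v ^ (-2 : int) = (v ^+ 2)^-1 by [].
all: try have -> : v ^ (2 : int) = v ^+ 2 by [].
all: rewrite ?(exprS (- v ^+ 2)) ?expr0 ?mulr1; clearbody V.
all: try (move: ((- v ^+ 2) ^+ b) => g).
all: try (by field; rewrite v0).
all: by ring.
Qed.

(** The move 0 has no partner on its left; the weight of the empty partition enters [wl] between 0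
    and 1. *)
Lemma diag0_first l :
  (v ^+ 2 - 1) * diag v 0 0 l = (v ^ wl 0 2 l) ^+ 2 - 1.
Proof.
rewrite !wlS wl0 W0 /= mulr0 addr0 add0r WE0 // modn_small; last by rewrite /hh; lia.
rewrite (negPf (_ : 1%N != n.*2)) ?eqxx; last by lia.
rewrite /diag ed0E // dvdn0 /= /upok /dnok /= part_neq0 /= !wl0 expr0z /loce /locf /= /dd eqxx muln1.
have h1 : (h %| 1)%N = false by rewrite dvdn1 /hh; lia.
rewrite h1 orbF mem_mult andbT; have [->|->] := mult01 l h1; rewrite /=.
  by rewrite mul0r addr0 -exprnP; ring.
have -> : 1%Z + 1%:Z * (2 * 0%Z - 2 * 1%Z) = - 1 by [].
by rewrite exprN1; field.
Qed.

Lemma diag_out i x l : (sumn l < x)%N -> diag v i x l = 0.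
Proof.
move=> lx; rewrite /diag; case: ifP => // _.
have -> : upok x l = false by apply/negP => /upok_bound; lia.
have -> : dnok x l = false by apply/negP => /dnok_bound; lia.
by rewrite mulr0 subr0.
Qed.

(** When h divides N the cut separates the two moves of a pair, and the term of the first one is
    left over. When N is 1 modulo h the pair is complete, but its last part N still has to be
    counted. *)
Lemma diag0_partial N l : (v ^+ 2 - 1) * (\sum_(x < N) diag v 0 x l) =
  if N == 0%N then 0 else
  if (N %% h == 0)%N then (v ^ wl 0 N.-1 l) ^+ 2 - 1 + (v ^+ 2 - 1) * diag v 0 N.-1 l
  else (v ^ wl 0 (if N %% h == 1 then N.+1 else N)%N l) ^+ 2 - 1.
Proof.
elim: N => [|N IH]; first by rewrite big_ord0 mulr0.
rewrite big_ord_recr /= mulrDr IH {IH} modhS //.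
have [->|N0] := eqVneq N 0%N.
  rewrite mod0n (negPf (_ : 1%N != h)) /=; last by rewrite /hh; lia.
  by rewrite ?eqxx diag0_first add0r.
have [rh|rh] := eqVneq (N %% h).+1 h.
  rewrite ?eqxx; have -> : (N %% h == 0)%N = false by move: rh; rewrite /hh; lia.
  have -> : (N %% h == 1)%N = (n.*2 == 1)%N by move: rh; rewrite /hh; lia.
  by have -> : (n.*2 == 1)%N = false by lia.
rewrite /=; have [r0|r0] := eqVneq (N %% h)%N 0%N.
  rewrite ?r0 ?eqxx -addrA -mulrDr ed0_two ?lt0n //; last by apply/eqP.
  by ring.
have nd : diag v 0 N l = 0.
  rewrite /diag ed0E // /dvdn modhS // (negPf r0) (negPf rh).
  by [].
rewrite nd mulr0 addr0 eqSS (negPf r0); have [r1|r1] := eqVneq (N %% h)%N 1%N; first by [].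
rewrite wlS (WE0 n_gt0) (negPf r1) (negPf N0) /=.
have -> : (N %% h == n.*2)%N = false by move: rh; rewrite /hh; lia.
by congr ((v ^ _) ^+ 2 - 1) => /=; ring.
Qed.

(** The differences telescope from [wl] at 0, which vanishes, to [wl] beyond the size, which is
    [wt]. *)
Lemma diag_sum i l : (i <= n)%N ->
  (v ^+ (2 * dd n i) - 1) * (\sum_(x < (sumn l).+2) diag v i x l) = (v ^ wt i l) ^+ 2 - 1.
Proof.
move=> ni; have [->|i0] := posnP i.
  rewrite /dd eqxx muln1 diag0_partial /=; case: ifP => _.
    by rewrite diag_out // mulr0 addr0 wl_wt.
  by rewrite wl_wt //; case: ifP => // _; apply: leqW.
pose psi z := wl i z l - (if (0 < z)%N && ed n i z.-1 then (dd n i * mult z l)%N%:Z else 0).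
have H N : (v ^+ (2 * dd n i) - 1) * (\sum_(x < N) diag v i x l) = (v ^ psi N) ^+ 2 - 1.
  elim: N => [|N IH]; first by rewrite big_ord0 mulr0 /psi wl0 subr0 expr0z expr1n subrr.
  rewrite big_ord_recr /= mulrDr IH (@diag_mid_step i N l psi) ?i0 //.
  by ring.
rewrite H /psi mult_gt_sumn // muln0 if_same subr0 wl_wt //.
Qed.

End Diagonal.

(** * Column lengths, and the addable and removable nodes *)

Section Heights.
Local Open Scope nat_scope.
Variable n : nat.
Local Notation h := (hh n).
Implicit Types (l m k : hspart n) (i c r x y : nat).

(** The length of column c. Diagrams are compared by columns because residues depend on the column
    only. *)
Definition height l c : nat := count (leq c) l.

Lemma heightS l c : height l c = mult c l + height l c.+1.
Proof.
rewrite /height /mult; elim: (parts l) => //= y s ->.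
by rewrite addnACA; congr (_ + _); rewrite leq_eqVlt eq_sym; case: eqP => [->|] /=; rewrite ?ltnn.
Qed.

Lemma height_gt l c : sumn l < c -> height l c = 0.
Proof.
move=> lc; rewrite /height; apply/eqP; rewrite -leqn0 leqNgt -has_count.
by apply/hasPn => y /leq_sumn; lia.
Qed.

Lemma leq_nth l r c : 0 < c -> (c <= nth 0 l r) = (r < height l c).
Proof.
move=> c0; rewrite /height; elim: (parts l) (parts_sorted l) r => [|y s IH] ys r.
  by rewrite nth_nil leqn0 (gtn_eqF c0).
have := order_path_min (@geq_trans) ys => /allP ymax.
have s0 : y < c -> count (leq c) s = 0.
  by move=> yc; rewrite (@eq_in_count _ _ pred0) ?count_pred0 // => z /ymax /=; lia.
case: r => [|r] /=; rewrite ?(IH (path_sorted ys)).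
  by case: (leqP c y) => cy; [rewrite add1n | rewrite s0].
by case: (leqP c y) => cy; [rewrite add1n | rewrite s0].
Qed.

Lemma diagramE l r c : diagram l (r, c) <-> 0 < c /\ r < height l c.
Proof.
rewrite /diagram /=; split=> [/andP[c0 H]|[c0 H]]; first by rewrite -leq_nth.
by rewrite c0 leq_nth.
Qed.

Lemma diagram_subset l m : (diagram m `<=` diagram l)%classic <->
  forall c, 0 < c -> height m c <= height l c.
Proof.
split=> [H c c0|H [r c] /diagramE[c0 rm]]; last first.
  by apply/diagramE; split=> //; apply: leq_trans (H c c0).
rewrite leqNgt; apply/negP => lt; have /H/diagramE[_] : diagram m (height l c, c).
  exact/diagramE.
by rewrite ltnn.
Qed.

Lemma removable_toP i l m : removable_to i l m <->
  forall c, 0 < c -> height m c <= height l c /\ (residue n c != i -> height m c = height l c).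
Proof.
split=> [[/diagram_subset H1 H2] c c0|H].
  split=> [|ci]; first exact: H1.
  apply/eqP; rewrite eqn_leq H1 //= leqNgt; apply/negP => lt.
  have /H2 /= : (diagram l `\` diagram m)%classic (height m c, c).
    by split; [apply/diagramE | move/diagramE => []; rewrite ltnn].
  by apply/eqP.
split; first by apply/diagram_subset => c /H[].
move=> [r c] [/diagramE[c0 rl] nm]; rewrite /inodes /=; apply/eqP/contraT => ci.
case: nm; apply/diagramE; split=> //; by have [_ ->] := H c c0.
Qed.

Fixpoint hseq (g : nat -> nat) M : seq nat :=
  if M is M'.+1 then nseq (g M - g M.+1) M ++ hseq g M' else [::].

Lemma mult_hseq g M y : mult y (hseq g M) = if 0 < y <= M then g y - g y.+1 else 0.
Proof.
elim: M => [|M IH] /=; first by case: y.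
rewrite /mult count_cat count_nseq /= -/(mult _ _) IH.
by case: (eqVneq M.+1 y) => [<-|ne]; rewrite ?mul1n ?mul0n ?ltnn ?leqnn ?andbF ?addn0 //=;
  congr (if _ then _ else _); lia.
Qed.

(** Serves to construct the extremal partitions in which all possible i-nodes are added, or removed,
    at once. *)
Lemma height_exists (g : nat -> nat) M :
    (forall c, 0 < c -> g c.+1 <= g c) -> (forall c, ~~ (h %| c) -> g c <= (g c.+1).+1) ->
    (forall c, M < c -> g c = 0) ->
  exists m : hspart n, forall c, 0 < c -> height m c = g c.
Proof.
move=> gdec gstrict gM.
have pm : perm_eq (mkhs n (hseq g M)) (hseq g M).
  apply: mkhs_perm => [|y /gstrict hy]; first by rewrite mem_mult mult_hseq.
  by rewrite mult_hseq; case: ifP => // _; lia.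
exists (mkhs n (hseq g M)) => c c0.
pose N := M + sumn (mkhs n (hseq g M)); have [Nc|cN] := ltnP N c.
  by rewrite height_gt ?gM //; move: Nc; rewrite /N; lia.
have [e] : exists e, c + e = N.+1 by exists (N.+1 - c); lia.
elim: e c c0 {cN} => [|e IH] c c0 ce.
  by rewrite height_gt ?gM //; move: ce; rewrite /N; lia.
rewrite heightS IH //; last by lia.
rewrite (mult_perm _ pm) mult_hseq c0 /=; case: leqP => cM; first by have := gdec c c0; lia.
by rewrite !gM // ltnW.
Qed.

Lemma height_le1 l c : ~~ (h %| c) -> height l c <= (height l c.+1).+1.
Proof. by move=> hc; have := mult_le1 l hc; rewrite [height l c]heightS; lia. Qed.

Lemma height_dec l c : height l c.+1 <= height l c.
Proof. by rewrite [height l c]heightS leq_addl. Qed.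

Lemma height_notin l c : (c \notin parts l) = (height l c == height l c.+1).
Proof. by rewrite mem_mult [height l c]heightS; lia. Qed.

Lemma height_in l c : (c \in parts l) = (height l c.+1 < height l c).
Proof. by rewrite mem_mult [height l c]heightS; lia. Qed.

(** At most one node of each column is addable, and at most one removable, so such nodes can be
    counted by columns. *)
Lemma count_leftE (A : set (nat * nat)) (P : pred nat) (f : nat -> nat) c :
    (forall r d, A (r, d) <-> [/\ 0 < d, P d & r = f d]) ->
  count_left c A = \sum_(x < c.-1) P x.+1.
Proof.
move=> AP; rewrite /count_left.
pose s := [seq (f d, d) | d <- iota 1 c.-1 & P d].
have -> : (A `&` [set x | x.2 < c])%classic = [set` [fset x in s]%fset]%classic.
  apply/seteqP; split=> [[r d] [/AP[d0 Pd ->] /= dc]|[r d] /=]; rewrite /= inE.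
    by apply/mapP; exists d => //; rewrite mem_filter Pd mem_iota; lia.
  move=> /mapP[e]; rewrite mem_filter mem_iota => /andP[Pe ec] [-> ->].
  by split; [apply/AP; split=> //; lia | rewrite /=; lia].
rewrite set_fsetK card_fseq undup_id; last first.
  by rewrite map_inj_uniq ?filter_uniq ?iota_uniq // => x y [].
rewrite size_map size_filter -sum1_count big_mkcond /=.
rewrite (iotaDl 1 0) big_map.
rewrite -(big_mkord xpredT (fun x => nat_of_bool (P x.+1))) /index_iota subn0.
by apply: eq_bigr => x _; rewrite add1n; case: (P _).
Qed.

Hypothesis n_gt0 : 0 < n.

Lemma residue0E c : 0 < c -> (residue n c == 0) = (h %| c.-1) || (h %| c).
Proof. by case: c => // c _; have := ed0E n_gt0 c. Qed.

Lemma residue_mid c i : 0 < c -> 0 < i <= n -> residue n c == i ->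
  [/\ (residue n c.+1 == i) = false, 1 < c, (residue n c.-1 == i) = false,
      (h %| c.-1) = false & (h %| c) = false].
Proof.
case: c => // c _ ni e.
have c0 : 0 < c.
  case: (posnP c) e => // ->; rewrite /residue /= mod0n min0n; case/andP: ni; case: i => //.
split=> //.
- exact: (edS_disj n_gt0 ni).
- case: c c0 e => // c _ e /=; apply: contraTF e => e.
  by have := edS_disj n_gt0 ni e; rewrite /ed => ->.
- exact: (@ed_mid_dvd n n_gt0 i c ni e).
- exact: (@ed_mid_dvdS n n_gt0 i c ni e).
Qed.

(* Whether an i-node can be added, or removed, at the bottom of column c. *)
Definition addcol i l c := (residue n c == i) &&
  [|| c == 1, c.-1 \in parts l | (h %| c.-1) && (c.-2 \in parts l)] &&
  ((c \notin parts l) || (h %| c)).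
Definition remcol i l c := (residue n c == i) &&
  ((c \in parts l) || (h %| c) && (c.+1 \in parts l)) &&
  ((c.-1 \notin parts l) || (h %| c.-1)).

Lemma dvd_add1 c : h %| c -> (h %| c.+1) = false.
Proof. by move=> /hnS; rewrite (gtn_eqF n_gt0) orbF => /negbTE. Qed.

Lemma dvd_sub1 c : h %| c -> 0 < c -> (h %| c.-1) = false.
Proof. by move=> hc c0; apply/negP => /dvd_add1; rewrite prednK // hc. Qed.

Lemma residue0_cases c : 0 < c -> residue n c = 0 -> (h %| c) \/ (h %| c.-1).
Proof. by move=> c0 r0; have := residue0E c0; rewrite r0 eqxx => /esym/orP[]; [right|left]. Qed.

Lemma residue_pred c : h %| c -> 0 < c -> (residue n c.-1 == 0) = false /\ 1 < c.
Proof.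
move=> hc c0; have c1 : 1 < c by apply: leq_trans (dvdn_leq c0 hc); rewrite /hh; lia.
split=> //; rewrite residue0E; last by lia.
rewrite (dvd_sub1 hc c0) orbF; apply/negP => h2.
have e2 : 2 + c.-2 = c by lia.
have : h %| 2 by rewrite -(dvdn_addl 2 h2) e2.
by move=> /(@dvdn_leq _ 2 isT); rewrite /hh; lia.
Qed.

Lemma residue_succ c : h %| c.-1 -> 0 < c -> (residue n c.+1 == 0) = false /\ (h %| c) = false.
Proof.
case: c => // c hc _; have h1 := dvd_add1 hc; split=> //.
rewrite residue0E // h1; apply/negP => h2.
have : h %| 2 by rewrite -(dvdn_addr 2 hc) addn2.
by move=> /(@dvdn_leq _ 2 isT); rewrite /hh; lia.
Qed.

(** Columns of other residues cannot change. For i > 0 these include both neighbours of c. For i = 0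
    the columns mh and mh + 1 may grow together, and the fixed columns are mh - 1 and mh + 2. *)
Lemma height_add_bound i l k c : removable_to i k l -> i <= n -> 0 < c ->
  height k c <= height l c + addcol i l c.
Proof.
move=> /removable_toP H ni c0.
have [lek eqk] := H c c0; have [lt|] := ltnP (height l c) (height k c); last by lia.
have ci : residue n c == i by apply: contraTT lt => /eqk ->; rewrite ltnn.
have eqS1 : (residue n c.+1 == i) = false -> height k c.+1 = height l c.+1.
  by move=> e; have [_ ->] := H c.+1 isT; rewrite ?e.
have eqP1 : 1 < c -> (residue n c.-1 == i) = false -> height k c.-1 = height l c.-1.
  by move=> c1 e; have [_ ->] := H c.-1 (ltac:(lia)); rewrite ?e.
have cP := prednK c0.
rewrite /addcol ci /=; have [i0|i0] := posnP i; last first.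
  have nii : 0 < i <= n by rewrite i0.
  have [r1 c1 r2 h1 h2] := residue_mid c0 nii ci.
  rewrite h1 h2 (gtn_eqF c1) /= !orbF height_notin height_in cP.
  have e1 := eqS1 r1; have e2 := eqP1 c1 r2.
  have := height_le1 k (negbT h2); have := height_dec k c.-1; have := height_dec l c.
  rewrite cP => le1 le2 le3.
  clear H eqk eqS1 eqP1 ci nii r1 r2 h1 h2.
  have -> : height l c < height l c.-1 by lia.
  have -> : height l c == height l c.+1 by lia.
  by lia.
subst i; have [hc|hc] := residue0_cases c0 (eqP ci).
  have [r1 c1] := residue_pred hc c0; have h1 := dvd_sub1 hc c0.
  rewrite hc orbT andbT (gtn_eqF c1) h1 /= orbF height_in cP.
  have e1 := eqP1 c1 r1; have := height_le1 l (negbT h1); have := height_dec k c.-1.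
  rewrite cP => le1 le2; have -> : height l c < height l c.-1 by lia.
  by lia.
have [r1 h1] := residue_succ hc c0.
rewrite hc h1 orbF height_notin /=.
have e1 := eqS1 r1; have le1 := height_le1 k (negbT h1); have le2 := height_dec l c.
have -> : height l c == height l c.+1 by lia.
rewrite andbT; have [_|c1] := eqVneq c 1; first by rewrite /=; lia.
have [r2 c3] := residue_pred hc (ltac:(lia)).
have cP2 : c.-2.+1 = c.-1 by lia.
have [_ e2] := H c.-2 (ltac:(lia)); rewrite r2 in e2.
rewrite !height_in cP cP2 /=.
have := height_dec k c.-1; have := height_dec k c.-2.
have := height_dec l c.-1; have := height_dec l c.-2; rewrite cP cP2 => a1 a2 a3 a4.
have -> : (height l c < height l c.-1) || (height l c.-1 < height l c.-2).
  have := e2 isT; case: (ltnP (height l c)) => //=; lia.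
by lia.
Qed.

Lemma height_rem_bound i l k c : removable_to i l k -> i <= n -> 0 < c ->
  height l c <= height k c + remcol i l c.
Proof.
move=> /removable_toP H ni c0.
have [lek eqk] := H c c0; have [lt|] := ltnP (height k c) (height l c); last by lia.
have ci : residue n c == i by apply: contraTT lt => /eqk ->; rewrite ltnn.
have eqS1 : (residue n c.+1 == i) = false -> height k c.+1 = height l c.+1.
  by move=> e; have [_ ->] := H c.+1 isT; rewrite ?e.
have eqP1 : 1 < c -> (residue n c.-1 == i) = false -> height k c.-1 = height l c.-1.
  by move=> c1 e; have [_ ->] := H c.-1 (ltac:(lia)); rewrite ?e.
have cP := prednK c0.
rewrite /remcol ci /=; have [i0|i0] := posnP i; last first.
  have nii : 0 < i <= n by rewrite i0.
  have [r1 c1 r2 h1 h2] := residue_mid c0 nii ci.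
  rewrite h1 h2 /= !orbF height_notin height_in cP.
  have e1 := eqS1 r1; have e2 := eqP1 c1 r2.
  have := height_le1 k (negbT h1); have := height_dec k c; have := height_dec l c.-1.
  have := height_le1 l (negbT h2).
  rewrite cP => le1 le2 le3 le4.
  clear H eqk eqS1 eqP1 ci nii r1 r2 h1 h2.
  have -> : height l c.+1 < height l c by lia.
  have -> : height l c.-1 == height l c by lia.
  by lia.
subst i; have [hc|hc] := residue0_cases c0 (eqP ci).
  have [r1 c1] := residue_pred hc c0; have h1 := dvd_sub1 hc c0.
  rewrite hc h1 /= orbF height_notin !height_in cP.
  have e1 := eqP1 c1 r1; have := height_le1 k (negbT h1); have := height_dec l c.-1.
  have hc1 : h %| c.+1.-1 by [].
  have [r2 _] := residue_succ hc1 isT.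
  have [_ e2] := H c.+2 isT; rewrite r2 in e2.
  have := height_dec k c; have := height_dec k c.+1; have := height_dec l c; have := height_dec l c.+1.
  rewrite cP => a1 a2 a3 a4 a5 a6.
  have {}e2 := e2 isT; clear H eqk eqS1 eqP1 ci r1 r2 h1 hc hc1.
  have -> : height l c.-1 == height l c by lia.
  have -> : (height l c.+1 < height l c) || (height l c.+2 < height l c.+1).
    by case: (ltnP (height l c.+1)) => //=; lia.
  by rewrite /=; lia.
have [r1 h1] := residue_succ hc c0.
rewrite hc h1 /= !orbF orbT andbT height_in.
have e1 := eqS1 r1; have := height_le1 l (negbT h1); have := height_dec k c => le1 le2.
have -> : height l c.+1 < height l c by lia.
by lia.
Qed.

(** One direction is [height_add_bound]. For the other, adding a node to all these columns at once
    still gives an h-strict partition. *)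
Lemma addable_nodesP i l r c : i <= n ->
  addable_nodes i l (r, c) <-> [/\ 0 < c, addcol i l c & r = height l c].
Proof.
move=> ni; split=> [[m [rm [/diagramE[c0 rlt] nl]]]|[c0 ac ->]].
  have rge : height l c <= r by rewrite leqNgt; apply/negP => lt; apply: nl; apply/diagramE.
  have := height_add_bound rm ni c0; case: (addcol i l c) => ?; first by split=> //; lia.
  by lia.
have [m mE] : exists m : hspart n, forall c, 0 < c -> height m c = height l c + addcol i l c.
  apply: (@height_exists _ (sumn l).+2) => [d d0|d hd|d ld].
  - rewrite [height l d]heightS; case a1 : (addcol i l d.+1); last by lia.
    suff : (0 < mult d l) || addcol i l d by case: (addcol i l d); lia.
    move: a1; rewrite -mem_mult {1}/addcol /= => /andP[/andP[r1 a1] a2].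
    case: (d \in parts l) a1 a2 => //=; rewrite ?eqSS (gtn_eqF d0) /=.
    move=> /andP[hd ld] _; rewrite /addcol ld hd /= !orbT !andbT.
    move: r1; have := residue0E (isT : 0 < d.+1); rewrite /= hd /= => /eqP -> /eqP <-.
    by rewrite residue0E // hd orbT.
  - have := mult_le1 l hd; rewrite [height l d]heightS => m1.
    case a1 : (addcol i l d); last by lia.
    by move: a1; rewrite /addcol (negPf hd) orbF !mem_mult => /andP[_]; lia.
  - rewrite height_gt //; last by lia.
    have z y : sumn l < y -> (y \in parts l) = false.
      by move=> ly; apply/negP => /leq_sumn; lia.
    by rewrite /addcol !z; lia.
exists m; split; last by split; [apply/diagramE; rewrite mE // ac; split; lia
                               | move/diagramE => [_]; rewrite ltnn].
apply/removable_toP => d d0; rewrite mE //; split; first by lia.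
by rewrite /addcol => /negPf ->; rewrite addn0.
Qed.

Lemma remcol_height i l c : remcol i l c -> 0 < height l c.
Proof.
move=> /andP[/andP[_ H] _]; rewrite [height l c]heightS [height l c.+1]heightS.
by move: H; rewrite !mem_mult => /orP[|/andP[_]]; lia.
Qed.

(** Removing a node from all these columns at once gives an h-strict partition, and by
    [height_rem_bound] it is the smallest one, as the definition requires. *)
Lemma removable_nodesP i l r c : i <= n ->
  removable_nodes i l (r, c) <-> [/\ 0 < c, remcol i l c & r.+1 = height l c].
Proof.
move=> ni.
have [m mE] : exists m : hspart n, forall c, 0 < c -> height m c = height l c - remcol i l c.
  apply: (@height_exists _ (sumn l).+2) => [d d0|d hd|d ld].
  - rewrite [height l d]heightS; case a1 : (remcol i l d); last by lia.
    suff : (0 < mult d l) || (remcol i l d.+1) && (0 < height l d.+1).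
      by case: (remcol i l d.+1); lia.
    case: (boolP (remcol i l d.+1)) => [a2|]; first by rewrite (remcol_height a2) orbT.
    move: a1; rewrite -mem_mult /remcol => /andP[/andP[r1 a1] a2].
    case: (d \in parts l) a1 a2 => //= /andP[hd ->] _; rewrite /= !andbT.
    move: r1; have := residue0E d0; rewrite hd orbT => /eqP -> /eqP <-.
    by rewrite residue0E // hd.
  - have := mult_le1 l hd; rewrite [height l d]heightS => m1.
    case a1 : (remcol i l d.+1); last by lia.
    by move: a1; rewrite /remcol /= (negPf hd) orbF !mem_mult => /andP[_]; lia.
  - by rewrite height_gt //; lia.
have rm : removable_to i l m.
  apply/removable_toP => d d0; rewrite mE //; split; first by lia.
  by rewrite /remcol => /negPf ->; rewrite subn0.
split=> [[m' [rm' minm [/diagramE[c0 rlt] nl]]]|[c0 rc rE]].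
  have rge : height m' c <= r by rewrite leqNgt; apply/negP => lt; apply: nl; apply/diagramE.
  have := height_rem_bound rm' ni c0; case: (remcol i l c) => ?; first by split=> //; lia.
  by lia.
exists m; split=> //.
  move=> k rk; apply/diagram_subset => d d0; rewrite mE //.
  by have := height_rem_bound rk ni d0; lia.
by split; [apply/diagramE; split=> //; lia | move/diagramE => [_]; rewrite mE // rc; lia].
Qed.

Lemma addcol_up_lt i x l c : upok x l -> c < x -> addcol i (up x l) c = addcol i l c.
Proof.
move=> ux cx; rewrite /addcol !(mem_up ux) //; lia.
Qed.





End Heights.

(** * The exponents of the Fock space as partial weights *)

Section FockCoefficients.
Variable n : nat.
Hypothesis n_gt0 : (0 < n)%N.
Local Notation h := (hh n).
Implicit Types (l m k : hspart n) (i c r x y : nat).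

(** [W i] is d_i at the lower end of an i-edge and -d_i at its upper end, so an edge has nonzero
    total weight when exactly one end is a part, that is, when its node is addable or removable. The
    correction concerns a cut through an edge. *)
Lemma sum_nodes_mid i l N : (0 < i <= n)%N ->
  (dd n i)%:Z * (\sum_(y < N) ((addcol i l y.+1)%:Z - (remcol i l y.+1)%:Z)) =
  wl i N l - (if (0 < N)%N && ed n i N.-1 then (dd n i)%:Z * (mult N l)%:Z else 0).
Proof.
move=> ni; elim: N => [|N IH]; first by rewrite big_ord0 mulr0 wl0 subr0.
rewrite big_ord_recr /= mulrDr IH {IH} wlS.
have -> : (i == 0%N) && (N == 0%N) = false by case: (i) ni.
rewrite /addcol /remcol -!/(ed n i N) /= eqSS.
have [->|N0] := posnP N.
  have -> : ed n i 0 = false by rewrite edE ?mod0n; move: ni; lia.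
  by rewrite mult0 /=; ring.
rewrite (WE n_gt0 ni N0) /=; have [ex|nex] := boolP (ed n i N); last first.
  rewrite /=; case: (ed n i N.-1) => /=; ring.
have -> : ed n i N.-1 = false.
  by apply: contraTF ex => ex; rewrite -[N](prednK N0) (edS_disj n_gt0 ni ex).
have hx := ed_mid_dvd n_gt0 ni ex; have hx1 := ed_mid_dvdS n_gt0 ni ex.
rewrite hx hx1 /= !orbF !mem_mult.
by have [->|->] := mult01 l hx; have [->|->] := mult01 l hx1; rewrite /=; ring.
Qed.

(** As in [diag0_partial], the cases reflect whether the cut separates the columns mh and mh + 1 of
    residue 0. *)
Lemma sum_nodes0 l N :
  \sum_(y < N) ((addcol 0 l y.+1)%:Z - (remcol 0 l y.+1)%:Z) =
  if N == 0%N then 0 else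
  if (N %% h == 0)%N then wl 0 N.-1 l + (N.-1 \in parts l)%:Z
     - ((N.-1 \notin parts l) && ((N \in parts l) || (N.+1 \in parts l)))%:Z
  else wl 0 (if N %% h == 1 then N.+1 else N)%N l.
Proof.
have m1 : (1 %% h = 1)%N by rewrite modn_small // /hh; lia.
have h1 : (h %| 1)%N = false by rewrite dvdn1 /hh; lia.
have one_h : (1 == h)%N = false by rewrite /hh; lia.
have one_n : (1 == n.*2)%N = false by lia.
elim: N => [|N IH]; first by rewrite big_ord0.
rewrite big_ord_recr /= IH {IH} modhS // /addcol /remcol /=.
have hN1 : (h %| N)%N -> (h %| N.+1)%N = false by apply: dvd_add1.
rewrite eqSS residue0E //= /dvdn.
have [N0|N0] := eqVneq N 0%N.
  subst N; rewrite !mod0n /= one_h m1 /= !wlS wl0 W0 WE0 // m1 one_n eqxx /= mulr0.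
  by rewrite ?andbT ?orbF mem_mult part_neq0; have [->|->] := mult01 l h1.
have [r0|r0] := eqVneq (N %% h)%N 0%N.
  have hN : (h %| N)%N by apply/eqP.
  have Nh : (N %% h).+1 == h = false by rewrite r0.
  rewrite Nh /= r0 /= orbT andbT.
  have -> : (N.+1 %% h == 0)%N = false by have := hN1 hN; rewrite /dvdn.
  have [N1] : exists N1, N = N1.+1 by exists N.-1; lia.
  move=> NE; subst N; rewrite /= !orbF.
  have hx0 : (h %| N1)%N = false by have := dvd_sub1 n_gt0 hN isT.
  have e1 : W n 0 N1.+1 = 0 by apply: W_dvd.
  have rx : (N1 %% h = n.*2)%N.
    have := ed0E n_gt0 N1; rewrite hN orbT edE // addn0 => /orP[/eqP r1|/eqP //].
    by move: hx0; rewrite /dvdn r1.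
  have e2 : W n 0 N1.+2 = - 2.
    rewrite WE0 // !modhS // rx; have -> : n.*2.+1 == h by [].
    by rewrite /hh; move: n_gt0; case: (n).
  have N1p : (0 < N1)%N by case: (N1) hx0.
  have e0 : W n 0 N1 = 2.
    by rewrite WE0 // rx eqxx; move: n_gt0; case: (n) => // k _; rewrite doubleS.
  rewrite !wlS e0 e1 e2 (gtn_eqF N1p) /= !addr0 mulr0 addr0 !mem_mult.
  have [->|->] := mult01 l hx0; have [->|->] := mult01 l (hN1 hN); case: (0 < mult N1.+1 l)%N; rewrite /=; ring.
have [rh|rh] := eqVneq (N %% h).+1 h.
  have hN : (h %| N.+1)%N by rewrite /dvdn modhS // rh eqxx.
  have -> : (N %% h == 1)%N = false by rewrite (succn_inj rh) eq_sym.
  rewrite modhS // rh eqxx /= orbT !orbF !andbT.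
  by rewrite andbC addrA.
rewrite /= (modhS n_gt0 N) (negPf rh) /= addr0 eqSS (negPf r0).
case: (eqVneq (N %% h)%N 1%N) => [r1|r1]; first by [].
rewrite wlS (WE0 n_gt0) (negPf r1) (negPf N0) /=.
have -> : (N %% h == n.*2)%N = false by move: rh; rewrite /hh eqSS => /negbTE.
by rewrite /=; ring.
Qed.

Lemma Posz_sum N (f : nat -> nat) : (\sum_(x < N) f x)%N%:Z = \sum_(x < N) (f x)%:Z.
Proof. exact: (big_morph Posz PoszD erefl). Qed.

Lemma W0_pred x : (h %| x.+1)%N -> [/\ W n 0 x = 2, (0 < x)%N, (h %| x)%N = false & (x %% h = n.*2)%N].
Proof.
move=> hx; have hx0 : (h %| x)%N = false by have := dvd_sub1 n_gt0 hx isT.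
have rx : (x %% h = n.*2)%N.
  have := ed0E n_gt0 x; rewrite hx orbT edE // addn0 => /orP[/eqP r1|/eqP //].
  by move: hx0; rewrite /dvdn r1.
split=> //; last by case: (x) hx0.
by rewrite WE0 // rx eqxx; move: n_gt0; case: (n) => // k _; rewrite doubleS.
Qed.

Lemma double_neq0 : (n.*2 == 0)%N = false. Proof. by lia. Qed.

Lemma double_neq1 : (n.*2 == 1)%N = false. Proof. by lia. Qed.

Lemma sum_nodes0_pred l x : (h %| x.+1)%N ->
  \sum_(y < x) ((addcol 0 l y.+1)%:Z - (remcol 0 l y.+1)%:Z) = wl 0 x l.
Proof.
move=> hx; have [_ x0 hx0 rx] := W0_pred hx.
by rewrite sum_nodes0 rx (gtn_eqF x0) double_neq0 double_neq1.
Qed.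

(** The definition counts the addable nodes of the larger partition. This differs from the partial
    weight only for a node in a column mh + 1 with m > 0, where column mh has the same residue; the
    difference 1 is the v^-1 of [locf]. *)
Lemma count_nodes i x l : (i <= n)%N -> ed n i x -> upok x l ->
  (dd n i)%:Z * ((count_left x.+1 (addable_nodes i (up x l)))%:Z
                 - (count_left x.+1 (removable_nodes i l))%:Z) =
  wl i x l - ((0 < x)%N && (h %| x)%N)%:Z.
Proof.
move=> ni ex ux.
have a1 := @count_leftE (addable_nodes i (up x l)) (addcol i (up x l)) (height (up x l)) x.+1.
have a2 := @count_leftE (removable_nodes i l) (remcol i l) (fun d => (height l d).-1) x.+1.
rewrite a1; last by move=> r d; apply: addable_nodesP.
rewrite a2; last first.
  move=> r d; rewrite removable_nodesP //; split=> -[d0 rd].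
    by move=> <-.
  by have := remcol_height n_gt0 rd; move: (height l d) => H H0 ->; rewrite prednK.
rewrite /= (Posz_sum _ (fun y => addcol i (up x l) y.+1)) (Posz_sum _ (fun y => remcol i l y.+1)).
rewrite -sumrB.
have up_add : residue n x != i -> forall y : 'I_x, addcol i (up x l) y.+1 = addcol i l y.+1.
  move=> rx y; have := ltn_ord y; rewrite leq_eqVlt => /orP[/eqP ->|yx].
    by rewrite /addcol (negPf rx).
  exact: addcol_up_lt.
have [i0|i0] := posnP i; last first.
  have ii : (0 < i <= n)%N by rewrite i0.
  have ex0 : (0 < x)%N && ed n i x.-1 = false.
    case: (posnP x) => // x0 /=; apply: contraTF ex => ex.
    by rewrite -[x](prednK x0) (edS_disj n_gt0 ii ex).
  rewrite (eq_bigr (fun y : 'I_x => (addcol i l y.+1)%:Z - (remcol i l y.+1)%:Z)).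
    by rewrite sum_nodes_mid // ex0 (ed_mid_dvd n_gt0 ii ex) andbF.
  move=> y _; rewrite up_add //; case: (posnP x) y ex0 => [->|x0] y; first by case: y.
  by rewrite /= /ed prednK // => ->.
subst i; rewrite /dd eqxx mul1r.
have [x0|x0] := posnP x; first by subst x; rewrite big_ord0 wl0.
have := ex; rewrite ed0E // => /orP[hx|hx]; last first.
  have hx0 := dvd_sub1 n_gt0 hx isT; rewrite /= in hx0.
  rewrite hx0 andbF subr0 -(sum_nodes0_pred l hx); apply: eq_bigr => y _.
  by rewrite up_add //; have [/= -> _] := residue_pred n_gt0 hx isT.
rewrite hx /=; case: x x0 ex ux hx {a1 a2 up_add} => // x _ ex ux hx.
have [W2 x0 hx0 _] := W0_pred hx.
rewrite big_ord_recr /= (eq_bigr (fun y : 'I_x => (addcol 0 l y.+1)%:Z - (remcol 0 l y.+1)%:Z)); last first.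
  by move=> y _; rewrite addcol_up_lt // ltnS.
rewrite sum_nodes0_pred // wlS W2 (gtn_eqF x0) /= addr0 -[RHS]addrA; move: (wl 0 x l) => w; congr (w + _).
have lx : x.+1 \in parts l by case/andP: ux.
have rx : residue n x.+1 == 0%N by rewrite residue0E // hx orbT.
rewrite /addcol /remcol rx hx lx /= hx0 /= !orbF orbT andbT (mem_up ux); try lia.
rewrite eqSS (gtn_eqF x0) /= mem_mult.
by have [->|->] := mult01 l hx0.
Qed.

End FockCoefficients.

(** * The coefficients N_i in terms of partial weights *)

Section FockOperators.
Variables (R : realType) (n : nat).
Hypothesis n_gt0 : (0 < n)%N.
Local Notation h := (hh n).
Local Notation Cq := {fraction {poly R[i]}}.
Implicit Types (l m : hspart n) (i x : nat).

Lemma q_neq0 : (q : Cq) != 0.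
Proof. by rewrite /q /poly_in_q tofrac_eq0 polyX_eq0. Qed.

Lemma q_E i : q_ R n i = q ^+ dd n i.
Proof. by rewrite /q_ /dd; case: eqP => // _; case: eqP. Qed.

Lemma fock_coefE i x l : (i <= n)%N -> ed n i x -> upok x l ->
  fock_coef R i l (up x l) x.+1 = q ^ wl i x (up x l) * locf q x (up x l).
Proof.
move=> ni ex ux; rewrite /fock_coef /=.
set s := (X in q ^ X * (1 - _)); have sE : (dd n i)%:Z * s = _ := count_nodes n_gt0 ni ex ux.
rewrite (wl_up n_gt0 ni ni ex ux (leqnn _)) /locf.
have -> : [&& i == 0%N, 1 < x.+1 & x.+1 == 1 %[mod h]]%N = (0 < x)%N && (h %| x)%N.
  rewrite ltnS -{1}[x.+1]addn1 -{3}[1%N]add0n eqn_modDr mod0n -/(dvdn _ _).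
  case: (0 < x)%N => //=; last by rewrite andbF.
  case: (boolP (h %| x)%N) => hx; rewrite ?andbF // andbT.
  by apply/eqP; apply: (ed_inj ni (leq0n _) ex); rewrite ed0E // hx.
case: ifP sE => [/andP[x0 hx]|_] sE; last first.
  by rewrite mulr1 q_E exprnP exprz_exp sE subr0.
have i0 : i = 0%N by apply: (ed_inj ni (leq0n _) ex); rewrite ed0E // hx.
subst i; move: sE; rewrite /dd eqxx mul1r => ->.
by rewrite expfzDr ?q_neq0 // /beta (mult_up_src ux x0) -[LHS]mulrA.
Qed.

End FockOperators.

(** * Adding a node to a row *)

Section Rows.
Local Open Scope nat_scope.
Variable n : nat.
Local Notation h := (hh n).
Implicit Types (l m : hspart n) (i c k r x y : nat).

Lemma eq_of_nth (s t : seq nat) : 0 \notin s -> 0 \notin t ->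
  (forall k, nth 0 s k = nth 0 t k) -> s = t.
Proof.
elim: s t => [|x s IH] [|y t] //=.
- by move=> _; rewrite inE negb_or => /andP[y0 _] /(_ 0) /= e; rewrite -e eqxx in y0.
- by rewrite inE negb_or => /andP[y0 _] _ /(_ 0) /= e; rewrite e eqxx in y0.
rewrite !inE !negb_or => /andP[_ s0] /andP[_ t0] e.
have /= -> := e 0; rewrite (IH t) // => k; exact: (e k.+1).
Qed.

Lemma height_up x l c : upok x l -> 0 < c -> height (up x l) c = height l c + (c == x.+1).
Proof.
move=> ux c0; rewrite /height; have /permP -> := up_perm ux.
rewrite /= leq_eqVlt; case/andP: ux => /orP[/eqP->|lx] _.
  rewrite rem_id ?part_neq0 // addnC; congr (_ + nat_of_bool _); lia.
have /permP -> := perm_to_rem lx; rewrite /=; lia.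
Qed.

Lemma nth_height l x : (x == 0) || (x \in parts l) -> nth 0 l (height l x.+1) = x.
Proof.
move=> lx; apply/eqP; rewrite eqn_leq; apply/andP; split.
  by rewrite -ltnS ltnNge leq_nth // ltnn.
case: (posnP x) lx => [->//|x0] /= lx.
by rewrite leq_nth // -height_in.
Qed.

Lemma nth_up x l r : upok x l -> nth 0 (up x l) r = nth 0 l r + (r == height l x.+1).
Proof.
move=> ux.
have H c : 0 < c -> (c <= nth 0 (up x l) r) = (c <= nth 0 l r + (r == height l x.+1)).
  move=> c0; rewrite leq_nth // height_up //; have nh := nth_height (proj1 (andP ux)).
  have := leq_nth l r c0; case: (eqVneq r (height l x.+1)) => [->|rx].
    rewrite nh => e; case: (eqVneq c x.+1) => [->|cx]; first by rewrite !addn1 ltnSn leqnn.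
    by rewrite addn0 -e addn1 [in RHS]leq_eqVlt (negPf cx) ltnS.
  rewrite addn0 => ->; case: (eqVneq c x.+1) => [->|cx]; last by rewrite addn0.
  by rewrite addn1 ltnS leq_eqVlt (negPf rx).
apply/eqP; rewrite eqn_leq; apply/andP; split.
  by case: (posnP (nth 0 (up x l) r)) => [->//|p0]; rewrite -H.
by case: (posnP (nth 0 l r + (r == height l x.+1))) => [->//|p0]; rewrite H.
Qed.

Lemma height_le_size l c : height l c <= size l.
Proof. exact: count_size. Qed.

(** Among equal parts only the first can grow, and [height l x.+1] is its row; so legal rows and
    legal moves correspond one to one. *)
Lemma row_step l r : r <= size l ->
  insub (incr_nth l r) =
  if (r == height l (nth 0 l r).+1) && upok (nth 0 l r) l
  then Some (up (nth 0 l r) l) else None :> option (hspart n).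
Proof.
move=> rs; set x := nth 0 l r.
have i0 : 0 \notin incr_nth l r.
  apply/negP => /(nthP 0)[k]; rewrite size_incr_nth nth_incr_nth.
  case: (ltnP r (size l)) => [rl kl|rl].
    by have := mem_nth 0 kl; case: eqP => _ // /[swap]; rewrite add0n => -> ; apply/negP/part_neq0.
  have -> : r = size l by apply/eqP; rewrite eqn_leq rs.
  rewrite ltnS leq_eqVlt; case: eqP => [->|ne] /=; first by rewrite eqxx.
  by move=> kl; have := mem_nth 0 kl; case: eqP => _ // /[swap]; rewrite add0n => -> ; apply/negP/part_neq0.
case: ifP => [/andP[/eqP rE ux]|H].
  have -> : incr_nth l r = up x l.
    apply: eq_of_nth => //; first exact: part_neq0.
    by move=> k; rewrite nth_incr_nth nth_up // -rE addnC eq_sym.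
  exact: valK.
apply: insubN; apply/negP => Hm; move: H.
pose m : hspart n := HSPart Hm.
have mE k : nth 0 m k = (r == k) + nth 0 l k by rewrite /= nth_incr_nth.
have hx : height l x.+1 <= r by rewrite leqNgt -leq_nth // ltnn.
have hm : r < height m x.+1 by rewrite -leq_nth // mE eqxx.
have rE : r = height l x.+1.
  apply/eqP; rewrite eqn_leq hx andbT; case: (posnP r) => [->//|r0].
  have rr : (r == r.-1) = false by lia.
  have := leq_nth m r.-1 (ltn0Sn x); rewrite mE rr add0n leq_nth // prednK // => ->.
  exact: ltnW.
have lx : (x == 0) || (x \in parts l).
  rewrite /x; case: (ltnP r (size l)) => rl; first by rewrite mem_nth ?orbT.
  by rewrite nth_default.
rewrite -rE eqxx /upok lx /= => /negbT; rewrite negb_or negbK => /andP[lx1 hx1].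
have := mult_le1 m hx1; have : height m x.+2 <= height l x.+2.
  rewrite leqNgt; apply/negP; rewrite -leq_nth // mE.
  case: (eqVneq r (height l x.+2)) => [e|_]; first by rewrite -e -/x; lia.
  by rewrite add0n leq_nth // ltnn.
move: hm lx1; rewrite [height m x.+1]heightS rE height_in; lia.
Qed.

End Rows.

(** * The operators of the Fock space as operators on functions *)

Section Bridge.
Variables (R : realType) (n : nat).
Hypothesis n_gt0 : (0 < n)%N.
Local Notation h := (hh n).
Local Notation Cq := {fraction {poly R[i]}}.
Implicit Types (l m : hspart n) (i x : nat).

Lemma f_basisE N i l m : (i <= n)%N -> (sumn l < N)%N ->
  (f_basis R i l)@_m =
  \sum_(x < N) if ed n i x && dnok x m && (dn x m == l)
               then q ^ wl i x m * locf q x m else 0.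
Proof.
move=> ni lN; rewrite /f_basis raddf_sum /=.
(* A row r determines its length x, and a legal x determines the row; the sum over both can be
   contracted either way. *)
transitivity (\sum_(r < (size l).+1) \sum_(x < N)
   if [&& (r == height l x.+1 :> nat), (nth 0%N l r == x), ed n i x, upok x l & up x l == m]
   then q ^ wl i x m * locf q x m else 0 : Cq).
  apply: eq_bigr => r _; set x := nth 0%N l r.
  have xN : (x < N)%N.
    apply: leq_ltn_trans lN; rewrite /x.
    case: (ltnP r (size l)) => rl; last by rewrite nth_default.
    by apply: leq_sumn; apply: mem_nth.
  rewrite (bigD1 (Ordinal xN)) //= [X in _ + X]big1 ?addr0; last first.
    move=> y; rewrite -val_eqE /= => yx; case: ifP => // /and5P[_ /eqP e _ _ _].
    by rewrite -e eqxx in yx.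
  rewrite -/x eqxx -/(ed n i x) /=.
  rewrite (row_step) -/x; last by rewrite -ltnS.
  case: (boolP (ed n i x)) => ex /=; last by rewrite andbF mcoeff0.
  case: (boolP ((r : nat) == _)) => rE /=; last by rewrite mcoeff0.
  case: (boolP (upok x l)) => ux /=; last by rewrite mcoeff0.
  rewrite mcoeffU; case: (eqVneq (up x l) m) => [<-|_] /=; last by rewrite mulr0n.
  by rewrite mulr1n fock_coefE.
rewrite exchange_big /=; apply: eq_bigr => x _.
have -> : ed n i x && dnok x m && (dn x m == l) = [&& ed n i x, upok x l & up x l == m].
  rewrite -andbA; congr andb; apply/andP/andP => -[].
    by move=> dx /eqP <-; rewrite upok_dn // dnK.
  by move=> ux /eqP <-; rewrite dnok_up // upK.
case: (boolP [&& _, _ & _]) => [/and3P[ex ux um]|H]; last first.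
  by rewrite big1 // => r _; rewrite !andbF.
have rs : (height l x.+1 < (size l).+1)%N by rewrite ltnS height_le_size.
rewrite (bigD1 (Ordinal rs)) //= big1 ?addr0; last first.
  by move=> r; rewrite -val_eqE /= => /negPf ->.
by rewrite eqxx nth_height ?eqxx //; case/andP: ux.
Qed.

Lemma f_opE i (v : {malg Cq[hspart n]}) m : (i <= n)%N ->
  (f_op i v)@_m = fop q i (fun l => v@_l) m.
Proof.
move=> ni; rewrite /f_op raddf_sum /=.
pose N := ((sumn m).+1 + \sum_(l <- msupp v) (sumn l).+1)%N.
rewrite (@fopE _ _ _ N) //; last by rewrite /N; lia.
rewrite big_seq; under eq_bigr => l lv.
  rewrite mcoeffZ (@f_basisE N) //; last first.
    rewrite /N (perm_big _ (perm_to_rem lv)) big_cons /=; lia.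
  rewrite big_distrr /=.
  over.
rewrite -big_seq exchange_big /=; apply: eq_bigr => x _.
case: (boolP (ed n i x && dnok x m)) => H /=; last first.
  by rewrite big1 // => l _; rewrite mulr0.
case: (boolP (dn x m \in msupp v)) => dv; last first.
  rewrite (mcoeff_outdom dv) mulr0 big_seq big1 // => l lv.
  by case: eqP => [e|_]; [rewrite e lv in dv | rewrite mulr0].
rewrite (bigD1_seq (dn x m)) ?fset_uniq //= eqxx big1 ?addr0; first by rewrite mulrC.
by move=> l /negPf; rewrite eq_sym => ->; rewrite mulr0.
Qed.

End Bridge.

(** * The operators e_i and strings of sl_2 *)

Section Strings.
Variables (n : nat) (F : fieldType) (v : F).
Hypotheses (n_gt0 : (0 < n)%N) (v0 : v != 0).
Hypothesis v_root : forall k, v ^+ k.+1 != 1.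
Local Notation h := (hh n).
Implicit Types (l m : hspart n) (i j k x y z : nat) (u : hspart n -> F).

(** The power of v absorbs the factor v^(- AA i j) of [fadj_fop] and turns that relation into a
    commutator. [qint i (j d_i)] is the quantum integer [j] in q_i. *)
Definition eop i u l : F := v ^ ((dd n i)%:Z - wt i l) * fadj v i u l.
Definition qint i (w : int) : F := (v ^ w - v ^ (- w)) / (v ^+ dd n i - v ^- dd n i).

Lemma fopZ i c u : fop v i (fun l => c * u l) = (fun m => c * fop v i u m).
Proof. by apply/funext => m; rewrite /fop big_distrr; apply: eq_bigr => x _; rewrite mulrCA. Qed.

Lemma fop_sum i (I : Type) (r : seq I) (P : pred I) (w : I -> hspart n -> F) :
  fop v i (fun l => \sum_(k <- r | P k) w k l) = (fun m => \sum_(k <- r | P k) fop v i (w k) m).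
Proof.
apply/funext => m; rewrite /fop exchange_big /=; apply: eq_bigr => x _.
by rewrite big_distrr.
Qed.

Lemma eopZ i c u : eop i (fun l => c * u l) = (fun m => c * eop i u m).
Proof.
apply/funext => m; rewrite /eop /fadj mulrCA; congr (_ * _).
by rewrite big_distrr; apply: eq_bigr => x _; rewrite mulrCA.
Qed.

Lemma eop_sum i (I : Type) (r : seq I) (P : pred I) (w : I -> hspart n -> F) :
  eop i (fun l => \sum_(k <- r | P k) w k l) = (fun m => \sum_(k <- r | P k) eop i (w k) m).
Proof.
apply/funext => m; rewrite /eop -big_distrr /=; congr (_ * _).
rewrite /fadj exchange_big /=; apply: eq_bigr => x _.
by rewrite big_distrr.
Qed.

Lemma iter_fopZ a i c u : iter a (fop v i) (fun l => c * u l) = (fun m => c * iter a (fop v i) u m).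
Proof. by elim: a => //= a ->; rewrite fopZ. Qed.

Lemma iter_fop_sum a i (I : Type) (r : seq I) (P : pred I) (w : I -> hspart n -> F) :
  iter a (fop v i) (fun l => \sum_(k <- r | P k) w k l) =
  (fun m => \sum_(k <- r | P k) iter a (fop v i) (w k) m).
Proof. by elim: a => //= a ->; rewrite fop_sum. Qed.

Lemma expz_opp w : v ^ (- w) = (v ^ w)^-1.
Proof. by rewrite invr_expz. Qed.

Lemma dd_pos i : exists d, dd n i = d.+1.
Proof. by rewrite /dd; case: ifP => _; [exists 0%N | case: ifP => _; [exists 3 | exists 1%N]]. Qed.

Lemma v_dd i : v ^+ (2 * dd n i) - 1 != 0.
Proof. by rewrite subr_eq0; have [d ->] := dd_pos i; rewrite mulnS; apply: v_root. Qed.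

Lemma v_dd' i : v ^+ dd n i - v ^- dd n i != 0.
Proof.
have vd : v ^+ dd n i != 0 by rewrite expf_neq0.
rewrite -(mulIr_eq0 _ (mulIf vd)) mulrBl mulVf // -expr2 -exprM mulnC.
exact: v_dd.
Qed.

Lemma fop_wt i j (c : int -> F) u l : (i <= n)%N -> (j <= n)%N ->
  fop v j (fun m => c (wt i m) * u m) l = c (wt i l + AA n i j) * fop v j u l.
Proof.
move=> ni nj; rewrite /fop big_distrr; apply: eq_bigr => x /andP[ex dx] /=.
by rewrite (wt_dn n_gt0 ni nj ex dx) mulrCA.
Qed.

Lemma eop_fop i j u l : (i <= n)%N -> (j <= n)%N ->
  eop i (fop v j u) l = fop v j (eop i u) l + (if i == j then qint i (wt i l) * u l else 0).
Proof.
move=> ni nj; rewrite {1}/eop fadj_fop // mulrDr.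
rewrite (fop_wt (fun w => v ^ ((dd n i)%:Z - w))) //; congr (_ + _).
  by rewrite mulrA -expfzDr //; congr (v ^ _ * _); ring.
case: (i == j); last by rewrite mul0r mulr0.
rewrite mulrA; congr (_ * _).
have H := diag_sum n_gt0 v0 l ni; have vd := v_dd i; have vd' := v_dd' i.
have -> : \sum_(x < (sumn l).+2) diag v i x l =
          ((v ^ wt i l) ^+ 2 - 1) / (v ^+ (2 * dd n i) - 1).
  by apply: (mulfI vd); rewrite H mulrCA divff // mulr1.
rewrite /qint expfzDr // !expz_opp.
have vw : v ^ wt i l != 0 by rewrite expfz_neq0.
have vD : v ^+ dd n i != 0 by rewrite expf_neq0.
move: vd vd'; rewrite mulnC exprM -exprnP; move: (v ^+ dd n i) vD (v ^ wt i l) vw => D D0 V V0 e1 e2.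
field; rewrite D0 V0 !andbT; apply/andP; split; last by [].
by move: e2; rewrite -(mulIr_eq0 _ (mulIf D0)) mulrBl mulVf.
Qed.

Lemma eop_supp i u l : eop i u l != 0 ->
  exists x, [/\ ed n i x, upok x l & u (up x l) != 0].
Proof.
move=> H; apply: contrapT => nx; move/eqP: H; apply.
rewrite /eop /fadj big1 ?mulr0 // => x /andP[ex ux].
case: (eqVneq (u (up x l)) 0) => [->|ne]; first by rewrite mulr0.
by case: nx; exists x.
Qed.

Lemma fop_supp i u l : fop v i u l != 0 ->
  exists x, [/\ ed n i x, dnok x l & u (dn x l) != 0].
Proof.
move=> H; apply: contrapT => nx; move/eqP: H; apply.
rewrite /fop big1 // => x /andP[ex ux].
case: (eqVneq (u (dn x l)) 0) => [->|ne]; first by rewrite mulr0.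
by case: nx; exists x.
Qed.

(** The product [j] [a - j + 1] of quantum integers in q_i, familiar from the module of highest
    weight a of sl_2. *)
Definition kappa i a j : F := qint i (j * dd n i)%N%:Z * qint i (a%:Z * (dd n i)%:Z - j%:Z * (dd n i)%:Z + (dd n i)%:Z).

Lemma kappaS i a j :
  kappa i a j.+1 = kappa i a j - qint i (2 * j%:Z * (dd n i)%:Z - a%:Z * (dd n i)%:Z).
Proof.
rewrite /kappa /qint; have := v_dd' i; have vD : v ^+ dd n i != 0 by rewrite expf_neq0.
have -> : (a%:Z * (dd n i)%:Z - j.+1%:Z * (dd n i)%:Z + (dd n i)%:Z) =
          a%:Z * (dd n i)%:Z - j%:Z * (dd n i)%:Z by rewrite -addn1 PoszD; ring.
have -> : (j.+1 * dd n i)%N%:Z = j%:Z * (dd n i)%:Z + (dd n i)%:Z by rewrite -addn1 mulnDl mul1n PoszD PoszM.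
have -> : (2 * j%:Z * (dd n i)%:Z - a%:Z * (dd n i)%:Z) = j%:Z * (dd n i)%:Z + j%:Z * (dd n i)%:Z - a%:Z * (dd n i)%:Z by ring.
rewrite PoszM !expz_opp !expfzDr // !expz_opp -!(exprnP v (dd n i)).
have : v ^ (a%:Z * (dd n i)%:Z) != 0 by rewrite expfz_neq0.
have : v ^ (j%:Z * (dd n i)%:Z) != 0 by rewrite expfz_neq0.
move: (v ^ (a%:Z * _)) (v ^ (j%:Z * _)) (v ^+ dd n i) vD => A J D D0 J0 A0.
rewrite -(mulIr_eq0 _ (mulIf D0)) mulrBl mulVf // => e.
by field; rewrite D0 J0 A0 e.
Qed.

(** Here u is a lowest weight vector of weight -a d_i; the formula follows by summing the
    commutators [e_i, f_i] along the string. *)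
Lemma string_step i a u j : (i <= n)%N ->
    (forall l, u l != 0 -> wt i l = - (a%:Z * (dd n i)%:Z)) -> fop v i u = (fun=> 0) ->
  fop v i (iter j.+1 (eop i) u) = (fun l => kappa i a j.+1 * iter j (eop i) u l).
Proof.
move=> ni uw fu.
have supp k : forall l, iter k (eop i) u l != 0 ->
    wt i l = 2 * k%:Z * (dd n i)%:Z - a%:Z * (dd n i)%:Z.
  elim: k => [|k IH] l /=; first by move/uw ->; ring.
  case/eop_supp => x [ex ux /IH].
  rewrite (wt_up n_gt0 ni ni ex ux) (AA_diag n_gt0 ni) PoszM => /eqP.
  by rewrite subr_eq => /eqP ->; rewrite -addn1 PoszD; ring.
have comm (w : hspart n -> F) (k : int) : (forall l, w l != 0 -> wt i l = k) ->
    fop v i (eop i w) = (fun l => eop i (fop v i w) l - qint i k * w l).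
  move=> wk; apply/funext => l; rewrite eop_fop // eqxx.
  case: (eqVneq (w l) 0) => [->|/wk ->]; first by rewrite !mulr0 addr0 subr0.
  by rewrite addrK.
elim: j => [|j IH].
  rewrite /= (comm _ _ (supp 0%N)) fu; apply/funext => l /=.
  rewrite kappaS /kappa mul0n /qint subrr !mul0r.
  have -> : eop i (fun _ => 0) l = 0 by rewrite /eop /fadj big1 ?mulr0 // => x _; rewrite mulr0.
  by ring.
rewrite [iter j.+2 _ _]/= (comm _ _ (supp j.+1)) IH eopZ; apply/funext => l.
by rewrite [in RHS]kappaS /=; ring.
Qed.

Definition stringc i a : F := \prod_(j < a) kappa i a j.+1.

Lemma string_id i a u : (i <= n)%N ->
    (forall l, u l != 0 -> wt i l = - (a%:Z * (dd n i)%:Z)) -> fop v i u = (fun=> 0) ->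
  iter a (fop v i) (iter a (eop i) u) = (fun l => stringc i a * u l).
Proof.
move=> ni uw fu.
suff H k : iter k (fop v i) (iter k (eop i) u) = (fun l => \prod_(j < k) kappa i a j.+1 * u l).
  exact: H.
elim: k => [|k IH]; first by apply/funext => l; rewrite big_ord0 mul1r.
rewrite iterSr (string_step _ ni uw fu) iter_fopZ IH; apply/funext => l.
by rewrite big_ord_recr /=; ring.
Qed.

Definition qfact i a : F := \prod_(j < a) qint i (j.+1 * dd n i)%N%:Z.

(** Reversing the order of the factors [a - j + 1] gives a second copy of [a]!. *)
Lemma stringcE i a : stringc i a = qfact i a ^+ 2.
Proof.
rewrite /stringc /kappa big_split /= expr2; congr (_ * _).
rewrite /qfact (reindex_inj rev_ord_inj) /=; apply: eq_bigr => j _; congr qint.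
have ja := ltn_ord j; have -> : (rev_ord j).+1 = (a - j)%N by rewrite /= subnSK.
by rewrite -subzn ?(ltnW ja) // PoszM -addn1 PoszD; ring.
Qed.

Lemma qint_neq0 i k : (0 < k)%N -> qint i (k * dd n i)%N%:Z != 0.
Proof.
move=> k0; rewrite /qint mulf_neq0 ?invr_eq0 ?v_dd' //.
have v1 : v ^ (k * dd n i)%N%:Z != 0 by rewrite expfz_neq0.
rewrite expz_opp -(mulIr_eq0 _ (mulIf v1)) mulrBl mulVf // -exprnP -expr2 -exprM subr_eq0.
by have [d ->] := dd_pos i; case: k k0 {v1} => // k _; rewrite mulSn mulnC /= addSn mulnS; apply: v_root.
Qed.

Lemma qfact_neq0 i a : qfact i a != 0.
Proof. by rewrite prodf_seq_neq0; apply/allP => j _; rewrite qint_neq0. Qed.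

End Strings.

(** * Adjointness of e_i and f_i *)

Section Adjoint.
Variables (n : nat) (F : fieldType) (v : F).
Hypotheses (n_gt0 : (0 < n)%N) (v0 : v != 0).
Hypothesis v_root : forall k, v ^+ k.+1 != 1.
Local Notation h := (hh n).
Implicit Types (l m : hspart n) (i j k x y z : nat) (u : hspart n -> F).

Definition delta l : hspart n -> F := fun m => (m == l)%:R.

(** Parts above N are ignored, so N is taken at least as large as the partitions in play. *)
Definition normc N l : F := \prod_(y < N | (h %| y.+1)%N) \prod_(k < mult y.+1 l) beta v k.+1.

(** Adjointness for a single move: at most one of x and x + 1 is a multiple of h, so at most one
    factor of the norm changes. *)
Lemma loc_normc N x l : (x < N)%N -> upok x l ->
  locf v x (up x l) * normc N (up x l) = loce v x l * normc N l.
Proof.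
move=> xN ux; rewrite /normc /locf /loce.
have far (y : 'I_N) : y.+1 != x -> y.+1 != x.+1 -> mult y.+1 (up x l) = mult y.+1 l.
  by move=> *; apply: mult_up_far.
have [hx|hx] := boolP (h %| x.+1)%N.
  have hx0 := dvd_sub1 n_gt0 hx isT; rewrite /= in hx0.
  rewrite hx0 andbF mul1r (bigD1 (Ordinal xN)) //= [in RHS](bigD1 (Ordinal xN)) //= mulrA.
  rewrite mult_up_tgt // big_ord_recr /= [beta v _ * _]mulrC; congr (_ * _).
  apply: eq_bigr => y /andP[hy]; rewrite -val_eqE /= => yx; rewrite far ?eqSS //.
  by apply: contraTN hy => /eqP ->; rewrite hx0.
have [x0|x0] := posnP x.
  subst x; rewrite /= !mul1r; apply: eq_bigr => y hy; rewrite far //.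
  by apply: contraNN hx => /eqP <-.
have [hx0|hx0] := boolP (h %| x)%N; last first.
  rewrite !mul1r; apply: eq_bigr => y hy; rewrite far //.
    by apply: contraNN hx0 => /eqP <-.
  by apply: contraNN hx => /eqP <-.
have xN1 : (x.-1 < N)%N by lia.
rewrite -mulrA; congr (_ * _).
rewrite (bigD1 (Ordinal xN1)) /= ?prednK // [in RHS](bigD1 (Ordinal xN1)) /= ?prednK // mulrA.
rewrite -(mult_up_src ux x0) big_ord_recr /= [beta v _ * _]mulrC; congr (_ * _).
apply: eq_bigr => y /andP[hy]; rewrite -val_eqE /= => yx; rewrite far //; first by lia.
by apply: contraNN hx => /eqP <-.
Qed.

Lemma fop_delta i l : (i <= n)%N -> fop v i (delta l) =
  (fun m => \sum_(x < (sumn l).+1 | ed n i x && upok x l)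
     (v ^ wl i x l * locf v x (up x l)) * delta (up x l) m).
Proof.
move=> ni; apply/funext => m.
pose N := (maxn (sumn l) (sumn m)).+1.
rewrite (@fopE _ _ _ N) ?ltnS ?leq_maxr //.
have -> : \sum_(x < (sumn l).+1 | ed n i x && upok x l)
     (v ^ wl i x l * locf v x (up x l)) * delta (up x l) m =
  \sum_(x < N) if ed n i x && upok x l then (v ^ wl i x l * locf v x (up x l)) * delta (up x l) m else 0.
  rewrite -(big_mkord (fun x => ed n i x && upok x l)
    (fun x => (v ^ wl i x l * locf v x (up x l)) * delta (up x l) m)).
  rewrite (big_nat_widen _ _ N) ?ltnS ?leq_maxl //.
  rewrite -[RHS](big_mkord xpredT (fun x => if ed n i x && upok x l
    then (v ^ wl i x l * locf v x (up x l)) * delta (up x l) m else 0)) -big_mkcond /=.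
  apply: eq_bigl => x; apply: andb_idr => /andP[_ /upok_bound].
  by rewrite ltnS.
apply: eq_bigr => x _; rewrite /delta; case: (boolP (ed n i x)) => //= ex.
case: (boolP (dnok x m)) => dx; last first.
  case: ifP => // ux; case: eqP => [e|]; last by rewrite mulr0.
  by rewrite e dnok_up in dx.
case: (boolP (upok x l)) => ux; last first.
  case: eqP => [e|]; last by rewrite mulr0.
  by rewrite -e upok_dn in ux.
case: (eqVneq m (up x l)) => [->|ne].
  by rewrite upK // eqxx; congr (v ^ _ * _ * _); rewrite (wl_up n_gt0 ni ni ex ux).
rewrite mulr0; case: eqP => [e|]; last by rewrite mulr0.
by rewrite -e dnK // eqxx in ne.
Qed.

(** The twists in [eop] accumulate to v^(j (j d_i - wt)). This is 1 for j = a and weight a d_i, that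
    is, along a whole string. *)
Lemma iter_adjoint N i j l m : (i <= n)%N -> (sumn l + j <= N)%N ->
  iter j (eop v i) (delta m) l * normc N l =
  v ^ (j%:Z * (j%:Z * (dd n i)%:Z - wt i l)) * iter j (fop v i) (delta l) m * normc N m.
Proof.
move=> ni; elim: j l => [|j IH] l lN.
  rewrite mul0r expr0z mul1r /= /delta eq_sym; case: eqP => [->|]; by rewrite // !mul0r.
rewrite iterS iterSr (fop_delta _ ni) iter_fop_sum {1}/eop /fadj big_mkord /=.
rewrite -[LHS]mulrA big_distrl big_distrr -[RHS]mulrA big_distrl big_distrr /=.
apply: eq_bigr => x /andP[ex ux]; rewrite iter_fopZ.
have IHx := IH (up x l); rewrite sumn_up // addSn -addnS in IHx; have {IHx IH} := IHx lN.
have xN : (x < N)%N by have := upok_bound ux; lia.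
have := loc_normc xN ux.
rewrite (wt_up n_gt0 ni ni ex ux) (AA_diag n_gt0 ni) PoszM.
move: (iter j (eop v i) (delta m) (up x l)) (iter j (fop v i) (delta (up x l)) m) => E Fx Hloc IHx.
transitivity (v ^ ((dd n i)%:Z - wt i l) * v ^ wl i x l * (loce v x l * normc N l) * E); first by ring.
rewrite -Hloc.
transitivity (v ^ ((dd n i)%:Z - wt i l) * v ^ wl i x l * locf v x (up x l) * (E * normc N (up x l))); first by ring.
rewrite IHx.
have -> : v ^ (j.+1%:Z * (j.+1%:Z * (dd n i)%:Z - wt i l)) = v ^ ((dd n i)%:Z - wt i l) *
    v ^ (j%:Z * (j%:Z * (dd n i)%:Z - (wt i l - 2 * (dd n i)%:Z))).
  by rewrite -expfzDr //; congr (v ^ _); rewrite -addn1 PoszD; ring.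
by ring.
Qed.

(** Squaring the relation (-v^2)^(k + 1) = 1 removes the sign and makes v a root of unity of order
    dividing 4(k + 1). *)
Lemma beta_neq0 k : beta v k.+1 != 0.
Proof.
rewrite /beta subr_eq0 eq_sym; apply: contraNneq (v_root (k.+1 * 4).-1) => e.
have -> : (k.+1 * 4).-1.+1 = (2 * k.+1 * 2)%N by lia.
by rewrite -mulnA exprM mulnC exprM -(sqrrN (v ^+ 2)) -exprM mulnC exprM e expr1n.
Qed.

Lemma normc_neq0 N l : normc N l != 0.
Proof.
by rewrite prodf_seq_neq0; apply/allP => y _; apply/implyP => _;
  rewrite prodf_seq_neq0; apply/allP => k _; apply: beta_neq0.
Qed.

(** * Positivity, which decides the sign of a matrix coefficient *)

Section Positivity.
Variable pos : F -> Prop.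
Hypotheses (posD : forall a b, pos a -> pos b -> pos (a + b))
  (posM : forall a b, pos a -> pos b -> pos (a * b)) (pos1 : pos 1)
  (posV : forall a, pos a -> pos a^-1) (pos_v : pos v)
  (pos_v1 : forall k, pos (1 - v ^+ k.+1)) (pos_v2 : forall k, pos (1 + v ^+ k.+1))
  (posN : forall a, pos a -> ~ pos (- a)).

Lemma posX a k : pos a -> pos (a ^+ k).
Proof. by move=> pa; elim: k => [|k IH]; rewrite ?expr0 // exprS; apply: posM. Qed.

Lemma posXz a (w : int) : pos a -> pos (a ^ w).
Proof. by move=> pa; case: w => k; rewrite ?NegzE -?exprnN -?exprnP; do ?apply: posV; apply: posX. Qed.

Lemma pos_beta k : pos (beta v k.+1).
Proof.
rewrite /beta exprNn -exprM -signr_odd; case: (odd k.+1); rewrite ?expr0 ?expr1 ?mulN1r ?mul1r ?opprK mulnC.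
  by rewrite mulSn addSn; apply: pos_v2.
by rewrite mulSn addSn; apply: pos_v1.
Qed.

Definition pos0 a := a = 0 \/ pos a.

Lemma pos0_sum (I : Type) (r : seq I) (P : pred I) (f : I -> F) :
  (forall c, P c -> pos0 (f c)) -> pos0 (\sum_(c <- r | P c) f c).
Proof.
move=> H; apply: big_ind => // [|a b [->|pa] [->|pb]]; rewrite ?addr0 ?add0r; first by left.
- by left.
- by right.
- by right.
- by right; apply: posD.
Qed.

Lemma pos0_fop i u : (forall l, pos0 (u l)) -> forall m, pos0 (fop v i u m).
Proof.
move=> H m; apply: pos0_sum => x _; case: (H (dn x m)) => [->|pu]; first by left; rewrite mulr0.
right; apply: posM => //; apply: posM; first exact: posXz.
by rewrite /locf; case: ifP => // _; apply: posM; [apply: posV | apply: pos_beta].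
Qed.

Lemma pos0_iter i j l m : pos0 (iter j (fop v i) (delta l) m).
Proof.
elim: j m => [|j IH] m /=; last by apply: pos0_fop.
by rewrite /delta; case: eqP => _; [right|left].
Qed.

Lemma pos_qfact i a : pos (qfact n v i a).
Proof.
apply: big_ind => // j _; rewrite /qint expz_opp -exprnP; have vd := v_dd n v_root i.
have [d dE] := dd_pos n i; rewrite dE in vd *.
have [e eE] : exists e, (j.+1 * d.+1)%N = e.+1 by exists (j.+1 * d.+1).-1; rewrite prednK.
rewrite eE; have -> : (v ^+ e.+1 - v ^- e.+1) / (v ^+ d.+1 - v ^- d.+1) =
    (1 - v ^+ (2 * e.+1)) * (1 - v ^+ (2 * d.+1))^-1 * (v ^+ d.+1 * (v ^+ e.+1)^-1).
  have ve : v ^+ e.+1 != 0 by rewrite expf_neq0.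
  have vD : v ^+ d.+1 != 0 by rewrite expf_neq0.
  rewrite ![(2 * _)%N]mulnC !exprM in vd *; move: (v ^+ e.+1) (v ^+ d.+1) ve vD vd => E D E0 D0 vd.
  field; rewrite E0 D0 /= -?expr2 ?vd ?andbT.
  by rewrite -opprB oppr_eq0 vd.
apply: (posM (posM _ _) (posM _ _)).
- by rewrite mulnS; apply: pos_v1.
- by apply: posV; rewrite mulnS; apply: pos_v1.
- exact: posX.
- exact/posV/posX.
Qed.

(* Both matrix coefficients of the divided powers of e_i and f_i between l and
   m are equal by adjointness, so their product being 1 makes them +1 or -1. *)
Lemma reflect_coef i a l m : (i <= n)%N -> wt i l = a%:Z * (dd n i)%:Z ->
    wt i m = - (a%:Z * (dd n i)%:Z) ->
    (forall N, normc N l = normc N m) ->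
    fop v i (delta m) = (fun=> 0) ->
    (forall k : hspart n, k != m -> iter a (fop v i) (delta l) k = 0) ->
    (forall k : hspart n, k != l -> iter a (eop v i) (delta m) k = 0) ->
  iter a (fop v i) (delta l) = (fun k : hspart n => qfact n v i a * delta m k).
Proof.
move=> ni wl wm nlm fm fl el; apply/funext => k.
case: (eqVneq k m) => [->|km]; last by rewrite fl // /delta (negPf km) mulr0.
rewrite /delta eqxx mulr1; set b := qfact n v i a.
set x := iter a (fop v i) (delta l) m; set y := iter a (eop v i) (delta m) l.
have xy : x = y.
  have := @iter_adjoint (sumn l + a) i a l m ni (leqnn _); rewrite wl subrr mulr0 expr0z mul1r nlm.
  by move/(mulIf (normc_neq0 _ _)).
have eE : iter a (eop v i) (delta m) = (fun k : hspart n => y * delta l k).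
  by apply/funext => k'; case: (eqVneq k' l) => [->|kl];
    [rewrite /delta eqxx mulr1 | rewrite el // /delta (negPf kl) mulr0].
have wm' (k' : hspart n) : delta m k' != 0 -> wt i k' = - (a%:Z * (dd n i)%:Z).
  by rewrite /delta; case: (eqVneq k' m) => [->|_] //; rewrite eqxx.
have := congr1 (fun w => w m) (string_id n_gt0 v0 v_root ni wm' fm).
rewrite eE iter_fopZ stringcE // -/b -/x -xy /delta eqxx mulr1 -expr2 => /eqP.
rewrite eqf_sqr => /orP[/eqP //|/eqP xb].
have pb : pos b := pos_qfact i a.
have [x0|px] : pos0 x by apply: pos0_iter.
  by have := qfact_neq0 n v0 v_root i a; rewrite -oppr_eq0 -/b -xb x0 eqxx.
by case: (posN pb); rewrite -xb.
Qed.

End Positivity.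

End Adjoint.

(** * Quantum integers as symmetric functions of v and 1/v *)

Section ScalarIdentities.
Variables (F : fieldType) (v : F).
Hypothesis v0 : v != 0.

Lemma sym_rec k : v ^+ k.+2 + v ^- k.+2 =
  (v + v^-1) * (v ^+ k.+1 + v ^- k.+1) - (v ^+ k + v ^- k).
Proof.
by rewrite !exprS; move: (expf_neq0 k v0); move: (v ^+ k) => X X0; field; rewrite X0 v0.
Qed.

(** Multiplying numerator and denominator by v^d - v^-d makes both invariant under v -> 1/v. *)
Lemma qint_sym (w d : int) : v ^ d - v ^ (- d) != 0 ->
  (v ^ w - v ^ (- w)) / (v ^ d - v ^ (- d)) =
  ((v ^ (w + d) + v ^ (- (w + d))) - (v ^ (w - d) + v ^ (- (w - d)))) /
  ((v ^ (d + d) + v ^ (- (d + d))) - (1 + 1)).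
Proof.
have -> : - (w + d) = - w - d by rewrite opprD.
have -> : - (w - d) = - w + d by rewrite opprD opprK.
have -> : - (d + d) = - d - d by rewrite opprD.
rewrite !expfzDr // !expz_opp.
have : v ^ w != 0 by rewrite expfz_neq0.
have : v ^ d != 0 by rewrite expfz_neq0.
move: (v ^ w) (v ^ d) => V D D0 V0 vd.
have -> : D * D + D^-1 * D^-1 - (1 + 1) = (D - D^-1) ^+ 2 by field.
have -> : V * D + V^-1 * D^-1 - (V * D^-1 + V^-1 * D) = (V - V^-1) * (D - D^-1).
  by field; rewrite V0 D0.
by rewrite expr2 invfM mulrA mulfK.
Qed.

Lemma qint_closed (K : F -> Prop) n i (w : int) : (forall k, v ^+ k.+1 != 1) ->
  (forall a b, K a -> K b -> K (a + b)) -> (forall a b, K a -> K b -> K (a - b)) ->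
  (forall a b, K a -> K b -> K (a * b)) -> (forall a, K a -> K a^-1) -> K 1 ->
  (forall w : int, K (v ^ w + v ^ (- w))) -> K (qint n v i w).
Proof.
move=> v_root KD KB KM KV K1 Ksym; have vd := v_dd' n v0 v_root i.
rewrite /qint exprnN exprnP; rewrite exprnN exprnP in vd; rewrite (qint_sym _ vd).
by apply: KM; [|apply: KV]; apply: KB; try exact: Ksym; apply: KD.
Qed.

End ScalarIdentities.

(** * The field C(q + 1/q) *)

Section SymmetricScalars.
Variable R : realType.
Local Notation Cq := {fraction {poly R[i]}}.
Implicit Types (a b p : {poly R[i]}) (x y : Cq).

Let qq : Cq := q.

Lemma poly_in_q_inj : injective (@poly_in_q R).
Proof. by move=> a b /eqP; rewrite /poly_in_q tofrac_eq => /eqP. Qed.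

Lemma poly_in_qX k : poly_in_q ('X^k : {poly R[i]}) = qq ^+ k.
Proof. by rewrite /qq /q /poly_in_q rmorphXn. Qed.

Lemma q_root k : qq ^+ k.+1 != 1.
Proof.
rewrite -poly_in_qX /poly_in_q -(rmorph1 (@FracField.tofrac _)) tofrac_eq -subr_eq0.
by rewrite -size_poly_eq0 size_Xn_sub_1.
Qed.

Lemma eval_symE p : eval_sym p = (map_poly (@FracField.tofrac {poly R[i]} \o polyC) p).[qq + qq^-1].
Proof. by []. Qed.

Lemma eval_symD a b : eval_sym (a + b) = eval_sym a + eval_sym b.
Proof. by rewrite !eval_symE rmorphD hornerD. Qed.

Lemma eval_symM a b : eval_sym (a * b) = eval_sym a * eval_sym b.
Proof. by rewrite !eval_symE rmorphM hornerM. Qed.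

Lemma eval_symC (c : R[i]) : eval_sym c%:P = poly_in_q c%:P.
Proof. by rewrite !eval_symE map_polyC hornerC. Qed.

Lemma eval_sym1 : eval_sym (1 : {poly R[i]}) = 1.
Proof. by rewrite eval_symC /poly_in_q rmorph1. Qed.

Lemma eval_sym0 : eval_sym (0 : {poly R[i]}) = 0.
Proof. by rewrite eval_symE rmorph0 horner0. Qed.

Lemma eval_symX : eval_sym ('X : {poly R[i]}) = qq + qq^-1.
Proof. by rewrite eval_symE map_polyX hornerX. Qed.

(* Multiplying a polynomial in q + 1/q by a power of q clears denominators and
   gives a polynomial in q of twice the degree, not vanishing at 0. *)
Lemma eval_sym_clear p : p != 0 -> exists P : {poly R[i]},
  [/\ P.[0] != 0, size P = ((size p).-1.*2).+1 &
      qq ^+ (size p).-1 * eval_sym p = poly_in_q P].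
Proof.
move=> p0; set m := (size p).-1.
have q0 : qq != 0 by apply: q_neq0.
have mp : m.+1 = size p by rewrite /m prednK // lt0n size_poly_eq0.
pose P : {poly R[i]} := \sum_(k < m.+1) p`_k *: (('X^2 + 1) ^+ k * 'X^(m - k)).
have pm : p`_m != 0 by rewrite -lead_coefE lead_coef_eq0.
have X0 : ('X^2 + 1 : {poly R[i]}) != 0 by rewrite -size_poly_eq0 size_XnaddC.
have sXk k : size (('X^2 + 1 : {poly R[i]}) ^+ k) = k.*2.+1.
  rewrite -[LHS]prednK; last by rewrite lt0n size_poly_eq0 expf_neq0.
  by rewrite size_exp size_XnaddC // mul2n.
exists P; split.
- rewrite /P horner_sum (bigD1 ord_max) //= big1 ?addr0 => [|k].
    by rewrite subnn expr0 mulr1 hornerZ !hornerE /= expr0n /= add0r expr1n mulr1.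
  rewrite -val_eqE /= => km; have : (m - k)%N != 0%N by have := ltn_ord k; lia.
  case: (m - k)%N => // j _.
  by rewrite hornerZ hornerM hornerXn expr0n /= !mulr0.
- rewrite /P big_ord_recr /= addrC size_polyDl subnn expr0 mulr1.
    by rewrite size_scale.
  rewrite size_scale // sXk ltnS; apply: leq_trans (size_sum _ _ _) _.
  apply/bigmax_leqP => k _; apply: leq_trans (size_scale_leq _ _) _.
  apply: leq_trans (size_polyMleq _ _) _; rewrite sXk size_polyXn /=.
  have := ltn_ord k; lia.
- rewrite eval_symE horner_coef size_map_inj_poly ?rmorph0 //; last first.
    by move=> c d /= /poly_in_q_inj/polyC_inj.
  rewrite -mp big_distrr /poly_in_q /P rmorph_sum /=; apply: eq_bigr => k _.
  rewrite coef_map /= -mul_polyC !rmorphM !rmorphXn rmorphD rmorph1 rmorphXn /= -[FracField.tofrac 'X]/qq.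
  have km : (k <= m)%N by rewrite -ltnS.
  rewrite mulrCA; congr (_ * _); rewrite -{1}(subnK km) exprD -mulrA mulrC -exprMn mulrDr divff //.
Qed.

Lemma eval_sym_neq0 p : p != 0 -> eval_sym p != 0.
Proof.
move=> /eval_sym_clear[P [P0 _ E]]; apply: contraNneq P0 => e0.
have /poly_in_q_inj <- : poly_in_q 0 = poly_in_q P :> Cq by rewrite -E e0 mulr0 /poly_in_q rmorph0.
by rewrite horner0.
Qed.

(** Clearing denominators gives q^a p B = q^b A with deg A = 2a, deg B = 2b and A, B nonzero at 0.
    Comparing degrees, deg p = a - b; if this were positive, q would divide A. *)
Lemma inK_poly p : in_Cqsym (poly_in_q p) -> p = (p.[0])%:P.
Proof.
case=> a [b [b0 E]]; have [->|p0] := eqVneq p 0; first by rewrite horner0.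
have bE := eval_sym_neq0 b0.
have {}E : poly_in_q p * eval_sym b = eval_sym a by rewrite E divfK.
have a0 : a != 0.
  apply: contraNneq p0 => a0; move: E; rewrite a0 eval_sym0 => /eqP.
  rewrite mulf_eq0 (negPf bE) orbF => /eqP e; apply/eqP/poly_in_q_inj.
  by rewrite e /poly_in_q rmorph0.
have [A [A0 sA EA]] := eval_sym_clear a0; have [B [B0 sB EB]] := eval_sym_clear b0.
set ma := (size a).-1 in sA EA; set mb := (size b).-1 in sB EB.
have PE : 'X^ma * p * B = 'X^mb * A.
  apply: poly_in_q_inj; rewrite /poly_in_q !rmorphM /= -?/(poly_in_q _) !poly_in_qX -EA -EB -E; ring.
have q0 : qq != 0 by apply: q_neq0.
have Ane : A != 0 by apply: contraNneq A0 => ->; rewrite horner0.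
have Bne : B != 0 by apply: contraNneq B0 => ->; rewrite horner0.
have sp : size p != 0%N by rewrite size_poly_eq0.
have szE : (ma + (size p).-1 + mb.*2 = mb + ma.*2)%N.
  have := congr1 (fun P : {poly R[i]} => (size P).-1) PE.
  rewrite /= !size_mul ?mulf_neq0 ?expf_neq0 ?polyX_eq0 // !size_polyXn sA sB.
  by move: sp; case: (size p) => // sp' _; rewrite addnS /=; lia.
suff s1 : (size p <= 1)%N by rewrite (size1_polyC s1) hornerC.
rewrite leqNgt; apply/negP => s2.
have lt : (mb < ma)%N by lia.
have : 'X^(ma - mb) * p * B = A.
  apply: (mulfI (_ : 'X^mb != 0 :> {poly R[i]})); first by rewrite expf_neq0 ?polyX_eq0.
  by rewrite !mulrA -exprD subnKC ?(ltnW lt).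
move=> H; case/negP: A0; rewrite -H !hornerM hornerXn expr0n.
have -> : (ma - mb == 0)%N = false by rewrite subn_eq0 leqNgt lt.
by rewrite !mul0r.
Qed.

Lemma inK0 : in_Cqsym (0 : Cq).
Proof. by exists 0, 1; rewrite oner_neq0 eval_sym0 mul0r. Qed.

Lemma inK1 : in_Cqsym (1 : Cq).
Proof. by exists 1, 1; rewrite oner_neq0 eval_sym1 divr1. Qed.

Lemma inKD x y : in_Cqsym x -> in_Cqsym y -> in_Cqsym (x + y).
Proof.
case=> a [b [b0 ->]] [c [d [d0 ->]]]; exists (a * d + c * b), (b * d).
rewrite mulf_neq0 // eval_symD !eval_symM; split=> //.
by rewrite addf_div ?eval_sym_neq0.
Qed.

Lemma inKM x y : in_Cqsym x -> in_Cqsym y -> in_Cqsym (x * y).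
Proof.
case=> a [b [b0 ->]] [c [d [d0 ->]]]; exists (a * c), (b * d).
by rewrite mulf_neq0 // !eval_symM invfM mulrACA.
Qed.

Lemma inKN x : in_Cqsym x -> in_Cqsym (- x).
Proof.
move=> Kx; rewrite -mulN1r; apply: inKM => //; exists ((-1)%:P), 1.
by rewrite oner_neq0 eval_sym1 eval_symC divr1 /poly_in_q rmorphN1 rmorphN rmorph1.
Qed.

Lemma inKB x y : in_Cqsym x -> in_Cqsym y -> in_Cqsym (x - y).
Proof. by move=> Kx Ky; apply: inKD => //; apply: inKN. Qed.

Lemma inKV x : in_Cqsym x -> in_Cqsym x^-1.
Proof.
case=> a [b [b0 ->]]; have [->|a0] := eqVneq a 0.
  by rewrite eval_sym0 mul0r invr0; apply: inK0.
by exists b, a; rewrite a0 invf_div.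
Qed.

Lemma inK_prod (I : Type) (r : seq I) (P : pred I) (f : I -> Cq) :
  (forall i, P i -> in_Cqsym (f i)) -> in_Cqsym (\prod_(i <- r | P i) f i).
Proof. by move=> H; apply: big_ind => // *; [exact: inK1 | apply: inKM]. Qed.

Lemma inK_qq : in_Cqsym (qq + qq^-1).
Proof. by exists 'X, 1; rewrite oner_neq0 eval_sym1 eval_symX divr1. Qed.

Lemma inK_sym (w : int) : in_Cqsym (qq ^ w + qq ^ (- w)).
Proof.
have q0 : qq != 0 by apply: q_neq0.
suff H k : in_Cqsym (qq ^+ k + qq ^- k).
  by case: w => k; [rewrite -exprnN; apply: H | rewrite NegzE opprK -exprnN addrC; apply: H].
have [] : in_Cqsym (qq ^+ k + qq ^- k) /\ in_Cqsym (qq ^+ k.+1 + qq ^- k.+1); last by [].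
elim: k => [|k [IH1 IH2]]; first by split; [rewrite expr0 invr1; apply: inKD; apply: inK1|exact: inK_qq].
split=> //; have -> : qq ^+ k.+2 + qq ^- k.+2 =
    (qq + qq^-1) * (qq ^+ k.+1 + qq ^- k.+1) - (qq ^+ k + qq ^- k).
  exact: sym_rec.
by apply: inKB => //; apply: inKM => //; apply: inK_qq.
Qed.

Lemma inK_qint n i w : in_Cqsym (qint n qq i w).
Proof.
exact: (qint_closed (q_neq0 R) n i w q_root inKD inKB inKM inKV inK1 inK_sym).
Qed.

End SymmetricScalars.

Lemma div_opp_cross (F : fieldType) (a b c d : F) : b != 0 -> d != 0 ->
  - (a / b) = c / d -> a * d + c * b = 0.
Proof.
move=> b0 d0 E; have -> : c = - (a / b) * d by rewrite E divfK.
by field.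
Qed.

(** * Positivity at q = 1/2 *)

Section Positive.
Variable R : realType.
Local Notation Cq := {fraction {poly R[i]}}.
Implicit Types (a b p : {poly R[i]}) (x y : Cq).

Let half : R[i] := 2^-1.

(* Positivity of the value at q = 1/2. *)
Definition posq x := exists a b, [/\ 0 < a.[half], 0 < b.[half] & x = poly_in_q a / poly_in_q b].

Lemma posq_den b : 0 < b.[half] -> poly_in_q b != 0.
Proof.
move=> b0; apply: contraTneq b0 => e; have -> : b = 0.
  by apply: poly_in_q_inj; rewrite e /poly_in_q rmorph0.
by rewrite horner0 ltxx.
Qed.

Lemma posq_poly a : 0 < a.[half] -> posq (poly_in_q a).
Proof. by move=> a0; exists a, 1; rewrite hornerE ltr01 /poly_in_q rmorph1 divr1. Qed.

Lemma posqD x y : posq x -> posq y -> posq (x + y).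
Proof.
case=> a [b [a0 b0 ->]] [c [d [c0 d0 ->]]]; exists (a * d + c * b), (b * d).
rewrite hornerD !hornerM; split; [by rewrite addr_gt0 // mulr_gt0 | by rewrite mulr_gt0 |].
by rewrite addf_div ?posq_den // /poly_in_q rmorphD !rmorphM.
Qed.

Lemma posqM x y : posq x -> posq y -> posq (x * y).
Proof.
case=> a [b [a0 b0 ->]] [c [d [c0 d0 ->]]]; exists (a * c), (b * d).
rewrite !hornerM; split; [by rewrite mulr_gt0 | by rewrite mulr_gt0 |].
by rewrite /poly_in_q !rmorphM invfM mulrACA.
Qed.

Lemma posqV x : posq x -> posq x^-1.
Proof. by case=> a [b [a0 b0 ->]]; exists b, a; rewrite invf_div. Qed.

Lemma posq1 : posq 1.
Proof. by rewrite -(rmorph1 (@FracField.tofrac _)); apply: posq_poly; rewrite hornerE ltr01. Qed.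

Lemma half_gt0 : 0 < half.
Proof. by rewrite invr_gt0 ltr0n. Qed.

Lemma half_lt1 : half < 1.
Proof. by rewrite invf_lt1 ?ltr0n // ltr1n. Qed.

Lemma posq_q : posq q.
Proof. by apply: posq_poly; rewrite hornerX half_gt0. Qed.

Lemma posq_1B k : posq (1 - q ^+ k.+1).
Proof.
have -> : 1 - q ^+ k.+1 = poly_in_q (1 - 'X^(k.+1) : {poly R[i]}).
  by rewrite /poly_in_q rmorphB rmorph1 -poly_in_qX.
apply: posq_poly; rewrite hornerD hornerN hornerXn hornerC subr_gt0.
by rewrite exprn_ilt1 ?half_lt1 // ltW ?half_gt0.
Qed.

Lemma posq_1D k : posq (1 + q ^+ k.+1).
Proof. by apply: posqD; [apply: posq1 | elim: k => [|k IH]; [apply: posq_q | rewrite exprS; apply: posqM => //; apply: posq_q]]. Qed.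

Lemma posqN x : posq x -> ~ posq (- x).
Proof.
case=> a [b [a0 b0 ->]] [c [d [c0 d0 E]]].
have bE := posq_den b0; have dE := posq_den d0.
have : poly_in_q (a * d + c * b) = poly_in_q 0.
  rewrite [poly_in_q 0](rmorph0 (@FracField.tofrac _)).
  have -> : poly_in_q (a * d + c * b) = poly_in_q a * poly_in_q d + poly_in_q c * poly_in_q b.
    by rewrite /poly_in_q rmorphD !rmorphM.
  exact: div_opp_cross bE dE E.
move/poly_in_q_inj/(congr1 (fun p => p.[half])); rewrite horner0 hornerD !hornerM => e.
by have := addr_gt0 (mulr_gt0 a0 d0) (mulr_gt0 c0 b0); rewrite e ltxx.
Qed.

End Positive.

(** * Bar-invariant vectors and their stability under e_i and f_i *)

Section BarInvariants.
Variables (R : realType) (n : nat).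
Hypothesis n_gt0 : (0 < n)%N.
Local Notation Cq := {fraction {poly R[i]}}.
Implicit Types (l m : hspart n) (i : nat) (u : hspart n -> Cq) (w : seq 'I_n.+1).

Let qq : Cq := q.

Definition fword w : hspart n -> Cq :=
  foldr (fun (i : 'I_n.+1) u => fop qq i u) (delta Cq (empty_hspart n)) w.

Definition barinv u := exists s : seq (Cq * seq 'I_n.+1),
  (forall cw, cw \in s -> in_Cqsym cw.1) /\ u = (fun l => \sum_(cw <- s) cw.1 * fword cw.2 l).

Lemma f_wordE w l : (f_word R w)@_l = fword w l.
Proof.
elim: w l => [|i w IH] l /=; first by rewrite mcoeffU /delta eq_sym.
rewrite f_opE //; last by rewrite -ltnS.
by congr fop; apply/funext.
Qed.

Lemma barinv_bar_invariant (v : {malg Cq[hspart n]}) :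
  bar_invariant v <-> barinv (fun l => v@_l).
Proof.
split=> -[s [sK E]]; exists s; split=> //.
  by apply/funext => l; rewrite E raddf_sum /=; apply: eq_bigr => cw _; rewrite mcoeffZ f_wordE.
apply/malgP => l; have := congr1 (fun u => u l) E; rewrite /= => ->.
by rewrite raddf_sum /=; apply: eq_bigr => cw _; rewrite mcoeffZ f_wordE.
Qed.

Lemma barinv0 : barinv (fun=> 0).
Proof. by exists [::]; split=> //; apply/funext => l; rewrite big_nil. Qed.

Lemma barinvD u1 u2 : barinv u1 -> barinv u2 -> barinv (fun l => u1 l + u2 l).
Proof.
case=> s [sK ->] [t [tK ->]]; exists (s ++ t); split.
  by move=> cw; rewrite mem_cat => /orP[/sK|/tK].
by apply/funext => l; rewrite big_cat.
Qed.

Lemma barinvZ c u : in_Cqsym c -> barinv u -> barinv (fun l => c * u l).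
Proof.
move=> Kc [s [sK ->]]; exists [seq (c * cw.1, cw.2) | cw <- s]; split.
  by move=> _ /mapP[cw /sK Kcw ->]; apply: inKM.
apply/funext => l; rewrite big_map big_distrr /=; apply: eq_bigr => cw _; exact: mulrA.
Qed.

Lemma barinv_sum (I : eqType) (r : seq I) (f : I -> hspart n -> Cq) :
  (forall k, k \in r -> barinv (f k)) -> barinv (fun l => \sum_(k <- r) f k l).
Proof.
elim: r => [|k r IH] H.
  have -> : (fun l => \sum_(k <- [::]) f k l) = (fun=> 0) by apply/funext => l; rewrite big_nil.
  exact: barinv0.
have -> : (fun l => \sum_(j <- k :: r) f j l) = (fun l => f k l + \sum_(j <- r) f j l).
  by apply/funext => l; rewrite big_cons.
apply: barinvD; first by apply: H; rewrite mem_head.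
by apply: IH => j jr; apply: H; rewrite inE jr orbT.
Qed.

Lemma barinv_fword w : barinv (fword w).
Proof.
exists [:: (1, w)]; split; first by move=> cw; rewrite inE => /eqP ->; apply: inK1.
by apply/funext => l; rewrite big_seq1 mul1r.
Qed.

Lemma barinv_delta0 : barinv (delta Cq (empty_hspart n)).
Proof. exact: (barinv_fword [::]). Qed.

Lemma barinv_fop i u : (i <= n)%N -> barinv u -> barinv (fop qq i u).
Proof.
rewrite -ltnS => ni [s [sK ->]]; rewrite fop_sum; apply: barinv_sum => cw /sK Kc.
by rewrite fopZ; apply: barinvZ => //; apply: (barinv_fword (Ordinal ni :: cw.2)).
Qed.

Lemma barinv_iter_fop a i u : (i <= n)%N -> barinv u -> barinv (iter a (fop qq i) u).
Proof. by move=> ni Bu; elim: a => //= a; apply: barinv_fop. Qed.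

Lemma fword_wt i w : (i <= n)%N -> exists c : int, forall l, fword w l != 0 -> wt i l = c.
Proof.
move=> ni; elim: w => [|j w [c cE]].
  exists (wt i (empty_hspart n)) => l; rewrite /= /delta.
  by case: (eqVneq l (empty_hspart n)) => [->|_] //; rewrite eqxx.
exists (c - AA n i j) => l /fop_supp[x [ex dx /cE]].
have nj : (j <= n)%N by rewrite -ltnS.
by rewrite (wt_dn n_gt0 ni nj ex dx) => <-; rewrite addrK.
Qed.

(** By induction on the word: e_i kills the empty partition, and on a weight vector the commutator
    with f_j is a scalar in C(q + 1/q). *)
Lemma barinv_eop i u : (i <= n)%N -> barinv u -> barinv (eop qq i u).
Proof.
move=> ni [s [sK ->]]; rewrite eop_sum; apply: barinv_sum => -[c w] /sK Kc /=.
rewrite eopZ; apply: barinvZ => // {s sK c Kc}; elim: w => [|j w IH].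
  have -> : eop qq i (fword [::]) = (fun=> 0); last exact: barinv0.
  apply/funext => l; apply/eqP/contraT => /eop_supp[x [_ ux]].
  rewrite /= /delta; case: (eqVneq (up x l) (empty_hspart n)) => [e|_]; last by rewrite eqxx.
  by have := sumn_up ux; rewrite e.
have nj : (j <= n)%N by rewrite -ltnS.
have [c cE] := fword_wt w ni.
have -> : eop qq i (fword (j :: w)) =
    (fun l => fop qq j (eop qq i (fword w)) l + (if i == j then qint n qq i c else 0) * fword w l).
  apply/funext => l /=; rewrite (eop_fop n_gt0 (q_neq0 R) (@q_root R)) //; congr (_ + _).
  case: (i == j); last by rewrite mul0r.
  case: (eqVneq (fword w l) 0) => [->|/cE ->]; by rewrite ?mulr0.
apply: barinvD; first exact: barinv_fop.
apply: barinvZ; last exact: barinv_fword.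
by case: (i == j); [apply: inK_qint | apply: inK0].
Qed.

Lemma barinv_iter_eop a i u : (i <= n)%N -> barinv u -> barinv (iter a (eop qq i) u).
Proof. by move=> ni Bu; elim: a => //= a; apply: barinv_eop. Qed.

End BarInvariants.

(** * Charges and the quadratic form that counts bars *)

Section Charges.
Variable n : nat.
Hypothesis n_gt0 : (0 < n)%N.
Local Notation h := (hh n).
Implicit Types (l m tau : hspart n) (i j k x y z : nat).

(** The charge of a runner of the abacus: the number of parts congruent to k minus the number
    congruent to -k. Removing a bar does not change it. *)
Definition ch l k : int := \sum_(y <- parts l) bq n k y.

Lemma wt_ch i l : wt i l = (i == 0%N)%:Z + 2 * (ch l i - ch l i.+1).
Proof.
rewrite /wt /ch; congr (_ + _); rewrite -sumrB big_distrr /=.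
by apply: eq_bigr => y _.
Qed.

Lemma bq_oppl k x y : (h %| x + y)%N -> bq n x k = - bq n y k.
Proof. by move=> d; rewrite bqC (bq_opp _ d) bqC. Qed.

Lemma ch_mod l x y : (x = y %[mod h])%N -> ch l x = ch l y.
Proof. by move=> e; apply: eq_bigr => z _; rewrite bqC (bq_mod _ e) bqC. Qed.

Lemma ch_opp l x y : (h %| x + y)%N -> ch l x = - ch l y.
Proof. by move=> e; rewrite /ch -sumrN; apply: eq_bigr => z _; rewrite bqC (bq_opp _ e) bqC. Qed.

Lemma ch_dvd l y : (h %| y)%N -> ch l y = 0.
Proof.
move=> hy; have e : (h %| y + y)%N by rewrite dvdn_addr.
have : ch l y *+ 2 = 0 by rewrite mulr2n {1}(ch_opp l e) addNr.
by move=> /eqP; rewrite mulrn_eq0 => /eqP.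
Qed.

Lemma bq_ed k i x : (i <= n)%N -> ed n i x -> bq n k x - bq n k x.+1 = bq n k i - bq n k i.+1.
Proof.
move=> ni; rewrite edE // => /orP[] /eqP e.
  have e1 : (x = i %[mod h])%N by rewrite e modn_small // /hh; lia.
  have e2 : (x.+1 = i.+1 %[mod h])%N by rewrite -addn1 -modnDml e1 modnDml addn1.
  by rewrite (bq_mod _ e1) (bq_mod _ e2).
have d : (h %| x + i.+1)%N by rewrite /dvdn -modnDml addnS e -/h modnn.
have d1 : (h %| x.+1 + i)%N by rewrite addSnnS.
by rewrite (bq_opp _ d) (bq_opp _ d1); ring.
Qed.

(** The simple root alpha_i in the coordinates [ch]. *)
Definition alpha i k : int := bq n k i - bq n k i.+1.

Lemma bq0 k : bq n k 0 = 0.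
Proof. by rewrite /bq mod0n addn0 subrr. Qed.

Lemma ch_up i x l k : (i <= n)%N -> ed n i x -> upok x l -> ch (up x l) k = ch l k - alpha i k.
Proof. by move=> ni ex ux; rewrite /ch sum_up ?bq0 // /alpha -(bq_ed k ni ex); ring. Qed.

Lemma ch_dn i x l k : (i <= n)%N -> ed n i x -> dnok x l -> ch (dn x l) k = ch l k + alpha i k.
Proof. by move=> ni ex dx; rewrite -[in RHS](dnK dx) (ch_up k ni ex (upok_dn dx)) subrK. Qed.

Lemma sum_bq (f : nat -> int) y : (y < h)%N ->
  \sum_(k < h) f k * bq n k y = f y - f ((h - y) %% h)%N.
Proof.
move=> yh; have h0 : (0 < h)%N by [].
have zh : ((h - y) %% h < h)%N by rewrite ltn_mod.
under eq_bigr => k _.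
  have -> : bq n k y = (val k == y)%:Z - (val k == (h - y) %% h)%N%:Z.
    rewrite /bq (modn_small (ltn_ord k)) (modn_small yh); congr (_ - _%:Z).
    have -> : (h %| k + y)%N = (k == h - y %[mod h])%N.
      by rewrite -(eqn_modDr y) subnK ?modnn //; apply: ltnW.
    by rewrite (modn_small (ltn_ord k)).
  rewrite mulrBr; over.
rewrite sumrB; congr (_ - _).
  rewrite (bigD1 (Ordinal yh)) //= eqxx mulr1 big1 ?addr0 // => k.
  by rewrite -val_eqE /= => /negPf ->; rewrite mulr0.
rewrite (bigD1 (Ordinal zh)) //= eqxx mulr1 big1 ?addr0 // => k.
by rewrite -val_eqE /= => /negPf ->; rewrite mulr0.
Qed.

(* 4 h times the number of h-bars that can be removed successively; a
   quadratic form in the charges measures the size of the bar-core. *)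
Definition DD l : int := 4 * (sumn l)%:Z -
  \sum_(k < h) (h%:Z * ch l k ^+ 2 - (h%:Z - 2 * k%:Z) * ch l k).

Lemma DD_up i x l : (i <= n)%N -> ed n i x -> upok x l ->
  DD (up x l) = DD l + 2 * h%:Z * (wt i l - (dd n i)%:Z).
Proof.
move=> ni ex ux; rewrite /DD sumn_up // -[(sumn l).+1]addn1 PoszD.
under eq_bigr => k _ do rewrite (ch_up k ni ex ux).
have ih : (i < h)%N by rewrite /hh; lia.
have ih1 : (i.+1 < h)%N by rewrite /hh; lia.
(* Expanding the quadratic form at ch - alpha_i leaves three sums: the pairing with alpha_i, the
   squared length of alpha_i, and the linear term. *)
have E1 : \sum_(k < h) ch l k * alpha i k = 2 * (ch l i - ch l i.+1).
  under eq_bigr => k _ do rewrite /alpha mulrBr.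
  rewrite sumrB !sum_bq //.
  have d1 : (h %| (h - i) %% h + i)%N by rewrite /dvdn modnDml subnK ?modnn // ltnW.
  have d2 : (h %| (h - i.+1) %% h + i.+1)%N by rewrite /dvdn modnDml subnK ?modnn // ltnW.
  by rewrite (ch_opp l d1) (ch_opp l d2); ring.
have E2 : \sum_(k < h) alpha i k * alpha i k = 2 * (dd n i)%:Z.
  under eq_bigr => k _ do rewrite {2}/alpha mulrBr.
  rewrite sumrB !sum_bq //.
  have d1 : (h %| (h - i) %% h + i)%N by rewrite /dvdn modnDml subnK ?modnn // ltnW.
  have d2 : (h %| (h - i.+1) %% h + i.+1)%N by rewrite /dvdn modnDml subnK ?modnn // ltnW.
  have a1 : alpha i ((h - i) %% h)%N = - alpha i i.
    by rewrite /alpha !(bq_oppl _ d1); ring.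
  have a2 : alpha i ((h - i.+1) %% h)%N = - alpha i i.+1.
    by rewrite /alpha !(bq_oppl _ d2); ring.
  rewrite a1 a2 -PoszM -(AA_diag n_gt0 ni) /AA /W /alpha [bq n i.+1 i]bqC; ring.
have E3 : \sum_(k < h) (h%:Z - 2 * k%:Z) * alpha i k = 4 - 2 * h%:Z * (i == 0%N)%:Z.
  under eq_bigr => k _ do rewrite /alpha mulrBr.
  rewrite sumrB !(sum_bq (fun k => h%:Z - 2 * k%:Z)) //.
  rewrite [((h - i.+1) %% h)%N]modn_small; last by rewrite /hh; lia.
  rewrite -(subzn (ltnW ih1)); have [->|i0] := posnP i.
    by rewrite subn0 modnn /=; move: (h%:Z) => H; ring.
  rewrite modn_small; last by rewrite /hh; lia.
  by rewrite -(subzn (ltnW ih)) -[i.+1]addn1 PoszD /=; move: (h%:Z) => H; ring.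
have -> : \sum_(k < h) (h%:Z * (ch l k - alpha i k) ^+ 2 - (h%:Z - 2 * k%:Z) * (ch l k - alpha i k)) =
  \sum_(k < h) (h%:Z * ch l k ^+ 2 - (h%:Z - 2 * k%:Z) * ch l k)
  - 2 * h%:Z * (\sum_(k < h) ch l k * alpha i k) + h%:Z * (\sum_(k < h) alpha i k * alpha i k)
  + \sum_(k < h) (h%:Z - 2 * k%:Z) * alpha i k.
  rewrite !big_distrr /= -sumrB -!big_split /=; apply: eq_bigr => k _; ring.
rewrite E1 E2 E3 wt_ch; ring.
Qed.

Lemma DD_dn i x l : (i <= n)%N -> ed n i x -> dnok x l ->
  DD (dn x l) = DD l - 2 * h%:Z * (wt i l + (dd n i)%:Z).
Proof.
move=> ni ex dx; have := DD_up ni ex (upok_dn dx).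
rewrite dnK // (wt_dn n_gt0 ni ni ex dx) (AA_diag n_gt0 ni) PoszM => ->; ring.
Qed.

Lemma bar_removal_inv l m : bar_removal l m ->
  (forall k, ch l k = ch m k) /\ sumn l = (sumn m + h)%N.
Proof.
case=> [[x [s [hx pl pm]]]|[x [y [xy pl]]]].
  split=> [k|]; rewrite /ch ?(perm_big _ pl) ?(perm_big _ pm) ?(perm_sumn pl) ?(perm_sumn pm) /=.
    rewrite big_cons; case: eqP => [->|_]; first by rewrite (@bq_mod _ k h 0) ?modnn ?mod0n // bq0 add0r.
    rewrite big_cons; congr (_ + _); apply: bq_mod.
    by rewrite -[in LHS](subnK hx) modnDr.
  by case: eqP => [->|_] /=; rewrite ?[(h + _)%N]addnC // addnAC subnK.
have d : (h %| x + y)%N by rewrite xy.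
split=> [k|]; rewrite /ch ?(perm_big _ pl) ?(perm_sumn pl) /=.
  by rewrite !big_cons (bq_opp _ d) addrA addNr add0r.
by rewrite addnA xy addnC.
Qed.

Lemma DD_removal l m : bar_removal l m -> DD l = DD m + 4 * h%:Z.
Proof.
case/bar_removal_inv => chE sE; rewrite /DD sE PoszD.
under eq_bigr => k _ do rewrite chE.
ring.
Qed.

End Charges.

Lemma leq_shift (k y z : nat) : (0 < k)%N -> (0 < y)%N -> (y <= z)%N -> (k <= z - y)%N ->
  (k < z)%N /\ (y <= z - k)%N /\ (z - k < z)%N.
Proof. by lia. Qed.

(** * Bar-cores are determined by their charges *)

Section Cores.
Variable n : nat.
Hypothesis n_gt0 : (0 < n)%N.
Local Notation h := (hh n).
Implicit Types (l m tau : hspart n) (i j k x y z : nat).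

Lemma h_gt0 : (0 < h)%N. Proof. by []. Qed.

(** Multiples of h may be repeated, so replacing a part y divisible by h with y - h never breaks
    h-strictness and is always a legal bar removal. *)
Lemma core_not_dvd tau y : is_bar_core tau -> y \in parts tau -> ~~ (h %| y)%N.
Proof.
move=> core ly; apply/negP => hy.
have y0 : (0 < y)%N by case: y ly {hy} => //; rewrite (negPf (part_neq0 tau)).
have hley : (h <= y)%N by apply: dvdn_leq.
pose s := if y == h then rem y tau else (y - h)%N :: rem y tau.
have pm : perm_eq (mkhs n s) s.
  apply: mkhs_perm; rewrite /s.
    case: eqP => [_|ne]; first exact/rem0_notin/part_neq0.
    by rewrite inE negb_or rem0_notin ?part_neq0 // andbT eq_sym subn_eq0 -ltnNge ltn_neqAle eq_sym hley andbT; apply/eqP.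
  move=> z hz; have m1 := mult_le1 tau hz.
  have m2 : (mult z (rem y tau) <= 1)%N by rewrite mult_rem; apply: leq_trans (leq_subr _ _) m1.
  case: eqP => // ne; rewrite mult_cons.
  have -> : (z == y - h)%N = false; last by rewrite add0n.
  by apply/eqP => e; move: hz; rewrite e dvdn_sub.
apply: (core (mkhs n s)); left; exists y, (rem y tau); split=> //.
exact: perm_to_rem.
Qed.

Lemma core_mult tau y : is_bar_core tau -> mult y tau = (y \in parts tau).
Proof.
move=> core; rewrite mem_mult; case: (boolP (h %| y)%N) => hy.
  case: (boolP (0 < mult y tau)%N); last by case: (mult y tau).
  by rewrite -mem_mult => /(core_not_dvd core); rewrite hy.
by have := mult_le1 tau hy; case: (mult y tau) => [|[|]].
Qed.

Lemma core_uniq tau : is_bar_core tau -> uniq tau.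
Proof. by move=> core; apply: count_mem_uniq => y; apply: core_mult core. Qed.

Lemma core_sub tau y : is_bar_core tau -> (h < y)%N -> y \in parts tau -> (y - h)%N \in parts tau.
Proof.
move=> core hy ly; apply: contraT => nly.
pose s := (y - h)%N :: rem y tau.
have pm : perm_eq (mkhs n s) s.
  apply: mkhs_perm => [|z hz].
    by rewrite inE negb_or rem0_notin ?part_neq0 // andbT eq_sym subn_eq0 -ltnNge.
  rewrite mult_cons mult_rem; case: eqP => [->|_]; last first.
    by rewrite add0n; apply: leq_trans (leq_subr _ _) (mult_le1 tau hz).
  by rewrite (core_mult _ core) (negPf nly).
case: (core (mkhs n s)); left; exists y, (rem y tau); split; first exact: ltnW.
  exact: perm_to_rem.
by rewrite (gtn_eqF hy).
Qed.

Lemma core_compl tau y : is_bar_core tau -> (y < h)%N -> y \in parts tau -> (h - y)%N \notin parts tau.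
Proof.
move=> core yh ly; apply/negP => lhy.
have yy : y != (h - y)%N by rewrite /hh in yh *; lia.
pose s := rem (h - y)%N (rem y tau).
have ly2 : (h - y)%N \in rem y tau by rewrite mem_rem_uniq ?core_uniq // inE eq_sym yy.
have pm : perm_eq (mkhs n s) s.
  apply: mkhs_perm => [|z hz]; first by do 2!apply: rem0_notin; apply: part_neq0.
  rewrite !mult_rem; apply: leq_trans (leq_subr _ _) _; apply: leq_trans (leq_subr _ _) _.
  exact: mult_le1.
apply: (core (mkhs n s)); right; exists y, (h - y)%N; split; first by rewrite subnKC // ltnW.
apply: perm_trans (perm_to_rem ly) _; rewrite perm_cons.
apply: perm_trans (perm_to_rem ly2) _; rewrite perm_cons perm_sym.
exact: pm.
Qed.

Lemma core_down tau y z : is_bar_core tau -> z \in parts tau -> (0 < y <= z)%N ->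
  (y = z %[mod h])%N -> y \in parts tau.
Proof.
move=> core; elim/ltn_ind: z => z IH lz /andP[y0 yz] e.
move: yz; rewrite leq_eqVlt => /orP[/eqP -> //|yz].
have d : (h %| z - y)%N by rewrite -eqn_mod_dvd ?(ltnW yz) // e.
have hzy : (h <= z - y)%N by apply: dvdn_leq d; rewrite subn_gt0.
have [hz [yzh zhz]] := leq_shift h_gt0 y0 (ltnW yz) hzy.
apply: (IH (z - h)%N); rewrite ?y0 ?yzh //.
- exact: core_sub.
- by rewrite e -[in LHS](subnK (ltnW hz)) modnDr.
Qed.

Definition nres (tau : seq nat) y : nat := count (fun z => y == z %[mod h])%N tau.

Lemma ch_nres tau y : ch tau y = (nres tau y)%:Z - (count (fun z => h %| y + z)%N tau)%:Z.
Proof.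
rewrite /ch /nres; elim: (parts tau) => [|z s IH]; first by rewrite big_nil.
by rewrite big_cons IH /= !PoszD /bq; ring.
Qed.

Lemma nres_le tau y : is_bar_core tau -> y \notin parts tau -> (nres tau y <= y %/ h)%N.
Proof.
move=> core ny; case: (posnP y) => [y0|y0].
  subst y; rewrite /nres leqn0 -leqn0 leqNgt -has_count; apply/hasPn => z lz.
  by rewrite mod0n eq_sym; apply: core_not_dvd lz.
rewrite /nres -size_filter; pose s := [seq (y %% h + j * h)%N | j <- iota 0 (y %/ h)].
have -> : (y %/ h = size s)%N by rewrite size_map size_iota.
apply: uniq_leq_size; first by rewrite filter_uniq // core_uniq.
move=> z; rewrite mem_filter => /andP[/eqP e lz]; apply/mapP; exists (z %/ h)%N.
  rewrite mem_iota add0n leq0n /= ltnNge; apply/negP => le.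
  case/negP: ny; apply: (core_down core lz) => //; rewrite y0 /=.
  by rewrite (divn_eq y h) (divn_eq z h) e leq_add2r leq_mul2r le orbT.
by rewrite e {1}(divn_eq z h) addnC.
Qed.

Lemma nres_gt tau y : is_bar_core tau -> y \in parts tau -> (y %/ h < nres tau y)%N.
Proof.
move=> core ly; have y0 : (0 < y)%N by case: y ly => //; rewrite (negPf (part_neq0 tau)).
have r0 : (0 < y %% h)%N by rewrite lt0n -/(dvdn _ _); apply: core_not_dvd ly.
rewrite /nres -size_filter; pose s := [seq (y %% h + j * h)%N | j <- iota 0 (y %/ h).+1].
have -> : ((y %/ h).+1 = size s)%N by rewrite size_map size_iota.
apply: uniq_leq_size.
  rewrite map_inj_uniq ?iota_uniq // => j k /addnI/eqP; rewrite eqn_mul2r => /orP[/eqP //|/eqP //].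
move=> z /mapP[j]; rewrite mem_iota add0n /= ltnS => jy ->.
have e : (y %% h + j * h = y %[mod h])%N by rewrite addnC modnMDl modn_mod.
rewrite mem_filter e eqxx /=; apply: (core_down core ly) => //.
by rewrite addn_gt0 r0 /= {2}(divn_eq y h) addnC leq_add2r leq_mul2r jy orbT.
Qed.

(** The parts of a core in one residue class form an initial segment of the class, and then the
    opposite class is empty; so a positive charge is the length of the segment. *)
Lemma coreP tau y : is_bar_core tau -> (y \in parts tau) = ((y %/ h)%N%:Z < ch tau y).
Proof.
move=> core; rewrite ch_nres; case: (boolP (y \in parts tau)) => ly; last first.
  apply/esym/negbTE; rewrite -leNgt lerBlDr -PoszD lez_nat.
  by apply: leq_trans (nres_le core ly) _; apply: leq_addr.
have -> : count (fun z => h %| y + z)%N tau = 0%N.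
  apply/eqP; rewrite -leqn0 leqNgt -has_count; apply/hasPn => z lz; apply/negP => d.
  have low x : x \in parts tau -> (x %% h)%N \in parts tau.
    move=> lx; apply: (core_down core lx); last by rewrite modn_mod.
    by rewrite leq_mod andbT lt0n -/(dvdn _ _); apply: core_not_dvd lx.
  have yh : (y %% h < h)%N by rewrite ltn_mod.
  have zh : (z %% h < h)%N by rewrite ltn_mod.
  have := core_compl core yh (low y ly); have e : (h - y %% h = z %% h)%N.
    have r0 : (0 < y %% h)%N by rewrite lt0n -/(dvdn _ _); apply: core_not_dvd ly.
    have : (h %| y %% h + z %% h)%N by rewrite /dvdn modnDm.
    case/dvdnP => k ek.
    have k1 : k = 1%N by case: k ek => [|[|k]] //; rewrite ?mul0n ?mulSn; lia.
    by apply/eqP; rewrite -(eqn_add2l (y %% h)) subnKC ?(ltnW yh) // ek k1 mul1n.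
  by rewrite e (low z lz).
by rewrite subr0 ltz_nat nres_gt.
Qed.

Lemma core_ext tau1 tau2 : is_bar_core tau1 -> is_bar_core tau2 ->
  (forall k, ch tau1 k = ch tau2 k) -> tau1 = tau2.
Proof.
move=> core1 core2 e; apply: hspart_ext => y _.
by rewrite !core_mult // !coreP // e.
Qed.

End Cores.

(** * The form [DD] vanishes exactly on cores *)

Section CoreSize.
Variable n : nat.
Hypothesis n_gt0 : (0 < n)%N.
Local Notation h := (hh n).
Implicit Types (l m tau : hspart n) (i j k x y z : nat).

Lemma sum_blocks (f : nat -> int) Q :
  \sum_(0 <= y < Q * h) f y = \sum_(j < Q) \sum_(k < h) f (k + j * h)%N.
Proof.
elim: Q => [|Q IH]; first by rewrite mul0n big_geq // big_ord0.
rewrite mulSnr (big_cat_nat _ (n := (Q * h)%N)) ?leq_addr //= IH big_ord_recr /=; congr (_ + _).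
by rewrite -{1}[(Q * h)%N]add0n big_addn addKn big_mkord.
Qed.

Lemma sum_core (f : nat -> int) tau M : is_bar_core tau -> (sumn tau < M)%N ->
  \sum_(y <- parts tau) f y = \sum_(0 <= y < M) (if y \in parts tau then f y else 0).
Proof.
move=> core tM; rewrite -big_mkcond /= /index_iota subn0 -[RHS]big_filter.
apply: perm_big; apply: uniq_perm; rewrite ?filter_uniq ?iota_uniq ?core_uniq // => y.
rewrite mem_filter mem_iota add0n /=; apply: esym; apply: andb_idr => /leq_sumn.
by move=> le; apply: leq_ltn_trans tM.
Qed.

Lemma sum_arith (c k : nat) :
  \sum_(j < c) 4 * (k + j * h)%N%:Z = 4 * k%:Z * c%:Z + 2 * h%:Z * c%:Z * (c%:Z - 1).
Proof.
elim: c => [|c IH]; first by rewrite big_ord0; ring.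
by rewrite big_ord_recr /= IH -[c.+1]addn1 !PoszD PoszM; move: (h%:Z) => H; ring.
Qed.

Lemma sum_arith_lt (p : int) Q k : p <= Q%:Z ->
  \sum_(j < Q) (if j%:Z < p then 4 * (k + j * h)%N%:Z else 0) =
  if 0 < p then 4 * k%:Z * p + 2 * h%:Z * p * (p - 1) else 0.
Proof.
case: p => p pQ; last first.
  by rewrite big1.
have pQ' : (p <= Q)%N by rewrite -lez_nat.
have -> : (if 0 < p%:Z then 4 * k%:Z * p%:Z + 2 * h%:Z * p%:Z * (p%:Z - 1) else 0) =
   4 * k%:Z * p%:Z + 2 * h%:Z * p%:Z * (p%:Z - 1).
  by case: p {pQ pQ'} => // ; ring.
rewrite -sum_arith (big_ord_widen Q (fun j => 4 * (k + j * h)%N%:Z) pQ') [RHS]big_mkcond /=.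
by apply: eq_bigr => j _; rewrite ltz_nat.
Qed.

Lemma div_res j k : (k < h)%N -> ((k + j * h) %/ h = j)%N.
Proof. by move=> kh; rewrite addnC divnMDl // divn_small // addn0. Qed.

(** The parts in the class of k form an arithmetic progression of length [ch tau k], so [DD] is a
    sum of terms g k. The terms of opposite classes cancel, and reversing the sum shows that it is
    its own opposite. *)
Lemma DD_core tau : is_bar_core tau -> DD tau = 0.
Proof.
move=> core; set Q := (sumn tau).+1.
have tQ : (sumn tau < Q * h)%N by apply: leq_pmulr.
pose g k : int := (if 0 < ch tau k then 4 * k%:Z * ch tau k + 2 * h%:Z * ch tau k * (ch tau k - 1) else 0)
  - (h%:Z * ch tau k ^+ 2 - (h%:Z - 2 * k%:Z) * ch tau k).
have -> : DD tau = \sum_(k < h) g k.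
  rewrite /DD /g [RHS]sumrB; congr (_ - _).
  have -> : 4 * (sumn tau)%:Z = \sum_(y <- parts tau) 4 * y%:Z.
    rewrite -big_distrr /=; congr (_ * _).
    by elim: (parts tau) => [|y s IH]; rewrite ?big_nil // big_cons /= PoszD IH.
  rewrite (sum_core _ core tQ) sum_blocks exchange_big /=; apply: eq_bigr => k _.
  rewrite -(sum_arith_lt (Q := Q)).
    apply: eq_bigr => j _; rewrite (coreP n_gt0 _ core) div_res // (ch_mod tau (y := k)) //.
    by rewrite addnC modnMDl.
  rewrite leNgt; apply/negP => lt.
  have : (k + Q * h)%N \in parts tau.
    by rewrite (coreP n_gt0 _ core) div_res // (ch_mod tau (y := k)) // addnC modnMDl.
  move/leq_sumn; rewrite leqNgt => /negP; apply.
  by apply: leq_trans tQ (leq_addl _ _).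
have g0 : g 0%N = 0 by rewrite /g ch_dvd // ltxx expr0n /= !mulr0 !subr0.
rewrite big_ord_recl g0 add0r.
have gN k k' : (k + k' = h)%N -> g k + g k' = 0.
  move=> kk; have d : (h %| k' + k)%N by rewrite addnC kk.
  rewrite /g (ch_opp tau d) -kk PoszD; have [p0|p0|p0] := ltrgt0P (ch tau k).
  - by rewrite oppr_gt0 ltNge (ltW p0) /=; ring.
  - by rewrite oppr_gt0 p0; ring.
  - by rewrite p0 oppr0 ltxx; ring.
set S := \sum_(i < n.*2) _.
have : S + S = 0.
  rewrite {2}/S (reindex_inj rev_ord_inj) /= -big_split big1 //= => k _.
  by apply: gN; rewrite /= /bump /= /hh; have := ltn_ord k; lia.
by move=> /eqP; rewrite -mulr2n mulrn_eq0 => /eqP.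
Qed.

Lemma DD_ge0 l : 0 <= DD l.
Proof.
have [N lN] := ubnP (sumn l); elim: N => // N IH in l lN *.
case: (pselect (is_bar_core l)) => [/DD_core -> //|nc].
have [m lm] : exists m, bar_removal l m.
  by apply: contrapT => H; apply: nc => m lm; apply: H; exists m.
rewrite (DD_removal lm) addr_ge0 // ?mulr_ge0 //; apply: IH.
have [_ sE] := bar_removal_inv lm; move: lN; rewrite sE ltnS; apply: leq_trans.
by rewrite -addn1 leq_add2l.
Qed.

Lemma DD0_core l : DD l = 0 -> is_bar_core l.
Proof.
move=> D0 m lm; have := DD_ge0 m; have := DD_removal lm; rewrite D0 => /eqP.
rewrite eq_sym addr_eq0 => /eqP ->; rewrite oppr_ge0 lez_nat.
by rewrite leqn0 muln_eq0.
Qed.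

(** Describes the block by invariants that change in a known way under moves, so that membership can
    be proved without exhibiting a bar. *)
Lemma block1P tau l : is_bar_core tau ->
  (bar_removal l tau <-> (forall k, ch l k = ch tau k) /\ DD l = 4 * h%:Z).
Proof.
move=> core; split=> [lt|[chE D]].
  by have [e _] := bar_removal_inv lt; rewrite (DD_removal lt) DD_core // add0r.
have nc : ~ is_bar_core l.
  by move/DD_core/eqP; rewrite D mulf_eq0.
have [m lm] : exists m, bar_removal l m.
  by apply: contrapT => H; apply: nc => m lm; apply: H; exists m.
have mc : is_bar_core m.
  by apply: DD0_core; have := DD_removal lm; rewrite D => /eqP; rewrite -subr_eq subrr eq_sym => /eqP.
suff <- : m = tau by [].
apply: core_ext => // k; have [e _] := bar_removal_inv lm; by rewrite -e chE.
Qed.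

End CoreSize.

(** * The partitions obtained from a core by adding one bar *)

Section WeightOne.
Variable n : nat.
Hypothesis n_gt0 : (0 < n)%N.
Local Notation h := (hh n).
Implicit Types (l m tau : hspart n) (i j k x y z Y : nat).

(* One new part for each residue class {k, -k} modulo h: the part x obtained by
   adding the only possible bar of type x -> x + h, or k, -k. *)
Definition newpart tau k : nat :=
  if k == 0%N then h else
  if 0 < ch tau k then (k + `|ch tau k| * h)%N else (h - k + `|ch tau k| * h)%N.

Definition newparts tau : seq nat := sort leq [seq newpart tau k | k <- iota 0 n.+1].

Lemma divmod_small r a : (r < h)%N -> ((r + a * h) %/ h = a)%N /\ ((r + a * h) %% h = r)%N.
Proof. by move=> rh; rewrite addnC divnMDl // modnMDl divn_small ?modn_small // addn0. Qed.

Lemma newpart_mod tau k : (0 < k <= n)%N ->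
  (newpart tau k %% h = (if (0 < ch tau k)%R then k else h - k))%N.
Proof.
case/andP=> k0 kn; rewrite /newpart gtn_eqF //; case: ifP => _.
  by case: (@divmod_small k `|ch tau k|) => //; rewrite /hh; lia.
by case: (@divmod_small (h - k)%N `|ch tau k|) => //; rewrite /hh; lia.
Qed.

(** The equation on the charge says that Y is the first element of its residue class missing from
    the core. When the charge is 0 both k and h - k qualify, and n < Y selects the larger one. *)
Lemma mem_newparts tau Y : (Y \in newparts tau) =
  (n < Y)%N && ((Y == h) || (ch tau Y == (Y %/ h)%N%:Z)).
Proof.
rewrite mem_sort; apply/mapP/andP => [[k]|[nY]].
  rewrite mem_iota add0n /= ltnS => kn ->.
  have [-> | k0] := posnP k; first by rewrite /newpart /= eqxx; split=> //; rewrite /hh; lia.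
  rewrite /newpart gtn_eqF //; case: ltP => ck.
    have kh : (k < h)%N by rewrite /hh; lia.
    have [dE mE] := @divmod_small k `|ch tau k| kh; split.
      have : (0 < `|ch tau k|)%N by lia.
      by case: `|ch tau k|%N => // c _; rewrite mulSn /hh; lia.
    have cE : ch tau (k + `|ch tau k| * h)%N = ch tau k.
      by apply: ch_mod; rewrite mE modn_small.
    by rewrite dE cE gtz0_abs // eqxx orbT.
  have kh : (h - k < h)%N by rewrite /hh; lia.
  have [dE mE] := @divmod_small (h - k)%N `|ch tau k| kh; split; first by rewrite /hh; lia.
  have dk : (h %| h - k + k)%N by rewrite subnK ?dvdnn // /hh; lia.
  have cE : ch tau (h - k + `|ch tau k| * h)%N = ch tau (h - k)%N.
    by apply: ch_mod; rewrite mE modn_small.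
  by rewrite dE cE (ch_opp tau dk) lez0_abs // eqxx orbT.
case/orP=> [/eqP->|/eqP cY]; first by exists 0%N; rewrite ?mem_iota.
have rh : (Y %% h < h)%N by rewrite ltn_mod.
have cr : ch tau (Y %% h) = (Y %/ h)%N%:Z by rewrite -cY; apply: ch_mod; rewrite modn_mod.
have Ye := divn_eq Y h.
have [r0|r0] := posnP (Y %% h).
  move: cr; rewrite r0 ch_dvd //= => /esym/eqP; rewrite eqz_nat => /eqP d0.
  by move: nY; rewrite Ye r0 d0.
have [rn|rn] := leqP (Y %% h) n.
  have q0 : (0 < Y %/ h)%N by rewrite divn_gt0 // leqNgt; apply/negP => Yh; move: rn; rewrite modn_small // leqNgt nY.
  exists (Y %% h)%N; first by rewrite mem_iota.
  by rewrite /newpart gtn_eqF // cr ltz_nat q0 absz_nat addnC -Ye.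
have e : ch tau (h - Y %% h)%N = - (Y %/ h)%N%:Z.
  by rewrite (ch_opp tau (y := (Y %% h)%N)) ?cr // subnK // ltnW.
exists (h - Y %% h)%N; first by rewrite mem_iota add0n /= /hh in rn rh *; lia.
rewrite /newpart gtn_eqF ?subn_gt0 // e oppr_gt0 ltz_nat ltn0 abszN absz_nat.
by rewrite subKn ?(ltnW rh) // addnC -Ye.
Qed.

Lemma size_newparts tau : size (newparts tau) = n.+1.
Proof. by rewrite size_sort size_map size_iota. Qed.

Lemma newparts_sorted tau : sorted ltn (newparts tau).
Proof.
rewrite ltn_sorted_uniq_leq sort_sorted ?andbT; last exact: leq_total.
rewrite sort_uniq map_inj_in_uniq ?iota_uniq // => k k'.
rewrite !mem_iota !add0n !ltnS /= => kn kn' e.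
have f a : (a <= n)%N -> a = (if newpart tau a %% h <= n then newpart tau a %% h else h - newpart tau a %% h)%N.
  move=> an; have [->|a0] := posnP a; first by rewrite /newpart /= modnn.
  by rewrite newpart_mod ?a0 //; case: (0 < ch tau a); case: leqP => //; rewrite /hh; lia.
by rewrite (f k) // e -f.
Qed.

Section Core.
Variable tau : hspart n.
Hypothesis core : is_bar_core tau.

Lemma newparts_gt Y : Y \in newparts tau -> (n < Y)%N.
Proof. by rewrite mem_newparts => /andP[]. Qed.

Lemma h_newparts : h \in newparts tau.
Proof. by rewrite mem_newparts eqxx andbT /hh; lia. Qed.

Lemma newparts_notin Y : Y \in newparts tau -> Y \notin parts tau.
Proof.
rewrite mem_newparts => /andP[_ /orP[/eqP->|/eqP e]].
  by apply/negP => /(core_not_dvd core); rewrite dvdnn.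
by rewrite (coreP n_gt0) // e ltxx.
Qed.

Lemma newparts_dvd Y : Y \in newparts tau -> (h %| Y)%N -> Y = h.
Proof.
rewrite mem_newparts => /andP[nY /orP[/eqP //|/eqP e]] d.
move: e; rewrite ch_dvd // => /esym/eqP; rewrite eqz_nat => /eqP e.
by move: nY; rewrite -(divnK d) e.
Qed.

Lemma newparts_sub Y : Y \in newparts tau -> (h < Y)%N -> (Y - h)%N \in parts tau.
Proof.
move=> YA hY; move: (YA); rewrite mem_newparts => /andP[_]; rewrite gtn_eqF //= => /eqP e.
rewrite (coreP n_gt0) // (ch_mod tau (y := Y)); last by rewrite -{2}(subnK (ltnW hY)) modnDr.
by rewrite e ltz_nat -{2}(subnK (ltnW hY)) divnDr // divnn /= addn1.
Qed.

Lemma newparts_compl Y : Y \in newparts tau -> (Y < h)%N -> (h - Y)%N \notin parts tau.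
Proof.
move=> YA Yh; move: (YA); rewrite mem_newparts => /andP[nY]; rewrite ltn_eqF //= divn_small // => /eqP e.
rewrite (coreP n_gt0) // (ch_opp tau (y := Y)) ?subnK ?(ltnW Yh) // e divn_small //.
by rewrite /hh in Yh *; lia.
Qed.

Lemma mem_newparts_add y : y \in parts tau -> (y + h)%N \notin parts tau -> (y + h)%N \in newparts tau.
Proof.
move=> ly; rewrite !(coreP n_gt0) // in ly *; rewrite -leNgt mem_newparts => le.
apply/andP; split; first by rewrite /hh; lia.
apply/orP; right; rewrite eq_le le /=.
rewrite (ch_mod tau (y := y)) ?modnDr //; move: ly; rewrite divnDr // divnn /= addn1.
by rewrite -lezD1 -addn1.
Qed.

Lemma mem_newparts_pair y : (n < y < h)%N -> y \notin parts tau -> (h - y)%N \notin parts tau ->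
  y \in newparts tau.
Proof.
case/andP=> ny yh; rewrite !(coreP n_gt0) // -!leNgt mem_newparts ny /= => le1 le2.
apply/orP; right; rewrite eq_le le1 /= divn_small //.
move: le2; rewrite (ch_opp tau (y := y)) ?subnK ?(ltnW yh) // divn_small //; first by rewrite oppr_le0.
by rewrite /hh in yh *; lia.
Qed.

(** The core with one bar added, indexed by the largest part that is created: a part h, a part Y - h
    raised to Y, or a pair Y, h - Y. *)
Definition tseq Y : seq nat :=
  if Y == h then h :: tau else
  if (h < Y)%N then Y :: rem (Y - h)%N tau else [:: Y, (h - Y)%N & tau].

Definition tY Y : hspart n := mkhs n (tseq Y).

Lemma tY_perm Y : Y \in newparts tau -> perm_eq (tY Y) (tseq Y).
Proof.
move=> YA; have YT := newparts_notin YA; have nY := newparts_gt YA.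
have YT0 : mult Y tau = 0%N by rewrite core_mult // (negPf YT).
apply: mkhs_perm => [|y hy]; have m1 := mult_le1 tau.
  rewrite /tseq; case: (ltngtP Y h) => hY; rewrite !inE ?negb_or.
  - by rewrite part_neq0 /= andbT !(eq_sym 0%N) subn_eq0 -ltnNge hY andbT -lt0n (leq_ltn_trans _ nY).
  - by rewrite rem0_notin ?part_neq0 // andbT eq_sym -lt0n (leq_ltn_trans _ nY).
  - by rewrite part_neq0.
rewrite /tseq; case: (ltngtP Y h) => hY; rewrite !mult_cons ?mult_rem.
- have YC : mult (h - Y)%N tau = 0%N by rewrite core_mult // (negPf (newparts_compl YA hY)).
  have ne : Y != (h - Y)%N by rewrite /hh in hY *; lia.
  case: (eqVneq y Y) => [->|_]; first by rewrite (negPf ne) YT0.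
  by case: eqVneq => [->|_]; rewrite ?YC ?m1.
- by case: (eqVneq y Y) => [->|_]; rewrite ?YT0 //; apply: leq_trans (leq_subr _ _) (m1 _ hy).
- by case: (eqVneq y h) hy => [->|_]; rewrite ?dvdnn // => hy; apply: m1.
Qed.

Lemma mult_tY Y y : Y \in newparts tau ->
  (mult y (tY Y) + ((h < Y) && (y == Y - h)) =
   mult y tau + (y == Y) + ((Y < h) && (y == h - Y)))%N.
Proof.
move=> YA; rewrite (mult_perm _ (tY_perm YA)) /tseq; case: (ltngtP Y h) => hY.
- by rewrite !mult_cons /=; lia.
- rewrite !mult_cons mult_rem /=; have := core_mult (Y - h)%N core.
  rewrite (newparts_sub YA hY); case: (eqVneq y (Y - h)%N) => [->|_]; lia.
- by rewrite hY mult_cons /=; lia.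
Qed.

Lemma newparts_of_removal l : bar_removal l tau -> exists2 Y, Y \in newparts tau & l = tY Y.
Proof.
have aux Y : Y \in newparts tau -> perm_eq l (tseq Y) -> l = tY Y.
  move=> YA p; apply: hspart_ext => y _; apply: mult_perm; apply: perm_trans p _.
  by rewrite perm_sym tY_perm.
case=> [[x [s [hx pl pt]]]|[x [y [xy pl]]]].
  have xA : x \in newparts tau.
    case: (eqVneq x h) pt => [->|xh] pt; first exact: h_newparts.
    have hx1 : (h < x)%N by rewrite ltn_neqAle eq_sym xh.
    rewrite -(subnK hx); apply: mem_newparts_add; first by rewrite (perm_mem pt) mem_head.
    rewrite subnK //; apply/negP => lx.
    have dx : ~~ (h %| x)%N by apply: core_not_dvd lx.
    have := mult_le1 l dx; rewrite (mult_perm _ pl) mult_cons eqxx.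
    move: lx; rewrite mem_mult (mult_perm _ pt) mult_cons.
    have -> : (x == x - h)%N = false by rewrite /hh in hx1 *; lia.
    by lia.
  exists x => //; apply: aux => //.
  rewrite /tseq; case: (eqVneq x h) pt => [xh|xh] pt.
    by apply: perm_trans pl _; rewrite xh perm_cons perm_sym.
    have hx1 : (h < x)%N by rewrite ltn_neqAle eq_sym xh.
    rewrite hx1; apply: perm_trans pl _; rewrite perm_cons perm_sym.
    rewrite -(perm_cons (x - h)%N); apply: (perm_trans _ pt).
    by rewrite perm_sym; apply: perm_to_rem; rewrite (perm_mem pt) mem_head.
wlog xy1 : x y xy pl / (x < y)%N.
  move=> W; case: (ltngtP x y) => c; first exact: (W x y).
    apply: (W y x) => //; first by rewrite addnC.
    by apply: perm_trans pl _; rewrite (perm_catCA [:: x] [:: y] tau).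
  by move: xy; rewrite c /hh; lia.
have x0 : (0 < x)%N.
  by rewrite lt0n; apply/eqP => x0; have := part_neq0 l; rewrite (perm_mem pl) x0 inE.
have yh : (y < h)%N by rewrite -xy; lia.
have yA : y \in newparts tau.
  have N z : z = x \/ z = y -> z \notin parts tau.
    move=> zE; rewrite mem_mult -leqNgt.
    have hz : ~~ (h %| z)%N.
      apply/negP => /dvdn_leq; case: zE => ->; rewrite -xy => H.
        by have := H x0; lia.
      by have := H (ltn_trans x0 xy1); lia.
    have := mult_le1 l hz; rewrite (mult_perm _ pl) !mult_cons.
    by case: zE => ->; rewrite eqxx; lia.
  apply: mem_newparts_pair; first by move: xy xy1; rewrite /hh in yh *; lia.
    by apply: N; right.
  by apply: N; left; lia.
exists y => //; apply: aux => //; rewrite /tseq ltn_eqF // ltnNge (ltnW yh) /=.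
apply: perm_trans pl _; rewrite (_ : (h - y)%N = x) ?(perm_catCA [:: x] [:: y] tau) //; lia.
Qed.

Lemma tY_removal Y : Y \in newparts tau -> bar_removal (tY Y) tau.
Proof.
move=> YA; have p := tY_perm YA; move: p; rewrite /tseq; case: (ltngtP Y h) => hY p.
- right; exists Y, (h - Y)%N; split=> //; lia.
- left; exists Y, (rem (Y - h)%N tau); split=> //; first exact: ltnW.
  by rewrite gtn_eqF //; apply: perm_to_rem; apply: newparts_sub.
- by left; exists h, (parts tau); rewrite leqnn eqxx.
Qed.

Lemma mem_tY_h Y : Y \in newparts tau -> (h \in parts (tY Y)) = (Y == h).
Proof.
move=> YA; rewrite mem_mult; have := mult_tY h YA; have nY := newparts_gt YA.
have : h \notin parts tau by apply/negP => /(core_not_dvd core); rewrite dvdnn.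
move=> H; rewrite (core_mult h core) (negPf H).
have -> : (Y < h)%N && (h == h - Y)%N = false by rewrite /hh; lia.
by rewrite addn0 add0n (eq_sym h); case: (eqVneq Y h) => [->|_]; rewrite ?ltnn /=; lia.
Qed.

Lemma tY_inj Y Y' : Y \in newparts tau -> Y' \in newparts tau -> tY Y = tY Y' -> Y = Y'.
Proof.
move=> YA YA' e; have nY := newparts_gt YA; have nY' := newparts_gt YA'.
have := mult_tY Y' YA; have := mult_tY Y' YA'; rewrite e.
have -> : mult Y' tau = 0%N by rewrite core_mult // (negPf (newparts_notin YA')).
rewrite eqxx; case: (eqVneq Y' Y) => // _.
have -> : (Y < h)%N && (Y' == h - Y)%N = false by rewrite /hh; lia.
have -> : (h < Y')%N && (Y' == Y' - h)%N = false by rewrite /hh; lia.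
by lia.
Qed.

End Core.

Lemma with_core_weight1 tau l : is_bar_core tau -> with_core_weight tau 1 l <-> bar_removal l tau.
Proof.
move=> core; split; first by case=> _ [k [lk <-]].
by move=> lt; split=> //; exists tau.
Qed.

End WeightOne.

(** * Dominance through the number of nodes beyond each column *)

Section Dominance.
Local Open Scope nat_scope.
Implicit Types (s t : seq nat) (r x y z : nat).

(* The number of nodes beyond column z.  It turns dominance into a pointwise
   comparison that does not depend on the order of the parts. *)
Definition excess z s : nat := sumn [seq y - z | y <- s].

Lemma excess_perm z s t : perm_eq s t -> excess z s = excess z t.
Proof. by move=> p; rewrite /excess; apply: perm_sumn; apply: perm_map. Qed.

(** For a partition the sum of the first r parts is the minimum over z of r z + excess z;
    [take_excess] shows that it is attained at the part in row r, rows being numbered from 0. *)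
Lemma take_le_excess r z s : sumn (take r s) <= r * z + excess z s.
Proof.
rewrite /excess; elim: s r => [|y s IH] [|r] //=; have := IH r.
by rewrite mulSn; lia.
Qed.

Lemma take_excess r s : sorted geq s -> sumn (take r s) = r * nth 0 s r + excess (nth 0 s r) s.
Proof.
rewrite /excess; elim: s r => [|y s IH] [|r] /= ss; rewrite ?muln0 //.
  rewrite mul0n subnn !add0n; have := order_path_min geq_trans ss.
  elim: s {IH ss} => //= x s IH /andP[xy a]; rewrite -IH // addn0.
  by apply/esym/eqP; rewrite subn_eq0.
have le : nth 0 s r <= y.
  have [rs|rs] := ltnP r (size s); last by rewrite nth_default.
  by move/(order_path_min geq_trans)/allP: ss; apply; apply: mem_nth.
rewrite (IH r (path_sorted ss)); move: (nth 0 s r) le (sumn _) => z le a.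
by rewrite mulSn; lia.
Qed.

Lemma dominated_excess s t : sorted geq t -> sumn s = sumn t ->
  (forall z, excess z s <= excess z t) -> dominated s t.
Proof.
move=> st e H; split=> // r.
by rewrite (take_excess r st); apply: leq_trans (take_le_excess r (nth 0 t r) s) _; rewrite leq_add2l.
Qed.

(** With H = h: the excess that a new part y adds to the core grows with y. The terms are moved
    across to avoid subtractions that truncate. *)
Lemma excess_mono H z y y' : y < y' -> H < y.*2 ->
  y - z + (if y < H then H - y - z else 0) + (if H < y' then y' - H - z else 0) <=
  y' - z + (if y' < H then H - y' - z else 0) + (if H < y then y - H - z else 0).
Proof.
by case: (ltngtP y H) => c; case: (ltngtP y' H) => c'; lia.
Qed.

Lemma dominated_anti n (l m : hspart n) : dominated l m -> dominated m l -> l = m.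
Proof.
move=> [_ lm] [_ ml]; apply/val_inj/eq_of_nth; try exact: part_neq0.
have e r : sumn (take r l) = sumn (take r m) by apply/eqP; rewrite eqn_leq lm ml.
have st s r : sumn (take r.+1 s) = sumn (take r s) + nth 0 s r.
  by elim: s r => [|y s IH] [|r] //=; rewrite ?take0 ?addn0 // -addnA -IH.
by move=> r; have := e r.+1; rewrite !st e => /addnI.
Qed.

End Dominance.

(** * The ordered enumeration of the block, and which members are restricted *)

Section Enumeration.
Variable n : nat.
Hypothesis n_gt0 : (0 < n)%N.
Local Notation h := (hh n).
Implicit Types (l m tau : hspart n) (i j k r x y z Y : nat).
Variable tau : hspart n.
Hypothesis core : is_bar_core tau.

Lemma excess_tY z Y : Y \in newparts tau ->
  (excess z (tY tau Y) + (if h < Y then Y - h - z else 0) =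
   excess z tau + (Y - z) + (if Y < h then h - Y - z else 0))%N.
Proof.
move=> YA; rewrite (excess_perm _ (tY_perm n_gt0 core YA)) /tseq /excess.
case: (ltngtP Y h) => hY /=.
- by lia.
- have p := perm_to_rem (newparts_sub n_gt0 core YA hY).
  by have := perm_sumn (perm_map (subn^~ z) p) => /=; lia.
- by rewrite hY; lia.
Qed.

Lemma tY_strict Y Y' : Y \in newparts tau -> Y' \in newparts tau -> (Y < Y')%N ->
  strictly_dominated (tY tau Y) (tY tau Y').
Proof.
move=> YA YA' lt; split; last first.
  by move/val_inj/(tY_inj n_gt0 core YA YA') => e; move: lt; rewrite e ltnn.
apply: dominated_excess; first exact: parts_sorted.
  by rewrite (bar_removal_inv (tY_removal n_gt0 core YA)).2 (bar_removal_inv (tY_removal n_gt0 core YA')).2.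
move=> z; have := excess_tY z YA; have := excess_tY z YA'.
have /(excess_mono z lt) : (h < Y.*2)%N by have := newparts_gt n_gt0 YA; rewrite /hh; lia.
set a := (if (h < Y)%N then _ else _); set b := (if (h < Y')%N then _ else _).
set c := (if (Y < h)%N then _ else _); set d := (if (Y' < h)%N then _ else _).
by move: a b c d (Y - z)%N (Y' - z)%N (excess z tau) (excess z _) (excess z _); clear; lia.
Qed.

Definition tt (r : nat) : hspart n := tY tau (nth 0%N (newparts tau) r).

Lemma nth_newparts r : (r <= n)%N -> nth 0%N (newparts tau) r \in newparts tau.
Proof. by move=> rn; apply: mem_nth; rewrite size_newparts. Qed.

Lemma ltn_newparts r s : (r <= n)%N -> (s <= n)%N ->
  (nth 0%N (newparts tau) r < nth 0%N (newparts tau) s)%N = (r < s)%N.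
Proof.
move=> rn sn; have st r' s' : (r' < s' <= n)%N -> (nth 0%N (newparts tau) r' < nth 0%N (newparts tau) s')%N.
  case/andP=> rs sn'; have H := sorted_ltn_nth ltn_trans 0%N (newparts_sorted n_gt0 tau).
  by apply: (H r' s'); rewrite // inE size_newparts; lia.
case: (ltngtP r s) => [c|c|->]; last by rewrite ltnn.
  by apply: st; rewrite c.
by apply/negbTE; rewrite -leqNgt ltnW // st // c.
Qed.

Lemma tt_inj r s : (r <= n)%N -> (s <= n)%N -> tt r = tt s -> r = s.
Proof.
move=> rn sn /(tY_inj n_gt0 core (nth_newparts rn) (nth_newparts sn)) e.
have := ltn_newparts rn sn; have := ltn_newparts sn rn; rewrite e ltnn.
by case: ltngtP.
Qed.

Lemma block1_tt l : bar_removal l tau -> exists2 r, (r <= n)%N & l = tt r.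
Proof.
case/(newparts_of_removal n_gt0 core) => Y YA ->.
exists (index Y (newparts tau)); last by rewrite /tt nth_index.
by rewrite -ltnS -(size_newparts tau) index_mem.
Qed.

Lemma tt_block1 r : (r <= n)%N -> bar_removal (tt r) tau.
Proof. by move=> rn; apply: tY_removal => //; apply: nth_newparts. Qed.

Lemma tt_weight1 : weight1_enum tau (fun r : 'I_n.+1 => tt r).
Proof.
split=> [l|r s rs].
  rewrite with_core_weight1 //; split=> [/block1_tt[r rn ->]|[r ->]].
    by exists (Ordinal (rn : (r < n.+1)%N)).
  by apply: tt_block1; rewrite -ltnS.
have rn : (r <= n)%N by rewrite -ltnS.
have sn : (s <= n)%N by rewrite -ltnS.
by apply: tY_strict; rewrite ?nth_newparts ?ltn_newparts.
Qed.

Lemma increasing_id (f : 'I_n.+1 -> 'I_n.+1) :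
  (forall r s : 'I_n.+1, (r < s)%N -> (f r < f s)%N) -> forall r : 'I_n.+1, f r = r.
Proof.
move=> H.
have up (r : 'I_n.+1) : (r <= f r)%N.
  case: r => [r rn]; elim: r rn => [|r IH] rn //.
  by apply: leq_ltn_trans (IH (ltnW rn)) _; apply: H.
have dn k (r : 'I_n.+1) : (r + k = n)%N -> (f r + k <= n)%N.
  elim: k r => [|k IH] r e; first by rewrite addn0 -ltnS.
  have rn : (r.+1 < n.+1)%N by move: (nat_of_ord r) e => r0; clear; lia.
  have /= := IH (Ordinal rn); rewrite addSnnS => /(_ e).
  by apply: leq_trans; rewrite -addSnnS leq_add2r; apply: H.
move=> r; apply/val_inj/eqP => /=; rewrite eqn_leq up andbT.
have rn : (r <= n)%N by rewrite -ltnS.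
have := dn (n - r)%N r (subnKC rn); move: rn; move: (nat_of_ord r) (nat_of_ord (f r)); clear; lia.
Qed.

(** Comparing two enumerations gives a self-map of the indices; it is increasing by antisymmetry of
    dominance, hence the identity. *)
Lemma weight1_enum_tt (t : 'I_n.+1 -> hspart n) : weight1_enum tau t -> forall r : 'I_n.+1, t r = tt r.
Proof.
case=> tP tS; have [uP uS] := tt_weight1.
have ex (r : 'I_n.+1) : exists s : 'I_n.+1, t r = tt s.
  by apply/uP/tP; exists r.
have [f fE] := choice ex; suff fid : forall r : 'I_n.+1, f r = r by move=> r; rewrite fE fid.
apply: increasing_id => r s rs; rewrite ltnNge leq_eqVlt; apply/negP => /orP[/eqP e|lt].
  by case: (tS r s rs) => _; rewrite !fE (val_inj e).
have [d1 ne] := tS r s rs; have [d2 _] := uS _ _ lt; rewrite -!fE in d2.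
by apply: ne; congr parts; apply: dominated_anti.
Qed.

(** If Y < h, then h is a larger new part. Otherwise restrictedness gives a part y right after Y
    with Y < y + h; it belongs to the core, and the first gap in its residue class lies beyond Y. *)
Lemma not_restricted_max Y : Y \in newparts tau -> restricted (tY tau Y) ->
  exists2 Y', Y' \in newparts tau & (Y < Y')%N.
Proof.
move=> YA Hr; have [hY|hY] := ltnP Y h; first by exists h; rewrite ?h_newparts.
pose l := tY tau Y; have lY : Y \in parts l.
  rewrite mem_mult; have := mult_tY n_gt0 core Y YA; rewrite eqxx.
  have -> : (Y == Y - h)%N = false by rewrite /hh in hY *; lia.
  by rewrite andbF addn0 -/l => ->; rewrite addn1 addSn.
have := Hr (index Y l); rewrite nth_index //; set y := nth 0%N l _ => Hy.
have m0 : mult (Y - h) l = 0%N.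
  have := hY; rewrite leq_eqVlt => /orP[/eqP e|hY1]; first by rewrite -[X in (X - h)%N]e subnn mult0.
  have := mult_tY n_gt0 core (Y - h)%N YA; rewrite hY1 [(Y < h)%N]ltnNge hY.
  rewrite (core_mult _ core) (newparts_sub n_gt0 core YA hY1).
  rewrite eqxx /= addn0; have -> : (Y - h == Y)%N = false by rewrite /hh in hY *; lia.
  by rewrite addn0 addn1; case.
have my : mult Y l = 1%N.
  have := mult_tY n_gt0 core Y YA; rewrite eqxx (core_mult Y core) (negPf (newparts_notin n_gt0 core YA)).
  have -> : (Y == Y - h)%N = false by rewrite /hh in hY *; lia.
  by rewrite andbF addn0 ltnNge hY.
have yY : (y < Y)%N.
  have iy : (index Y l < size l)%N by rewrite index_mem.
  have [si|si] := ltnP (index Y l).+1 (size l); last first.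
    by rewrite /y nth_default // (leq_trans _ hY).
  have le : (y <= Y)%N.
    rewrite -[X in (_ <= X)%N](nth_index 0%N lY).
    have ge_refl : reflexive geq by move=> ?; rewrite /geq /=.
    exact: (sorted_leq_nth geq_trans ge_refl 0%N (parts_sorted l)) (leqnSn _).
  rewrite ltn_neqAle le andbT; apply/eqP => e.
  have : (1 < mult Y l)%N.
    rewrite /mult -(cat_take_drop (index Y l) l) count_cat (drop_nth 0%N) // (drop_nth 0%N) //=.
    by rewrite nth_index // -/y e eqxx; lia.
  by rewrite my.
have ly : y \in parts l.
  have [si|si] := ltnP (index Y l).+1 (size l); first exact: mem_nth.
  move: Hy; rewrite /y nth_default // add0n => -[Yh|[Yh]]; first by move: hY; rewrite leqNgt Yh.
  by rewrite Yh dvdnn.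
have hyY : (Y < y + h)%N.
  case: Hy => // -[e _]; move: ly; rewrite mem_mult; suff -> : y = (Y - h)%N by rewrite m0.
  by rewrite e addnK.
have ty : y \in parts tau.
  have := mult_tY n_gt0 core y YA; rewrite (ltn_eqF yY) (ltnNge Y h) hY /= !addn0.
  rewrite -[in X in X -> _]/l; move: ly; rewrite !mem_mult => ly.
  by move=> <-; rewrite addn_gt0 ly.
pose Y' := (y %% h + `|ch tau y| * h)%N.
have cy : (y %/ h)%N%:Z < ch tau y by rewrite -(coreP n_gt0).
have rh : (y %% h < h)%N by rewrite ltn_mod.
have [dE mE] := divmod_small `|ch tau y| rh.
have c0 : 0 <= ch tau y by apply: le_trans (ltW cy).
have lt : (y %/ h < `|ch tau y|)%N by rewrite -ltz_nat gez0_abs.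
have yY' : (y + h <= Y')%N.
  by rewrite {1}(divn_eq y h) /Y' addnC addnA [(h + _)%N]addnC -mulSnr addnC leq_add2l leq_mul2r lt orbT.
exists Y'; last by apply: leq_trans yY'.
rewrite mem_newparts //; apply/andP; split.
  by apply: leq_trans yY'; rewrite /hh -addnn; clear; lia.
apply/orP; right; rewrite dE gez0_abs //; apply/eqP/ch_mod; by rewrite mE.
Qed.

(** Every part y >= h needs a smaller part close enough to it. For y <> Y the part y - h serves; for
    y = Y the residue class of the larger new part Y' provides one. *)
Lemma restricted_nonmax Y Y' : Y \in newparts tau -> Y' \in newparts tau -> (Y < Y')%N ->
  restricted (tY tau Y).
Proof.
move=> YA YA' lt; set l := tY tau Y.
have nY := newparts_gt n_gt0 YA.
have keep y : y \in parts tau -> (y != Y - h)%N -> y \in parts l.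
  move=> ty ne; rewrite mem_mult; have := mult_tY n_gt0 core y YA.
  by rewrite (negPf ne) andbF addn0 => ->; move: ty; rewrite mem_mult; lia.
have key y : y \in parts l -> (h <= y)%N -> exists2 y', y' \in parts l &
   (y' < y)%N /\ ((y < y' + h)%N \/ (y = y' + h /\ ~~ (h %| y))%N).
  move=> ly hy; case: (eqVneq y Y) => [yY|yY]; last first.
    have ty : y \in parts tau.
      rewrite mem_mult; have := mult_tY n_gt0 core y YA; rewrite (negPf yY).
      have -> : (Y < h)%N && (y == h - Y)%N = false by rewrite /hh in hy *; lia.
      by move: ly; rewrite mem_mult -/l; lia.
    have hy' : (h < y)%N.
      by rewrite ltn_neqAle hy andbT; apply: contraNneq (core_not_dvd core ty) => <-.
    exists (y - h)%N; first by apply: keep; [exact: core_sub|move: hy' yY; clear; move: h => H; lia].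
    split; first by rewrite ltn_subrL (leq_ltn_trans _ hy').
    by right; split; [rewrite subnK|exact: core_not_dvd ty].
  have hYY : (h <= Y)%N by rewrite -yY.
  have hY' : (h < Y')%N by apply: leq_ltn_trans lt.
  have tY' := newparts_sub n_gt0 core YA' hY'.
  (* With this j, the number Y' - (j + 1) h is the element of the class of Y' that is at most Y and
     larger than Y - h. *)
  pose j := ((Y' - Y).-1 %/ h)%N.
  have j1 : (j * h <= (Y' - Y).-1)%N by apply: leq_trunc_div.
  have j2 : ((Y' - Y).-1 < j.+1 * h)%N by apply: ltn_ceil.
  pose y' := (Y' - j.+1 * h)%N.
  have jE : (j.+1 * h = j * h + h)%N by rewrite mulSnr.
  have y'Y' : (y' + j.+1 * h = Y')%N.
    by rewrite subnK // jE; move: (j * h)%N j1 lt hYY => a; clear; lia.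
  have y'0 : (0 < y')%N.
    by rewrite /y' jE; move: (j * h)%N j1 lt hYY nY => a; clear; lia.
  have y'Y : (y' <= Y)%N.
    by rewrite /y'; move: (j.+1 * h)%N j2 lt => a; clear; lia.
  have Yy' : (Y < y' + h)%N.
    by rewrite /y' jE; move: (j * h)%N j1 lt hYY => a; clear; lia.
  have ty' : y' \in parts tau.
    apply: (core_down core tY').
      by rewrite y'0 -y'Y' jE addnA addnK leq_addr.
    by rewrite -y'Y' jE addnA addnK addnC modnMDl.
  have ne : y' != Y by apply: contraTneq ty' => ->; apply: newparts_notin.
  exists y'; first by apply: keep => //; move: Yy' hYY; clear; lia.
  by rewrite yY; split; [rewrite ltn_neqAle ne|left].
move=> r; have [yh|hy] := ltnP (nth 0%N l r) h; first by left; apply: leq_trans yh (leq_addl _ _).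
have rs : (r < size l)%N by rewrite ltnNge; apply/negP => s; move: hy; rewrite nth_default.
have [y' ly' [y'y d]] := key _ (mem_nth 0%N rs) hy.
have le : (y' <= nth 0%N l r.+1)%N.
  rewrite -(nth_index 0%N ly').
  have ge_refl : reflexive geq by move=> ?; rewrite /geq /=.
  have H := sorted_leq_nth geq_trans ge_refl 0%N (parts_sorted l).
  have iy : (index y' l < size l)%N by rewrite index_mem.
  have ri : (r < index y' l)%N.
    rewrite ltnNge; apply/negP => ir; have := H _ _ iy rs ir.
    by rewrite nth_index // /geq /= leqNgt y'y.
  by apply: H => //; rewrite inE; apply: leq_ltn_trans iy.
case: d => [d|[d nd]]; first by left; apply: leq_trans d _; rewrite leq_add2r.
move: le; rewrite leq_eqVlt => /orP[/eqP <-|lt']; first by right.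
by left; rewrite d ltn_add2r.
Qed.

Lemma restricted_tt r : (r <= n)%N -> restricted (tt r) <-> (r < n)%N.
Proof.
move=> rn; split=> [/(not_restricted_max (nth_newparts rn))[Y' YA']|rn'].
  rewrite -(nth_index 0%N YA'); have : (index Y' (newparts tau) <= n)%N.
    by rewrite -ltnS -(size_newparts tau) index_mem.
  by move=> i; rewrite ltn_newparts // => /leq_trans; apply.
by apply: (restricted_nonmax (nth_newparts rn) (nth_newparts (leqnn n))); rewrite ltn_newparts.
Qed.

End Enumeration.

(** * Adding several nodes of the same residue *)

Section Reach.
Variable n : nat.
Hypothesis n_gt0 : (0 < n)%N.
Local Notation h := (hh n).
Implicit Types (l m tau : hspart n) (i j a r x y z : nat).

Fixpoint reach i a l m : Prop :=
  if a is a'.+1 then exists x, [/\ ed n i x, upok x l & reach i a' (up x l) m] else l = m.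

Lemma reach_sumn i a l m : reach i a l m -> sumn m = (sumn l + a)%N.
Proof.
elim: a l => [|a IH] l /=; first by move=> ->; rewrite addn0.
by case=> x [_ ux /IH ->]; rewrite sumn_up // addSnnS.
Qed.

Lemma reach_sum (V : zmodType) (g : nat -> V) i a l m : g 0%N = 0 ->
  (forall x, ed n i x -> g x.+1 = g x) -> reach i a l m ->
  \sum_(y <- parts l) g y = \sum_(y <- parts m) g y.
Proof.
move=> g0 gE; elim: a l => [|a IH] l /=; first by move=> ->.
by case=> x [ex ux /IH <-]; rewrite sum_up // gE // subrK.
Qed.

Lemma reach_wt i a l m : (i <= n)%N -> reach i a l m -> wt i m = wt i l - 2 * a%:Z * (dd n i)%:Z.
Proof.
move=> ni; elim: a l => [|a IH] l /=; first by move=> ->; rewrite mulr0 mul0r subr0.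
case=> x [ex ux /IH ->]; rewrite (wt_up n_gt0 ni ni ex ux) (AA_diag n_gt0 ni) PoszM -[a.+1]addn1 PoszD.
by ring.
Qed.

Lemma reach_ch i a l m : (i <= n)%N -> reach i a l m -> forall k, ch m k = ch l k - a%:Z * alpha n i k.
Proof.
move=> ni; elim: a l => [|a IH] l /= H k; first by rewrite H mul0r subr0.
case: H => x [ex ux /IH ->]; rewrite (ch_up n_gt0 k ni ex ux) -[a.+1]addn1 PoszD.
by ring.
Qed.

Lemma reach_DD i a l m : (i <= n)%N -> reach i a l m ->
  DD m = DD l + 2 * h%:Z * (a%:Z * wt i l - a%:Z * a%:Z * (dd n i)%:Z).
Proof.
move=> ni; elim: a l => [|a IH] l /=; first by move=> ->; rewrite !mul0r subr0 mulr0 addr0.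
case=> x [ex ux /IH ->]; rewrite (DD_up n_gt0 ni ex ux) (wt_up n_gt0 ni ni ex ux) (AA_diag n_gt0 ni).
by rewrite PoszM -[a.+1]addn1 PoszD; ring.
Qed.

End Reach.

(** * Supports of images and the vanishing criterion *)

Section Supports.
Variables (n : nat) (F : fieldType) (v : F).
Hypotheses (n_gt0 : (0 < n)%N).
Local Notation h := (hh n).
Implicit Types (l m tau : hspart n) (i j a r x y z : nat) (u : hspart n -> F).

Lemma iter_eop_supp i a u l : iter a (eop v i) u l != 0 -> exists2 m, reach i a l m & u m != 0.
Proof.
elim: a l => [|a IH] l /=; first by exists l.
by case/eop_supp => x [ex ux /IH[m rm um]]; exists m => //; exists x.
Qed.

Lemma iter_fop_supp i a u m : iter a (fop v i) u m != 0 -> exists2 l, reach i a l m & u l != 0.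
Proof.
elim: a u => [|a IH] u; first by exists m.
rewrite iterSr => /IH[l rl /fop_supp[x [ex dx ul]]]; exists (dn x l) => //=.
by exists x; rewrite upok_dn // dnK.
Qed.

Lemma delta_neq0 l m : delta F l m != 0 -> m = l.
Proof. by rewrite /delta; case: (eqVneq m l) => // _; rewrite eqxx. Qed.

(** The hypothesis gives every possible target a negative value of [DD], and no partition has
    one. *)
Lemma fop_eq0 i u : (i <= n)%N ->
  (forall l, u l != 0 -> DD l + 2 * h%:Z * (wt i l - (dd n i)%:Z) < 0) -> fop v i u = (fun=> 0).
Proof.
move=> ni H; apply/funext => m; apply/eqP/contraT => /fop_supp[x [ex dx /H]].
by rewrite -(DD_up n_gt0 ni ex (upok_dn dx)) ltNge DD_ge0.
Qed.

Lemma normc_core N tau : is_bar_core tau -> normc v N tau = 1.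
Proof.
move=> core; rewrite /normc big1 // => y hy; rewrite core_mult //.
have -> : (y.+1 \in parts tau) = false by apply: contraTF hy => /(core_not_dvd core).
by rewrite big_ord0.
Qed.

End Supports.

(** The weight is always a multiple of d_i; for i = n this uses that the charges of n and n + 1 are
    opposite, so that the weight is 4 [ch l n]. *)
Lemma dd_dvd_wt n i l : (0 < n)%N -> (i <= n)%N -> wt i l <= - (@dd n i)%:Z ->
  exists2 a, (0 < a)%N & wt i (l : hspart n) = - (a%:Z * (dd n i)%:Z).
Proof.
move=> n0 ni; rewrite wt_ch /dd; case: (eqVneq i 0%N) => [->|i0] /=.
  move: (_ - _ : int) => c H; exists (absz (1 + 2 * c)%R); lia.
case: (eqVneq i n) => [-> |ne] /=.
  have -> : ch l n.+1 = - ch l n by apply: ch_opp; rewrite /hh addSn addnn.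
  by move: (ch l n) => c H; exists `|c|%N; lia.
by move: (_ - _ : int) => c H; exists `|c|%N; lia.
Qed.

(** * Cores: reflections, and bar-invariance of their basis vectors *)

Section LevelZero.
Variables (R : realType) (n : nat).
Hypothesis n_gt0 : (0 < n)%N.
Local Notation h := (hh n).
Local Notation Cq := {fraction {poly R[i]}}.
Implicit Types (l m tau : hspart n) (i j a r x y z : nat) (u : hspart n -> Cq).

Local Notation qq := (q : Cq).
Local Notation f := (fop qq).
Local Notation e := (eop qq).
Let v0 := q_neq0 R.
Let vr := @q_root R.

Lemma reflect_delta i a l m : (i <= n)%N -> wt i l = a%:Z * (dd n i)%:Z ->
    wt i m = - (a%:Z * (dd n i)%:Z) -> (forall N, normc qq N l = normc qq N m) ->
    f i (delta Cq m) = (fun=> 0) ->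
    (forall k : hspart n, reach i a l k -> k = m) ->
    (forall k : hspart n, reach i a k m -> k = l) ->
  iter a (f i) (delta Cq l) = (fun k : hspart n => qfact n qq i a * delta Cq m k).
Proof.
move=> ni wl wm nlm fm lk km.
apply: (reflect_coef n_gt0 v0 vr (pos := @posq R)) => //.
- exact: posqD.
- exact: posqM.
- exact: posq1.
- exact: posqV.
- exact: posq_q.
- by move=> k; apply: posq_1B.
- by move=> k; apply: posq_1D.
- exact: posqN.
- move=> k kneq; apply/eqP; apply: contraNT kneq => /iter_fop_supp[l' rl /delta_neq0 le].
  by apply/eqP/lk; rewrite -le.
- move=> k kneq; apply/eqP; apply: contraNT kneq => /iter_eop_supp[m' rm /delta_neq0 me].
  by apply/eqP/km; rewrite -me.
Qed.

Section Step.
Variables (tau : hspart n) (i a : nat).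
Hypotheses (core : is_bar_core tau) (ni : (i <= n)%N) (a0 : (0 < a)%N).
Hypothesis wtau : wt i tau = - (a%:Z * (dd n i)%:Z).

Lemma core_step_wt l : reach i a l tau -> wt i l = a%:Z * (dd n i)%:Z.
Proof. by move/(reach_wt n_gt0 ni); rewrite wtau => /eqP; rewrite eq_sym subr_eq => /eqP ->; ring. Qed.

Lemma core_step_core l : reach i a l tau -> is_bar_core l.
Proof.
move=> rl; apply: DD0_core => //; have := reach_DD n_gt0 ni rl.
rewrite (core_step_wt rl) (DD_core n_gt0 core).
have -> : (a%:Z * (a%:Z * (dd n i)%:Z) - a%:Z * a%:Z * (dd n i)%:Z) = 0 by ring.
by rewrite mulr0 addr0.
Qed.

Lemma core_step_uniq l m : reach i a l tau -> reach i a m tau -> l = m.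
Proof.
move=> rl rm; apply: core_ext (core_step_core rl) (core_step_core rm) _ => // k.
have := reach_ch n_gt0 ni rl k; rewrite (reach_ch n_gt0 ni rm k) => /addIr; exact/esym.
Qed.

Lemma dd_gt0 : 0 < (dd n i)%:Z.
Proof. by have [d ->] := dd_pos n i. Qed.

Lemma core_killed : f i (delta Cq tau) = (fun=> 0).
Proof.
apply: fop_eq0 => // l /delta_neq0 ->; rewrite DD_core // add0r wtau.
by rewrite pmulr_rlt0 // -opprD oppr_lt0 addr_gt0 ?dd_gt0 // mulr_gt0 ?dd_gt0.
Qed.

(** A predecessor exists because f_i^a e_i^a acts on the basis vector of tau by a nonzero scalar. It
    is a core because reflecting the weight preserves [DD], and it is unique because its charges are
    determined. *)
Lemma core_step : exists tau', [/\ is_bar_core tau', reach i a tau' tau &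
   iter a (f i) (delta Cq tau') = (fun k : hspart n => qfact n qq i a * delta Cq tau k)].
Proof.
have [tau' rt] : exists tau', reach i a tau' tau.
  apply: contrapT => nr.
  have E0 : iter a (e i) (delta Cq tau) = (fun=> 0).
    apply/funext => l; apply/eqP/contraT => /iter_eop_supp[m rm /delta_neq0 me].
    by case: nr; exists l; rewrite -me.
  have := @string_id _ _ qq n_gt0 v0 vr i a (delta Cq tau) ni _ core_killed.
  rewrite E0 stringcE => H; have := H _ => /(_ _)/(congr1 (fun g => g tau)) /=.
  have -> : iter a (f i) (fun=> 0) tau = 0.
    by apply/eqP/contraT => /iter_fop_supp[l _]; rewrite eqxx.
  rewrite {2}/delta eqxx mulr1 => /(_ _)/esym/eqP; rewrite expf_eq0 /= => H0.
  suff : qfact n qq i a == 0 by rewrite (negPf (qfact_neq0 n v0 vr i a)).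
  by apply: H0 => l /delta_neq0 ->.
exists tau'; split=> //; first exact: core_step_core rt.
apply: reflect_delta => //; first exact: core_step_wt.
- by move=> N; rewrite !normc_core //; exact: core_step_core rt.
- exact: core_killed.
- move=> k rk; have rc := core_step_core rt.
  apply: core_ext => //; last by move=> y; rewrite (reach_ch n_gt0 ni rk) (reach_ch n_gt0 ni rt).
  apply: DD0_core => //; rewrite (reach_DD n_gt0 ni rk) -(reach_DD n_gt0 ni rt); exact: DD_core.
- by move=> k rk; apply: core_step_uniq.
Qed.

End Step.

(** A vector supported on one block: charges and size together fix the weights and the number of
    bars. *)
Definition homog u := exists (c : nat -> int) (N : nat),
  forall l, u l != 0 -> (forall k, ch l k = c k) /\ sumn l = N.

Lemma fword_homog w : homog (@fword R n w).
Proof.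
elim: w => [|j w [c [N H]]].
  exists (ch (empty_hspart n)), (sumn (empty_hspart n)) => l.
  by rewrite /= => /delta_neq0 ->.
exists (fun k => c k - alpha n j k), N.+1 => l /fop_supp[x [ex dx /H[cE sE]]].
have nj : (j <= n)%N by rewrite -ltnS.
split=> [k|]; first by rewrite -cE (ch_dn n_gt0 _ nj ex dx) addrK.
by rewrite -sE -(sumn_up (upok_dn dx)) dnK.
Qed.

Lemma homog_block u l m : homog u -> u l != 0 -> u m != 0 ->
  [/\ forall k, ch l k = ch m k, forall i, wt i l = wt i m & DD l = DD m].
Proof.
case=> c [N H] /H[cl sl] /H[cm sm]; have E k : ch l k = ch m k by rewrite cl cm.
split=> // [i|]; first by rewrite !wt_ch !E.
by rewrite /DD sl sm; congr (_ - _); apply: eq_bigr => k _; rewrite E.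
Qed.

(** Bar-invariant vectors are combinations of words, so only the empty word and homogeneous vectors
    of the form f_i u need attention. *)
Lemma barinv_ind (P : (hspart n -> Cq) -> Prop) :
  P (fun=> 0) -> (forall u1 u2, P u1 -> P u2 -> P (fun l => u1 l + u2 l)) ->
  (forall c u, in_Cqsym c -> P u -> P (fun l => c * u l)) ->
  P (delta Cq (empty_hspart n)) ->
  (forall i u, (i <= n)%N -> barinv u -> homog (f i u) -> P (f i u)) ->
  forall u, barinv u -> P u.
Proof.
move=> P0 PD PZ Pd Pf u [s [sK ->]]; elim: s sK => [|cw s IH] sK.
  have -> : (fun l => \sum_(cw <- [::] : seq (Cq * seq 'I_n.+1)) cw.1 * @fword R n cw.2 l) = (fun=> 0).
    by apply/funext => l; rewrite big_nil.
  exact: P0.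
have -> : (fun l => \sum_(cw <- cw :: s) cw.1 * @fword R n cw.2 l) =
   (fun l => cw.1 * @fword R n cw.2 l + \sum_(cw <- s) cw.1 * @fword R n cw.2 l).
  by apply/funext => l; rewrite big_cons.
apply: PD; last by apply: IH => c cs; apply: sK; rewrite inE cs orbT.
apply: PZ; first by apply: sK; rewrite mem_head.
case: cw.2 => [|j w] //; apply: Pf; first by rewrite -ltnS.
  exact: barinv_fword.
exact: (fword_homog (j :: w)).
Qed.

Lemma inK_qfact i a : in_Cqsym (qfact n qq i a).
Proof. by apply: inK_prod => j _; apply: inK_qint. Qed.

(** A homogeneous f_i u with tau in its support is a multiple of the basis vector of tau and is
    killed by f_i. It is therefore recovered from its image under e_i^a, which is bar-invariant and
    lives on a smaller core; the coefficient only gets divided by [a]!. *)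
Lemma barinv_core tau u : is_bar_core tau -> barinv u -> in_Cqsym (u tau).
Proof.
have [N] := ubnP (sumn tau); elim: N tau u => // N IH tau u tN core; move: u.
apply: barinv_ind; [exact: inK0|by move=> *; apply: inKD|by move=> *; apply: inKM| |].
  by rewrite /delta; case: eqP => _; [apply: inK1|apply: inK0].
move=> i u ni Bu Hu.
have [ut0|ut0] := eqVneq (f i u tau) 0; first by rewrite ut0; apply: inK0.
have [x [ex dx _]] := fop_supp ut0.
(* Removing the i-node x from the core gives [DD] = -2h(wt + d_i), which is nonnegative, so the
   weight is at most -d_i. *)
have [a a0 wtau] : exists2 a, (0 < a)%N & wt i tau = - (a%:Z * (dd n i)%:Z).
  apply: dd_dvd_wt => //; have := DD_ge0 n_gt0 (dn x tau).
  rewrite (DD_dn n_gt0 ni ex dx) DD_core // sub0r oppr_ge0 pmulr_rle0 //.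
  by rewrite -lerBrDr sub0r.
have [tau' [core' rt fE]] := core_step core ni a0 wtau.
have uB l : f i u l != 0 -> [/\ forall k, ch l k = ch tau k, forall i, wt i l = wt i tau & DD l = DD tau].
  by move=> ul; apply: homog_block Hu ul ut0.
have fu0 : f i (f i u) = (fun=> 0).
  apply: fop_eq0 => // l /uB[_ -> ->]; rewrite DD_core // add0r wtau.
  by rewrite pmulr_rlt0 // -opprD oppr_lt0 addr_gt0 ?dd_gt0 // mulr_gt0 ?dd_gt0.
have wu l : f i u l != 0 -> wt i l = - (a%:Z * (dd n i)%:Z) by move=> /uB[_ ->].
have := string_id n_gt0 v0 vr ni wu fu0.
set X := iter a (e i) (f i u) tau'.
have -> : iter a (e i) (f i u) = (fun k : hspart n => X * delta Cq tau' k).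
  apply/funext => k; rewrite /delta; case: (eqVneq k tau') => [->|kt]; first by rewrite mulr1.
  rewrite mulr0; apply/eqP; apply: contraNT kt => /iter_eop_supp[m rm /uB[cm _ Dm]].
  apply/eqP; apply: (core_step_uniq core ni wtau) => //; move: rm.
  have -> : m = tau; last by [].
  by apply: core_ext => //; apply: DD0_core => //; rewrite Dm DD_core.
move/(congr1 (fun g => g tau)); rewrite iter_fopZ fE stringcE /delta eqxx mulr1 /= => H.
have b0 := qfact_neq0 n v0 vr i a.
have -> : f i u tau = X / qfact n qq i a.
  by apply: (mulfI (expf_neq0 2 b0)); rewrite -H expr2 mulrACA divff // mulr1 mulrC.
apply: inKM; last exact/inKV/inK_qfact.
apply: IH => //; last by apply: barinv_iter_eop => //; apply: barinv_fop.
by move: tN; rewrite (reach_sumn rt) ltnS; apply: leq_trans; rewrite -addn1 leq_add2l.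
Qed.

(** The smallest part can always be lowered by 1, and removing a node from a core forces the weight
    of its residue to be negative. *)
Lemma core_neg tau : is_bar_core tau -> tau <> empty_hspart n ->
  exists i a, [/\ (i <= n)%N, (0 < a)%N & wt i tau = - (a%:Z * (dd n i)%:Z)].
Proof.
move=> core ne.
have exy : exists y, y \in parts tau.
  case E : (parts tau) => [|y s]; last by exists y; rewrite mem_head.
  by case: ne; apply: val_inj.
have [y ly ymin] := ex_minnP exy.
case: y ly ymin => [|x] ly ymin; first by have := part_neq0 tau; rewrite ly.
have dx : dnok x tau.
  rewrite /dnok ly /=; apply/orP; left; apply/negP => /ymin; by rewrite ltnn.
pose i := residue n x.+1.
have ni : (i <= n)%N.
  rewrite /i /residue /=; have := ltn_mod x h; have := ltn_mod x.+1 h; rewrite !ltn0Sn modhS //.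
  case: (eqVneq (x %% h).+1 h) => _ *; rewrite ?subn0 ?modnn ?minn0 //.
  by move: (x %% h)%N => r; rewrite [((h - _) %% h)%N]modn_small ?ltn_subrL // /hh; lia.
have ex : ed n i x by rewrite /ed.
exists i; have [a a0 wa] : exists2 a, (0 < a)%N & wt i tau = - (a%:Z * (dd n i)%:Z).
  apply: dd_dvd_wt => //; have := DD_ge0 n_gt0 (dn x tau).
  rewrite (DD_dn n_gt0 ni ex dx) DD_core // sub0r oppr_ge0 pmulr_rle0 //.
  by rewrite -lerBrDr sub0r.
by exists a.
Qed.

Lemma barinv_delta_core tau : is_bar_core tau -> barinv (delta Cq tau).
Proof.
have [N] := ubnP (sumn tau); elim: N tau => // N IH tau tN core.
have [->|/eqP ne] := eqVneq tau (empty_hspart n); first exact: barinv_delta0.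
have [i [a [ni a0 wtau]]] := core_neg core ne.
have [tau' [core' rt fE]] := core_step core ni a0 wtau.
have b0 := qfact_neq0 n v0 vr i a.
have -> : delta Cq tau = (fun k => (qfact n qq i a)^-1 * iter a (f i) (delta Cq tau') k).
  by apply/funext => k; rewrite fE mulKf.
apply: barinvZ; first exact/inKV/inK_qfact.
apply: barinv_iter_fop => //; apply: IH => //.
by move: tN; rewrite (reach_sumn rt) ltnS; apply: leq_trans; rewrite -addn1 leq_add2l.
Qed.

End LevelZero.

(** * Classes of parts joined by moves of one residue *)

Section EdgeClasses.
Variable n : nat.
Hypothesis n_gt0 : (0 < n)%N.
Local Notation h := (hh n).
Implicit Types (l m tau : hspart n) (i j a r s x y z Y Z C : nat).

(* Parts joined by moves of residue i are in the same class; the classes are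
   intervals, numbered in increasing order, 0 being in class 0. *)
Definition cls i y : nat := (\sum_(0 <= x < y) ~~ ed n i x)%N.

Lemma clsS i y : cls i y.+1 = (cls i y + ~~ ed n i y)%N.
Proof. by rewrite /cls big_nat_recr. Qed.

Lemma cls_ed i x : ed n i x -> cls i x.+1 = cls i x.
Proof. by rewrite clsS => ->; rewrite addn0. Qed.

Lemma cls0 i : cls i 0 = 0%N.
Proof. by rewrite /cls big_geq. Qed.

Lemma leq_cls i y z : (y <= z)%N -> (cls i y <= cls i z)%N.
Proof.
elim: z => [|z IH]; first by rewrite leqn0 => /eqP ->.
rewrite leq_eqVlt => /orP[/eqP -> //|]; rewrite ltnS clsS => /IH le.
exact: leq_trans le (leq_addr _ _).
Qed.

Lemma cls_eq_ed i y z x : cls i y = cls i z -> (y <= x < z)%N -> ed n i x.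
Proof.
move=> e /andP[yx xz]; apply: contraT => nx.
have := leq_cls i xz; rewrite clsS nx addn1 -e => le.
by have := leq_cls i yx; rewrite leqNgt le.
Qed.

Lemma ed0_after y : (h %| y)%N -> ~~ ed n 0 y.+1.
Proof.
by move=> hy; rewrite ed0E // negb_or -(addn2 y) -(addn1 y) !dvdn_addr // !gtnNdvd // /hh; lia.
Qed.

Lemma ed_gap i x : (i <= n)%N -> exists2 y, (x <= y < x + h)%N & ~~ ed n i y.
Proof.
move=> ni; have h3 : (3 <= h)%N by rewrite /hh; lia.
have [i0|i0] := posnP i; last first.
  have [ex|ex] := boolP (ed n i x); last by exists x; rewrite // leqnn -addn1 leq_add2l.
  exists x.+1; last by rewrite edS_disj // i0.
  by rewrite leqnSn -addn2 leq_add2l ltnW.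
rewrite i0; have [hx|hx] := boolP (h %| x.+1)%N.
  exists x.+2; last exact: ed0_after.
  by move: h h3 => H; clear; lia.
have [hx0|hx0] := boolP (h %| x)%N; last first.
  exists x; last by rewrite ed0E // negb_or hx0.
  by rewrite leqnn -addn1 leq_add2l.
exists x.+1; last exact: ed0_after.
by rewrite leqnSn -addn2 leq_add2l ltnW.
Qed.

Lemma cls_sub i Y : (i <= n)%N -> (h <= Y)%N -> (cls i (Y - h) < cls i Y)%N.
Proof.
move=> ni hY; have [y /andP[y1 y2] ne] := ed_gap (Y - h) ni.
rewrite subnK // in y2; have := leq_cls i y2; rewrite clsS ne addn1.
exact/leq_ltn_trans/leq_cls.
Qed.

Lemma cls_gt0 i Y : (i <= n)%N -> (n < Y)%N -> (0 < cls i Y)%N.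
Proof.
move=> ni nY; have [i0|i0] := posnP i.
  have Y2 : (2 <= Y)%N by apply: leq_ltn_trans nY.
  apply: leq_trans (leq_cls i Y2); rewrite i0 !clsS [ed n 0 1]ed0E //.
  by rewrite !gtnNdvd // /hh; lia.
apply: leq_trans (leq_cls i (leq_ltn_trans (leq0n n) nY)); rewrite clsS cls0 edE // mod0n.
have -> : (0 == i)%N = false by lia.
by have -> : (0 + i == n.*2)%N = false by lia.
Qed.

(** Class 0 is left out because a move from 0 creates a new part in it; the number of parts in each
    other class is invariant under moves of residue i. *)
Definition ncls i C (l : seq nat) : int := \sum_(y <- l) (if (0 < C)%N then (cls i y == C)%:Z else 0).

Lemma reach_ncls i C a l m : reach i a l m -> ncls i C l = ncls i C m.
Proof.
apply: (@reach_sum n (int : zmodType) (fun y => if (0 < C)%N then (cls i y == C)%:Z else 0)).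
  by rewrite cls0; case: C.
by move=> x ex; rewrite cls_ed.
Qed.

Section Core.
Variable tau : hspart n.
Hypothesis core : is_bar_core tau.

Lemma sum_tY (V : zmodType) (g : nat -> V) Y : Y \in newparts tau ->
  \sum_(y <- parts (tY tau Y)) g y = \sum_(y <- parts tau) g y + g Y
   + (if (Y < h)%N then g (h - Y)%N else 0) - (if (h < Y)%N then g (Y - h)%N else 0).
Proof.
move=> YA; rewrite (perm_big _ (tY_perm n_gt0 core YA)) /tseq /=.
case: (ltngtP Y h) => hY; rewrite ?subr0 ?addr0.
- by rewrite !big_cons -[RHS]addrA [RHS]addrC -addrA.
- rewrite [in RHS](perm_big _ (perm_to_rem (newparts_sub n_gt0 core YA hY))) /= !big_cons.
  by rewrite addrAC [g (Y - h)%N + _]addrC addrK addrC.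
- by rewrite big_cons hY addrC.
Qed.

(** The class of Y is the largest one in which [tY tau Y] and tau have different numbers of parts.
    As moves of residue i preserve these numbers, they preserve this class; [reach_cls] draws the
    conclusion. *)
Lemma ncls_tY_gt i C Y : (i <= n)%N -> Y \in newparts tau -> (cls i Y < C)%N ->
  ncls i C (tY tau Y) = ncls i C tau.
Proof.
move=> ni YA lt; rewrite /ncls sum_tY // (leq_ltn_trans (leq0n _) lt) (ltn_eqF lt) addr0.
have nY := newparts_gt n_gt0 YA.
case: (ltngtP Y h) => hY; rewrite ?subr0 ?addr0 //.
  have le : (h - Y <= Y)%N by move: nY; rewrite /hh; clear; lia.
  by rewrite (ltn_eqF (leq_ltn_trans (leq_cls i le) lt)) addr0.
by rewrite (ltn_eqF (leq_ltn_trans (leq_cls i (leq_subr h Y)) lt)) subr0.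
Qed.

Lemma ncls_tY i Y : (i <= n)%N -> Y \in newparts tau ->
  ncls i (cls i Y) tau < ncls i (cls i Y) (tY tau Y).
Proof.
move=> ni YA; have nY := newparts_gt n_gt0 YA.
rewrite /ncls sum_tY // (cls_gt0 ni nY) eqxx; move: (\sum_(_ <- _) _) => S.
case: (ltngtP Y h) => hY; rewrite ?subr0 ?addr0 ?ltrDl //.
  by rewrite -addrA ltrDl ltr_pwDl.
by rewrite (ltn_eqF (cls_sub ni (ltnW hY))) subr0 ltrDl.
Qed.

(** Two new parts in one class are joined by i-edges, and the equations for their charges pin down
    the weight. So outside the exceptional weights a new part is determined by its class. *)
Lemma newparts_cls i Y Z : (i <= n)%N -> Y \in newparts tau -> Z \in newparts tau ->
  cls i Y = cls i Z -> (Y < Z)%N ->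
  wt i tau = 0 \/ (i = 0%N /\ (wt i tau = 1 \/ wt i tau = -1)).
Proof.
move=> ni YA ZA e YZ; have eY := cls_eq_ed e (_ : Y <= Y < Z)%N.
have {eY} eY : ed n i Y by apply: eY; rewrite leqnn.
have cE y : y \in newparts tau -> y != h -> ch tau y = (y %/ h)%N%:Z.
  by rewrite mem_newparts // => /andP[_] /orP[->|/eqP].
have [i0|i0] := posnP i; last first.
  left; have i0n : (0 < i <= n)%N by rewrite i0.
  have ZE : Z = Y.+1.
    apply/eqP; rewrite eqn_leq YZ andbT leqNgt; apply/negP => lt.
    have := cls_eq_ed e (_ : Y <= Y.+1 < Z)%N; rewrite (edS_disj n_gt0 i0n eY) leqnSn lt.
    by move/(_ isT).
  have d1 := ed_mid_dvd n_gt0 i0n eY; have d2 := ed_mid_dvdS n_gt0 i0n eY.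
  have c1 : ch tau Y = (Y %/ h)%N%:Z.
    by apply: cE => //; apply: contraFneq d1 => ->; rewrite dvdnn.
  have c2 : ch tau Y.+1 = (Y %/ h)%N%:Z.
    have Zh : Z != h by rewrite ZE; apply: contraFneq d2 => ->; rewrite dvdnn.
    by rewrite -ZE (cE Z) // ZE divnS // d2.
  rewrite wt_ch gtn_eqF // add0r; move: eY; rewrite edE // => /orP[] /eqP m1.
    have e1 : (i = Y %[mod h])%N by rewrite m1 modn_small // /hh; lia.
    have e2 : (i.+1 = Y.+1 %[mod h])%N by rewrite -addn1 -modnDml e1 modnDml addn1.
    by rewrite (ch_mod tau e1) (ch_mod tau e2) c1 c2 subrr mulr0.
  have e1 : (h %| Y + i.+1)%N by rewrite /dvdn -modnDml addnS m1 -/h modnn.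
  have e2 : (h %| Y.+1 + i)%N by rewrite addSnnS.
  have := ch_opp tau e1; have := ch_opp tau e2; rewrite c1 c2 => -> /oppr_inj ->.
  by rewrite subrr mulr0.
right; split=> //; rewrite i0 wt_ch /= (ch_dvd tau (dvdn0 h)) sub0r.
move: eY; rewrite i0 ed0E // => /orP[hY|hY].
  have Yh : Y = h by apply: newparts_dvd YA hY.
  have n1 : ~~ ed n 0 h.+1 by apply/ed0_after/dvdnn.
  have ZE : Z = h.+1.
    apply/eqP; rewrite eqn_leq -{2}Yh YZ andbT leqNgt; apply/negP => lt; case/negP: n1.
    by rewrite -{1}i0; apply: (cls_eq_ed e); rewrite Yh leqnSn.
  right; have := cE _ ZA; rewrite ZE gtn_eqF // => /(_ isT).
  have -> : ch tau h.+1 = ch tau 1 by apply: ch_mod; rewrite -(addn1 h) modnDl.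
  have -> : (h.+1 %/ h = 1)%N by rewrite -(addn1 h) divnDl ?dvdnn // divnn divn_small //= /hh; lia.
  by move=> ->.
have c1 : ch tau 1 = - (Y %/ h)%N%:Z.
  have Yh : Y != h by apply: contraTneq hY => ->; rewrite -(addn1 h) dvdn_addr // gtnNdvd // /hh; lia.
  by rewrite -(cE Y) //; apply: ch_opp; rewrite add1n.
have [ZE|ZE] := eqVneq Z Y.+1.
  left; have Zh : Z = h by apply: (newparts_dvd n_gt0 ZA); rewrite ZE.
  have Yh : (Y < h)%N by rewrite -Zh.
  by rewrite c1 divn_small.
have n2 : ~~ ed n 0 Y.+2 by apply: ed0_after.
have {}ZE : Z = Y.+2.
  apply/eqP; rewrite eqn_leq [(Y.+2 <= Z)%N]ltn_neqAle eq_sym ZE YZ !andbT leqNgt; apply/negP => lt.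
  case/negP: n2; rewrite -{1}i0; apply: (cls_eq_ed e); rewrite lt andbT.
  by rewrite -addn2 leq_addr.
have : ch tau 1 = (Z %/ h)%N%:Z.
  rewrite -(cE Z) //; last by apply: contraTneq hY => Zh; rewrite gtnNdvd // -Zh ZE.
  by apply: ch_mod; rewrite ZE -(addn1 Y.+1); case/dvdnP: hY => k ->; rewrite modnMDl.
rewrite c1 => /eqP; rewrite -subr_eq0 -opprD oppr_eq0 -PoszD eqz_nat addn_eq0 => /andP[_ /eqP Z0].
have : (0 < Z %/ h)%N by rewrite divn_gt0 // ZE; apply: leq_trans (leqnSn _); apply: dvdn_leq.
by rewrite Z0.
Qed.

Lemma newparts_cls_inj i Y Z : (i <= n)%N -> wt i tau != 0 ->
  (i = 0%N -> wt i tau != 1 /\ wt i tau != -1) -> Y \in newparts tau -> Z \in newparts tau ->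
  cls i Y = cls i Z -> Y = Z.
Proof.
move=> ni w0 w1 YA ZA e; wlog YZ : Y Z YA ZA e / (Y < Z)%N.
  by move=> W; case: (ltngtP Y Z) => // lt; [apply: W | apply/esym/W].
case: (newparts_cls ni YA ZA e YZ) => [w|[i0]]; first by rewrite w eqxx in w0.
by have [n1 n2] := w1 i0; case=> w; [rewrite w eqxx in n1 | rewrite w eqxx in n2].
Qed.

End Core.

Lemma reach_cls tau tau' i a Y Z : (i <= n)%N -> is_bar_core tau -> is_bar_core tau' ->
  reach i a tau' tau -> Y \in newparts tau' -> Z \in newparts tau ->
  reach i a (tY tau' Y) (tY tau Z) -> cls i Y = cls i Z.
Proof.
move=> ni core core' rt YA ZA rYZ; case: (ltngtP (cls i Y) (cls i Z)) => // lt.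
  have := ncls_tY core ni ZA; rewrite -(reach_ncls _ rYZ) -(reach_ncls _ rt).
  by rewrite (ncls_tY_gt core') // ltxx.
have := ncls_tY core' ni YA; rewrite (reach_ncls _ rYZ) (reach_ncls _ rt).
by rewrite (ncls_tY_gt core) // ltxx.
Qed.

End EdgeClasses.

(** * Divided powers of f_i between two blocks with one bar *)

Section StepLevelOne.
Variables (R : realType) (n : nat).
Hypothesis n_gt0 : (0 < n)%N.
Local Notation h := (hh n).
Local Notation Cq := {fraction {poly R[i]}}.
Implicit Types (l m tau : hspart n) (r s x y z Y : nat) (u : hspart n -> Cq).
Local Notation qq := (q : Cq).
Local Notation f := (fop qq).
Local Notation e := (eop qq).
Let v0 := q_neq0 R.
Let vr := @q_root R.

Lemma block1_wt tau l i : bar_removal l tau -> wt i l = wt i tau.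
Proof. by case/bar_removal_inv => E _; rewrite !wt_ch !E. Qed.

Lemma block1_DD tau l : is_bar_core tau -> bar_removal l tau -> DD l = 4 * h%:Z.
Proof. by move=> core /DD_removal ->; rewrite DD_core // add0r. Qed.

Lemma mult_tY_dvd tau Y y : is_bar_core tau -> Y \in newparts tau -> (0 < y)%N -> (h %| y)%N ->
  mult y (tY tau Y) = ((Y == h) && (y == h))%N.
Proof.
move=> core YA y0 hy; have := mult_tY n_gt0 core y YA; have nY := newparts_gt n_gt0 YA.
have -> : mult y tau = 0%N.
  by rewrite core_mult //; apply/eqP; rewrite eqb0; apply: contraTN hy => /(core_not_dvd core).
have -> : (h < Y)%N && (y == Y - h)%N = false.
  apply/negP => /andP[hY /eqP yE]; have YE : Y = h.
    apply: (newparts_dvd n_gt0 YA); rewrite -(subnK (ltnW hY)) -yE dvdn_addr //.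
  by rewrite YE ltnn in hY.
have -> : (Y < h)%N && (y == h - Y)%N = false.
  apply/negP => /andP[Yh /eqP yE]; move: (dvdn_leq y0 hy); rewrite yE leqNgt ltn_subrL.
  by rewrite (leq_ltn_trans (leq0n n) nY).
rewrite !addn0 add0n => ->; have [YE|Yh] := eqVneq Y h; first by rewrite YE.
by have [yY|//] := eqVneq y Y; rewrite -yY in YA Yh; rewrite (newparts_dvd n_gt0 YA hy) eqxx in Yh.
Qed.

Variables (tau tau' : hspart n) (i a : nat).
Hypotheses (core : is_bar_core tau) (core' : is_bar_core tau').
Hypotheses (ni : (i <= n)%N) (a0 : (0 < a)%N) (rt : reach i a tau' tau).
Hypothesis wtau : wt i tau = - (a%:Z * (dd n i)%:Z).
Hypothesis ai : (i == 0%N) ==> (1 < a)%N.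

Lemma reach_block1 l m : reach i a l m -> bar_removal l tau' <-> bar_removal m tau.
Proof.
move=> rl; rewrite !block1P //.
have D0 : 2 * h%:Z * (a%:Z * wt i tau' - a%:Z * a%:Z * (dd n i)%:Z) = 0.
  by have := reach_DD n_gt0 ni rt; rewrite !DD_core // add0r.
split=> -[cE DE]; have cl k : ch l k = ch tau' k.
- exact: cE.
- split=> [k|]; first by rewrite (reach_ch n_gt0 ni rl) cl (reach_ch n_gt0 ni rt).
  have wl : wt i l = wt i tau' by rewrite !wt_ch !cl.
  by rewrite (reach_DD n_gt0 ni rl) wl D0 addr0.
- by have := cE k; rewrite (reach_ch n_gt0 ni rl) (reach_ch n_gt0 ni rt) => /addIr.
- split=> //; have wl : wt i l = wt i tau' by rewrite !wt_ch !cl.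
  by rewrite -DE (reach_DD n_gt0 ni rl) wl D0 addr0.
Qed.

Lemma step_wt' : wt i tau' = a%:Z * (dd n i)%:Z.
Proof. exact: core_step_wt rt. Qed.

Lemma step_cls_inj Y Z : Y \in newparts tau -> Z \in newparts tau -> cls n i Y = cls n i Z -> Y = Z.
Proof.
apply: newparts_cls_inj => //.
  by rewrite wtau oppr_eq0 mulf_neq0 // ?gt_eqF ?dd_gt0 // ltz_nat.
move=> i0; move: ai; rewrite wtau i0 /dd /= mulr1 => a1.
by split; lia.
Qed.

Lemma step_cls_inj' Y Z : Y \in newparts tau' -> Z \in newparts tau' -> cls n i Y = cls n i Z -> Y = Z.
Proof.
apply: newparts_cls_inj => //.
  by rewrite step_wt' mulf_neq0 // ?gt_eqF ?dd_gt0 // ltz_nat.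
move=> i0; move: ai; rewrite step_wt' i0 /dd /= mulr1 => a1.
by split; lia.
Qed.

(** The target would have [DD] = 2h(2 - (a + 1) d_i). This is negative except for i = 0 and a = 1,
    where it is 0; the hypothesis [ai] excludes that case. *)
Lemma block1_killed m : bar_removal m tau -> f i (delta Cq m) = (fun=> 0).
Proof.
move=> mt; apply: fop_eq0 => // l /delta_neq0 ->.
rewrite (block1_DD core mt) (block1_wt i mt) wtau.
have -> : 4 * h%:Z = 2 * h%:Z * 2 by ring.
rewrite -mulrDr pmulr_rlt0 //; move: ai; rewrite /dd; case: (eqVneq i 0%N) => /= _; first by lia.
by case: (i == n); lia.
Qed.

(** As for cores, f_i^a e_i^a is a nonzero scalar here, so e_i^a does not kill the basis vector. *)
Lemma step_ex s : (s <= n)%N -> exists2 r, (r <= n)%N & reach i a (tt tau' r) (tt tau s).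
Proof.
move=> sn; have mt := tt_block1 n_gt0 core sn.
suff [l rl] : exists l, reach i a l (tt tau s).
  have /(block1_tt n_gt0 core')[r rn lE] := (reach_block1 rl).2 mt.
  by exists r; rewrite // -lE.
apply: contrapT => nr.
have E0 : iter a (e i) (delta Cq (tt tau s)) = (fun=> 0).
  apply/funext => l; apply/eqP/contraT => /iter_eop_supp[m rm /delta_neq0 me].
  by case: nr; exists l; rewrite -me.
have wm (l : hspart n) : delta Cq (tt tau s) l != 0 -> wt i l = - (a%:Z * (dd n i)%:Z).
  by move/delta_neq0 => ->; rewrite (block1_wt i mt).
have := string_id n_gt0 v0 vr ni wm (block1_killed mt).
rewrite E0 stringcE => /(congr1 (fun g => g (tt tau s))) /=.
have -> : iter a (f i) (fun=> 0) (tt tau s) = 0.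
  by apply/eqP/contraT => /iter_fop_supp[l _]; rewrite eqxx.
rewrite /delta eqxx mulr1 => /esym/eqP; rewrite expf_eq0 /=.
by rewrite (negPf (qfact_neq0 n v0 vr i a)).
Qed.

(** Classes are intervals in increasing order and are preserved, so choosing predecessors is an
    increasing self-map of the positions, hence the identity. *)
Lemma step_cls r : (r <= n)%N ->
  cls n i (nth 0%N (newparts tau') r) = cls n i (nth 0%N (newparts tau) r).
Proof.
have ex (s : 'I_n.+1) : exists r : 'I_n.+1, reach i a (tt tau' r) (tt tau s).
  have sn : (s <= n)%N by rewrite -ltnS.
  by have [k kn rk] := step_ex sn; exists (Ordinal (kn : (k < n.+1)%N)).
have [g gP] := choice ex.
have gcls (s : 'I_n.+1) : cls n i (nth 0%N (newparts tau') (g s)) = cls n i (nth 0%N (newparts tau) s).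
  by apply: (reach_cls n_gt0 ni core core' rt) (gP s); apply: nth_newparts; rewrite -ltnS.
suff gid : forall s : 'I_n.+1, g s = s.
  by move=> rn; have := gcls (Ordinal (rn : (r < n.+1)%N)); rewrite gid.
apply: increasing_id => s s' ss'.
have on (k : 'I_n.+1) : (k <= n)%N by rewrite -ltnS.
rewrite -(ltn_newparts n_gt0 tau') //.
have lt : (nth 0%N (newparts tau) s < nth 0%N (newparts tau) s')%N by rewrite ltn_newparts.
have lec := leq_cls n i (ltnW lt); move: lec; rewrite leq_eqVlt => /orP[/eqP E|].
  by move: lt; rewrite (step_cls_inj _ _ E) ?ltnn // nth_newparts.
by rewrite -!gcls !ltnNge; apply: contraNN => /leq_cls; apply.
Qed.

(** Corresponding new parts share a class, and a class contains at most one new part. Hence h keeps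
    its position, so that the norms agree and so do the exponents 1 and 2. *)
Lemma step_h r : (r <= n)%N ->
  (nth 0%N (newparts tau') r == h) = (nth 0%N (newparts tau) r == h).
Proof.
move=> rn; have E := step_cls rn; apply/eqP/eqP => H; rewrite H in E; apply/esym.
  by apply: (step_cls_inj _ _ E); [apply: h_newparts | apply: nth_newparts].
by apply: (step_cls_inj' _ _ (esym E)); [apply: h_newparts | apply: nth_newparts].
Qed.

Lemma step_tt r : (r <= n)%N -> iter a (f i) (delta Cq (tt tau' r)) =
  (fun k : hspart n => qfact n qq i a * delta Cq (tt tau r) k).
Proof.
move=> rn; have mt := tt_block1 n_gt0 core rn; have lt := tt_block1 n_gt0 core' rn.
have YA := nth_newparts tau rn; have YA' := nth_newparts tau' rn.
apply: reflect_delta => //.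
- by rewrite (block1_wt i lt) step_wt'.
- by rewrite (block1_wt i mt).
- move=> N; rewrite /normc; apply: eq_bigr => y hy.
  by rewrite !mult_tY_dvd // step_h.
- exact: block1_killed.
- move=> k rk; have [Z ZA kE] := newparts_of_removal n_gt0 core ((reach_block1 rk).1 lt).
  rewrite kE in rk *; congr tY; apply: step_cls_inj => //; rewrite -step_cls //; apply/esym.
  exact: (reach_cls n_gt0 ni core core' rt YA' ZA rk).
- move=> k rk; have [Z ZA kE] := newparts_of_removal n_gt0 core' ((reach_block1 rk).2 mt).
  rewrite kE in rk *; congr tY; apply: step_cls_inj' => //; rewrite step_cls //.
  exact: (reach_cls n_gt0 ni core core' rt ZA YA rk).
Qed.

End StepLevelOne.

(** * Direct computation for 0 < i < n in weight 0 *)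

Section DirectMoves.
Variables (n : nat) (F : fieldType) (v : F).
Hypothesis n_gt0 : (0 < n)%N.
Local Notation h := (hh n).
Implicit Types (l m tau : hspart n) (i r s x y z Y Z : nat) (u : hspart n -> F).

Lemma fop_none i u m : (forall x, ed n i x -> dnok x m -> False) -> fop v i u m = 0.
Proof. by move=> H; rewrite /fop big1 // => x /andP[ex dx]; case: (H x). Qed.

Lemma fop_single i u m z : ed n i z -> dnok z m ->
  (forall x, ed n i x -> dnok x m -> x = z) ->
  fop v i u m = v ^ wl i z m * locf v z m * u (dn z m).
Proof.
move=> ez dz H; rewrite (fopE _ _ _ (ltnSn (sumn m))).
have zm : (z < (sumn m).+1)%N by rewrite ltnS ltnW // dnok_bound.
rewrite (bigD1 (Ordinal zm)) //= ez dz big1 ?addr0 // => x /eqP nx.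
by case: ifP => // /andP[ex dx]; case: nx; apply: val_inj; apply: H.
Qed.

Lemma fop_pair i u m z z' : z != z' -> ed n i z -> dnok z m -> ed n i z' -> dnok z' m ->
  (forall x, ed n i x -> dnok x m -> x = z \/ x = z') ->
  fop v i u m = v ^ wl i z m * locf v z m * u (dn z m) + v ^ wl i z' m * locf v z' m * u (dn z' m).
Proof.
move=> zz ez dz ez' dz' H; rewrite (fopE _ _ _ (ltnSn (sumn m))).
have zm : (z < (sumn m).+1)%N by rewrite ltnS ltnW // dnok_bound.
have zm' : (z' < (sumn m).+1)%N by rewrite ltnS ltnW // dnok_bound.
rewrite (bigD1 (Ordinal zm)) //= ez dz (bigD1 (Ordinal zm')) /=; last by rewrite -val_eqE /= eq_sym.
rewrite ez' dz' big1 ?addr0 // => x /andP[/eqP nx /eqP nx'].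
case: ifP => // /andP[ex dx]; case: (H x ex dx) => E; [case: nx | case: nx']; exact: val_inj.
Qed.

Lemma dnok_mult x m : dnok x m = (0 < mult x.+1 m)%N && ((mult x m == 0%N) || (h %| x)%N).
Proof. by rewrite /dnok !mem_mult -eqn0Ngt. Qed.

Lemma ch_edge i x l : (i <= n)%N -> ed n i x -> ch l x - ch l x.+1 = ch l i - ch l i.+1.
Proof.
move=> ni ex; rewrite /ch -!sumrB; apply: eq_bigr => y _.
by rewrite ![bq n _ y]bqC; exact: bq_ed.
Qed.

Variable tau : hspart n.
Hypothesis core : is_bar_core tau.

Lemma newparts_succ Y : Y \in newparts tau -> Y.+1 \in newparts tau ->
  (index Y (newparts tau) < n)%N /\ nth 0%N (newparts tau) (index Y (newparts tau)).+1 = Y.+1.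
Proof.
move=> YA YA1; set ys := newparts tau.
have iY : (index Y ys <= n)%N by rewrite -ltnS -(size_newparts tau) index_mem.
have iY1 : (index Y.+1 ys <= n)%N by rewrite -ltnS -(size_newparts tau) index_mem.
have lt : (index Y ys < index Y.+1 ys)%N by rewrite -(ltn_newparts n_gt0 tau) // !nth_index.
have sn : (index Y ys < n)%N by apply: leq_trans lt iY1.
split=> //; have le1 : (Y < nth 0%N ys (index Y ys).+1)%N.
  by rewrite -{1}(nth_index 0%N YA) ltn_newparts.
apply/eqP; rewrite eqn_leq le1 andbT leqNgt -{1}(nth_index 0%N YA1) ltn_newparts //.
by rewrite -leqNgt.
Qed.

Lemma wl_tY i z Y : Y \in newparts tau -> wl i z (tY tau Y) =
  wl i z tau + (if (Y < z)%N then W n i Y else 0)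
  + (if (Y < h)%N then (if (h - Y < z)%N then W n i (h - Y) else 0) else 0)
  - (if (h < Y)%N then (if (Y - h < z)%N then W n i (Y - h) else 0) else 0).
Proof. by move=> YA; rewrite /wl sum_tY // !addrA. Qed.

(** Removing the node lowers [DD] from 4h to 4h - 2h(wt + d_i) = 0. The charges of the result do not
    depend on z and Y, so it is always the same core. *)
Lemma dn_tY_core i z Y : (i <= n)%N -> wt i tau + (dd n i)%:Z = 2 -> Y \in newparts tau ->
  ed n i z -> dnok z (tY tau Y) ->
  is_bar_core (dn z (tY tau Y)) /\ forall k, ch (dn z (tY tau Y)) k = ch tau k + alpha n i k.
Proof.
move=> ni w2 YA ez dz; have lt := tY_removal n_gt0 core YA.
have [cE _] := bar_removal_inv lt; split; last by move=> k; rewrite (ch_dn n_gt0 _ ni ez dz) cE.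
apply: DD0_core => //; rewrite (DD_dn n_gt0 ni ez dz) (DD_removal lt) DD_core // add0r.
have -> : wt i (tY tau Y) = wt i tau by rewrite !wt_ch !cE.
by rewrite w2; ring.
Qed.

Lemma dn_tY_uniq i z Y z' Y' : (i <= n)%N -> wt i tau + (dd n i)%:Z = 2 -> Y \in newparts tau ->
  ed n i z -> dnok z (tY tau Y) -> Y' \in newparts tau -> ed n i z' -> dnok z' (tY tau Y') ->
  dn z (tY tau Y) = dn z' (tY tau Y').
Proof.
move=> ni w2 YA ez dz YA' ez' dz'; have [c1 E1] := dn_tY_core ni w2 YA ez dz.
have [c2 E2] := dn_tY_core ni w2 YA' ez' dz'.
by apply: core_ext => // k; rewrite E1 E2.
Qed.

Section Middle.
Variable i : nat.
Hypotheses (i0n : (0 < i < n)%N) (wtau : wt i tau = 0).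

Let i0 : (0 < i)%N. Proof. by case/andP: i0n. Qed.
Let ni : (i <= n)%N. Proof. by case/andP: i0n => _ /ltnW. Qed.
Let i0n' : (0 < i <= n)%N. Proof. by rewrite i0 ni. Qed.

Lemma middle_ch x : ed n i x -> ch tau x = ch tau x.+1.
Proof.
move=> ex; apply/eqP; rewrite -subr_eq0 (ch_edge tau ni ex); move: wtau.
by rewrite wt_ch gtn_eqF // add0r => /eqP; rewrite mulf_eq0.
Qed.

Lemma middle_div x : ed n i x -> (x.+1 %/ h = x %/ h)%N.
Proof. by move=> ex; rewrite divnS // (ed_mid_dvdS n_gt0 i0n' ex). Qed.

Lemma middle_mult x : ed n i x -> mult x.+1 tau = mult x tau.
Proof. by move=> ex; rewrite !core_mult // !(coreP n_gt0 _ core) (middle_div ex) (middle_ch ex). Qed.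

Lemma middle_mem Y : ed n i Y -> (Y.+1 \in newparts tau) = (Y \in newparts tau).
Proof.
move=> ex; rewrite !mem_newparts // (middle_div ex) (middle_ch ex).
have nh y : (h %| y)%N = false -> (y == h) = false.
  by move=> hy; apply/negP => /eqP E; rewrite E dvdnn in hy.
rewrite (nh _ (ed_mid_dvd n_gt0 i0n' ex)) (nh _ (ed_mid_dvdS n_gt0 i0n' ex)); congr andb.
rewrite ltnS leq_eqVlt; case: eqVneq => // nY; move: ex; rewrite -nY edE // modn_small; last by rewrite /hh; lia.
by move: i0n; rewrite -addnn; clear; lia.
Qed.

Lemma middle_W x : ed n i x -> W n i x = 2 /\ W n i x.+1 = -2.
Proof.
move=> ex; have x0 : (0 < x)%N by case: x ex => // ex; have := ed_mid_dvd n_gt0 i0n' ex.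
have d2 : (dd n i)%:Z = 2 by rewrite /dd gtn_eqF //; case/andP: i0n => _ /ltn_eqF ->.
rewrite !WE // !d2 /= ex (edS_disj n_gt0 i0n' ex); split=> //.
have -> : ed n i x.-1 = false by apply/negP => /(edS_disj n_gt0 i0n'); rewrite prednK // ex.
by rewrite subr0 mulr1.
Qed.

Lemma middle_W0 x : (0 < x)%N -> ed n i x = false -> ed n i x.-1 = false -> W n i x = 0.
Proof. by move=> x0 e1 e2; rewrite WE // e1 e2 subrr mulr0. Qed.

(** In weight 0 the two ends of an i-edge are both parts of the core or both not, so their weights
    cancel unless the cut passes between them. *)
Lemma middle_wl x : wl i x.+1 tau = if ed n i x then 2 * (mult x tau)%:Z else 0.
Proof.
elim: x => [|x IH].
  rewrite wlS wl0 gtn_eqF //= mult0 mul0r !addr0.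
  by case: ifP => // /(ed_mid_dvd n_gt0 i0n'); rewrite dvdn0.
rewrite wlS IH gtn_eqF //= addr0; case: (boolP (ed n i x)) => ex.
  by rewrite (edS_disj n_gt0 i0n' ex) (middle_W ex).2 middle_mult //; ring.
rewrite add0r; case: (boolP (ed n i x.+1)) => ex1; first by rewrite (middle_W ex1).1 mulrC.
by rewrite middle_W0 ?mulr0 //; exact: negbTE.
Qed.

Lemma middle_wl_ed x : ed n i x -> wl i x tau = 0.
Proof.
case: x => [|x] ex; first by rewrite wl0.
by rewrite middle_wl; case: ifP => // /(edS_disj n_gt0 i0n'); rewrite ex.
Qed.

Lemma ed_addh x : ed n i (x + h) = ed n i x.
Proof. by rewrite !edE // modnDr. Qed.

Lemma ed_opp x : (x < h)%N -> ed n i (h - x.+1) = ed n i x.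
Proof.
move=> xh; rewrite !edE // !modn_small //; last by rewrite ltn_subrL.
by move: ni xh; rewrite /hh -addnn; clear; lia.
Qed.

(** No i-node of the core itself can be removed, since the ends of i-edges occur together; only
    edges touched by the added bar qualify. *)
Lemma middle_dnok x Y : Y \in newparts tau -> ed n i x -> dnok x (tY tau Y) ->
  [\/ Y = x.+1, (Y < h)%N /\ x = (h - Y.+1)%N | (h < Y)%N /\ x = (Y - h)%N].
Proof.
move=> YA ex; rewrite dnok_mult (ed_mid_dvd n_gt0 i0n' ex) orbF => /andP[m1 /eqP m0].
have := mult_tY n_gt0 core x.+1 YA; have := mult_tY n_gt0 core x YA; rewrite m0 middle_mult //.
case: (ltngtP Y h) => hY /=; rewrite ?addn0.
- case: (eqVneq x.+1 Y) => [->|_]; first by constructor 1.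
  case: (eqVneq x.+1 (h - Y)%N) => [E|_]; last by lia.
  by constructor 2; rewrite subnS -E.
- case: (eqVneq x.+1 Y) => [->|_]; first by constructor 1.
  by case: (eqVneq x (Y - h)%N) => [E|_]; [constructor 3 | lia].
- by case: (eqVneq x.+1 Y) => [->|_]; [constructor 1 | lia].
Qed.

Lemma middle_locf x m : ed n i x -> locf v x m = 1.
Proof. by move=> ex; rewrite /locf (ed_mid_dvd n_gt0 i0n' ex) andbF. Qed.

Lemma middle_none u Y : Y \in newparts tau -> ~~ ed n i Y -> ~~ ed n i Y.-1 -> fop v i u (tY tau Y) = 0.
Proof.
move=> YA e0 e1; apply: fop_none => x ex /(middle_dnok YA ex)[E|[hY E]|[hY E]].
- by move: e1; rewrite E ex.
- by move: ex; rewrite E ed_opp // (negPf e0).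
- by move: e0; rewrite -(subnK (ltnW hY)) -E ed_addh ex.
Qed.

(** The exponent 2 comes from the smaller end of the bar: the added part h - Y - 1 has weight 2, and
    the lost part Y + 1 - h had weight -2. *)
Lemma middle_upper u Y : Y.+1 \in newparts tau -> ed n i Y ->
  dnok Y (tY tau Y.+1) /\ fop v i u (tY tau Y.+1) = v ^+ 2 * u (dn Y (tY tau Y.+1)).
Proof.
move=> YA eY; have YA0 : Y \in newparts tau by rewrite -middle_mem.
have eY1 := edS_disj n_gt0 i0n' eY.
have Yh : Y.+1 != h by apply: contraFneq (ed_mid_dvdS n_gt0 i0n' eY) => ->; rewrite dvdnn.
have nY := newparts_gt n_gt0 YA0.
have mY : mult Y tau = 0%N by rewrite core_mult // (negPf (newparts_notin n_gt0 core YA0)).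
have dY : dnok Y (tY tau Y.+1).
  rewrite dnok_mult (ed_mid_dvd n_gt0 i0n' eY) orbF; apply/andP; split.
    have := mult_tY n_gt0 core Y.+1 YA; rewrite eqxx.
    have -> : (Y.+1 == Y.+1 - h)%N = false by rewrite /hh; lia.
    by rewrite andbF addn0 => ->; rewrite addn1 addSn.
  have := mult_tY n_gt0 core Y YA; rewrite mY (ltn_eqF (ltnSn Y)).
  have -> : (Y == h - Y.+1)%N = false by rewrite /hh in Yh *; lia.
  by rewrite andbF !addn0 => /eqP; rewrite addn_eq0 => /andP[].
split=> //; rewrite (fop_single u eY dY).
  rewrite middle_locf // mulr1 wl_tY // middle_wl_ed // [(Y.+1 < Y)%N]ltnNge leqnSn /= !add0r.
  rewrite [X in v ^ X](_ : _ = 2) //; move: Yh; clear u.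
  case: (ltngtP Y.+1 h) => // hY _.
    have -> : (h - Y.+1 < Y)%N by rewrite /hh in hY *; lia.
    by rewrite subr0 (middle_W _).1 // ed_opp // ltnW.
  have -> : (Y.+1 - h < Y)%N by rewrite /hh in hY *; lia.
  by rewrite subSn // (middle_W _).2 ?opprK // -ed_addh subnK.
move=> x ex /(middle_dnok YA ex)[[->]//|[hY E]|[hY E]].
  by move: ex; rewrite E ed_opp // eY1.
by move: eY1; rewrite -(subnK (ltnW hY)) -E ed_addh ex.
Qed.

(** The node to remove is at the smaller end of the bar: h - Y is lowered, or Y + 1 - h drops into
    the place left by Y - h. Nothing below it has changed, so the exponent is 0. *)
Lemma middle_lower u Y : Y \in newparts tau -> ed n i Y ->
  exists z, [/\ ed n i z, dnok z (tY tau Y) & fop v i u (tY tau Y) = u (dn z (tY tau Y))].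
Proof.
move=> YA eY; have YA1 : Y.+1 \in newparts tau by rewrite middle_mem.
have Yh : Y != h by apply: contraFneq (ed_mid_dvd n_gt0 i0n' eY) => ->; rewrite dvdnn.
have Yh1 : Y.+1 != h by apply: contraFneq (ed_mid_dvdS n_gt0 i0n' eY) => ->; rewrite dvdnn.
have nY := newparts_gt n_gt0 YA.
pose z := (if Y < h then h - Y.+1 else Y - h)%N.
have ez : ed n i z.
  by rewrite /z; case: (ltnP Y h) => hY; [rewrite ed_opp | rewrite -ed_addh subnK].
have zY : (z < Y)%N by rewrite /z; case: (ltnP Y h); rewrite /hh; lia.
have dz : dnok z (tY tau Y).
  rewrite dnok_mult (ed_mid_dvd n_gt0 i0n' ez) orbF.
  have := mult_tY n_gt0 core z.+1 YA; have := mult_tY n_gt0 core z YA.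
  rewrite middle_mult // (ltn_eqF zY) /z; case: (ltngtP Y h) Yh => // hY _ /=.
    have -> : mult (h - Y.+1) tau = 0%N.
      rewrite core_mult //; apply/eqP; rewrite eqb0.
      by apply: (newparts_compl n_gt0 core YA1); rewrite ltn_neqAle Yh1.
    rewrite -[(h - Y.+1).+1]subSn // subSS eqxx addn0.
    have -> : (h - Y.+1 == h - Y)%N = false by lia.
    by rewrite !addn0 => -> ->; rewrite addn1.
  have -> : mult (Y - h) tau = 1%N by rewrite core_mult // (newparts_sub n_gt0 core YA hY).
  rewrite eqxx.
  have -> : ((Y - h).+1 == Y - h)%N = false by lia.
  have -> : ((Y - h).+1 == Y)%N = false by rewrite /hh in hY *; lia.
  by rewrite !addn0 addn1 => -[->] ->.
exists z; split=> //; rewrite (fop_single u ez dz).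
  rewrite middle_locf // mulr1 wl_tY // middle_wl_ed // [(Y < z)%N]ltnNge (ltnW zY) /= !add0r.
  rewrite [X in v ^ X](_ : _ = 0) ?expr0z ?mul1r // /z.
  case: (ltngtP Y h) Yh => // hY _; last by rewrite ltnn subr0.
  by rewrite ltnNge leq_sub2l ?subr0.
have nY1 : ed n i Y.-1 = false.
  by apply/negP => /(edS_disj n_gt0 i0n'); rewrite prednK ?eY // (leq_ltn_trans _ nY).
rewrite /z => x ex /(middle_dnok YA ex)[E|[hY ->]|[hY ->]].
- by move: nY1; rewrite E ex.
- by rewrite hY.
- by rewrite ltnNge (ltnW hY).
Qed.

End Middle.
End DirectMoves.

(** * Direct computation for i = 0 in weight 1 - 2c, that is, weight 1 or -1 *)

Section ResidueZero.
Variables (n : nat) (F : fieldType) (v : F).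
Hypothesis n_gt0 : (0 < n)%N.
Local Notation h := (hh n).
Implicit Types (l m : hspart n) (i r s x y z Y Z : nat) (u : hspart n -> F).

Variables (tau : hspart n) (c : nat).
Hypotheses (core : is_bar_core tau) (c1 : (c <= 1)%N) (chc : ch tau 1 = c%:Z).

Let h3 : (3 <= h)%N. Proof. by rewrite /hh; lia. Qed.
Let h1 : (h %| 1)%N = false. Proof. by rewrite gtnNdvd // ltnW // h3. Qed.

Lemma dvdS_false x : (h %| x)%N -> (h %| x.+1)%N = false.
Proof. by move=> hx; rewrite -addn1 dvdn_addr // h1. Qed.

Lemma dvdS_div x : (h %| x)%N -> (x.+1 %/ h = x %/ h)%N.
Proof. by move=> hx; rewrite divnS // dvdS_false. Qed.

Lemma zero_ch1 x : (h %| x)%N -> ch tau x.+1 = c%:Z.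
Proof. by case/dvdnP => k ->; rewrite -chc; apply: ch_mod; rewrite -addn1 modnMDl. Qed.

Lemma zero_chN x : (h %| x.+1)%N -> ch tau x = - c%:Z.
Proof. by move=> hx; rewrite -chc; apply: ch_opp; rewrite addn1. Qed.

(** The class of 1 modulo h has charge c <= 1, so its only possible part is 1. Together with
    [zero_mult]: no other end of a 0-edge is a part of the core. *)
Lemma zero_multS x : ed n 0 x -> mult x.+1 tau = ((x == 0) * c)%N.
Proof.
rewrite ed0E // core_mult // => /orP[hx|hx].
  rewrite (coreP n_gt0 _ core) zero_ch1 // dvdS_div // ltz_nat.
  case: (posnP x) => [->|x0]; first by rewrite div0n mul1n; case: c c1 => [|[]].
  have : (0 < x %/ h)%N by rewrite divn_gt0 // dvdn_leq.
  by rewrite mul0n; case: (x %/ h)%N c1 => // k; case: c => [|[]].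
have -> : (x.+1 \in parts tau) = false by apply: contraTF hx => /(core_not_dvd core).
by case: (eqVneq x 0%N) hx => // ->; rewrite h1.
Qed.

Lemma zero_mult x : ed n 0 x -> mult x tau = 0%N.
Proof.
rewrite ed0E // core_mult // => /orP[hx|hx]; apply/eqP; rewrite eqb0.
  by apply: contraTN hx => /(core_not_dvd core).
by rewrite (coreP n_gt0 _ core) zero_chN // -leNgt (@le_trans _ _ 0) // oppr_le0.
Qed.

Lemma W0E x : W n 0 x = if (h %| x.+1)%N then 2 else if (0 < x)%N && (h %| x.-1)%N then -2 else 0.
Proof.
case: (boolP (h %| x.+1)%N) => hx; first by have [] := W0_pred n_gt0 hx.
rewrite WE0 //; have -> : (x %% h == n.*2)%N = false.
  apply/negP => /eqP e; case/negP: hx; rewrite /dvdn -addn1 -modnDml e addn1 modnn //.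
case: x hx => [|x] hx; first by rewrite mod0n.
rewrite /= modhS // /dvdn; have [e|_] := eqVneq (x %% h).+1 h; last by rewrite eqSS; case: (x %% h)%N.
by have [e0|] := eqVneq (x %% h)%N 0%N => //; move: h3; rewrite -e e0.
Qed.

Lemma zero_wl z : wl 0 z tau = (0 < z)%N%:Z - (if (1 < z)%N then 2 * c%:Z else 0).
Proof.
elim: z => [|z IH]; first by rewrite wl0.
rewrite wlS IH W0E eqxx /=.
case: (boolP (h %| z.+1)%N) => hz.
  have ez : ed n 0 z by rewrite ed0E // hz orbT.
  rewrite zero_mult // mul0r addr0.
  have z2 : (1 < z)%N by have := leq_trans h3 (dvdn_leq (ltn0Sn z) hz).
  by rewrite z2 (ltnW z2) (gtn_eqF (ltnW z2)) addr0 (leqW z2).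
case: z IH hz => [|z] IH hz /=; first by rewrite mulr0 !addr0.
case: (boolP (h %| z)%N) => hz0; last by case: z hz0 {IH hz} => [|z] //; rewrite ?dvdn0 // mulr0 !addr0.
have ez : ed n 0 z by rewrite ed0E // hz0.
rewrite zero_multS //; case: z {IH hz hz0 ez} => [|z] /=; last by rewrite mul0n mul0r !addr0.
by rewrite mul1n; ring.
Qed.

Lemma zero_dnok x Z : Z \in newparts tau -> ed n 0 x -> dnok x (tY tau Z) ->
  [\/ x = 0%N /\ c = 1%N, x.+1 = Z | (Z < h)%N /\ x.+1 = (h - Z)%N].
Proof.
move=> ZA ex; rewrite dnok_mult => /andP[m0 _]; have := mult_tY n_gt0 core x.+1 ZA.
rewrite zero_multS //; case: (eqVneq x.+1 Z) => [E|_]; first by constructor 2.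
case: (boolP ((Z < h)%N && (x.+1 == h - Z)%N)) => [/andP[zh /eqP e]|_]; first by constructor 3.
have [x0|_] := eqVneq x 0%N; last by rewrite mul0n; lia.
rewrite mul1n !addn0 => E; constructor 1; split=> //; apply/eqP; rewrite eqn_leq c1 -E.
exact: leq_trans m0 (leq_addr _ _).
Qed.

Lemma zero_newparts Z : Z \in newparts tau -> ed n 0 Z || ed n 0 Z.-1 ->
  Z = h \/ Z = if c == 0%N then h.-1 else h.+1.
Proof.
move=> ZA H; have nZ := newparts_gt n_gt0 ZA; have Z0 : (0 < Z)%N by apply: leq_ltn_trans nZ.
have cE : Z != h -> ch tau Z = (Z %/ h)%N%:Z.
  by move: ZA; rewrite mem_newparts // => /andP[_] /orP[/eqP ->|/eqP //]; rewrite eqxx.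
have [ZE|Zh] := eqVneq Z h; [by left | right]; have {}cE := cE Zh.
have hZ : (h %| Z)%N = false by apply/negP => /(newparts_dvd n_gt0 ZA) E; rewrite E eqxx in Zh.
move: H; rewrite !ed0E // prednK // hZ !orbF => /orP[hZ1|hZ1].
  have c0 : c = 0%N.
    by move: (zero_chN hZ1); rewrite cE; move: (Z %/ h)%N => k; clear; lia.
  have := zero_chN hZ1; rewrite cE c0 oppr0 => /eqP; rewrite eqz_nat -leqn0 leqNgt divn_gt0 // -ltnNge => Zlt.
  have := dvdn_leq (ltn0Sn Z) hZ1; rewrite eqxx => le.
  by apply/eqP; rewrite -eqSS prednK // eqn_leq le Zlt.
have := zero_ch1 hZ1; rewrite prednK // cE => /eqP; rewrite eqz_nat -[in (Z %/ h)%N](prednK Z0) dvdS_div // => /eqP E.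
have Z1 : (0 < Z.-1)%N by move: nZ; lia.
have : (0 < c)%N by rewrite -E divn_gt0 // dvdn_leq.
case: c c1 E => [|[|//]] // _ E _ /=.
by rewrite -(prednK Z0) -[X in X.+1](divnK hZ1) E mul1n.
Qed.

Lemma h_pred : (h %| h.-1)%N = false.
Proof. by rewrite gtnNdvd //= /hh; lia. Qed.

Section Two.
Hypothesis cz : c = 0%N.

Lemma zero_pred_mem : h.-1 \in newparts tau.
Proof.
rewrite mem_newparts //; apply/andP; split; first by rewrite /hh /=; lia.
apply/orP; right; rewrite zero_chN ?prednK ?dvdnn // cz oppr0 divn_small //.
Qed.

Lemma zero_lower u : [/\ ed n 0 0, dnok 0 (tY tau h.-1) & fop v 0 u (tY tau h.-1) = u (dn 0 (tY tau h.-1))].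
Proof.
have e0 : ed n 0 0 by rewrite ed0E // dvdn0.
have A := zero_pred_mem.
have hh1 : (h - h.-1 = 1)%N by rewrite /hh /=; lia.
have d0 : dnok 0 (tY tau h.-1).
  rewrite dnok_mult dvdn0 orbT andbT; have := mult_tY n_gt0 core 1 A.
  have -> : (h < h.-1)%N = false by rewrite /hh /=; lia.
  have -> : (h.-1 < h)%N by [].
  by rewrite hh1 eqxx /= addn0 => ->; rewrite addn1.
split=> //; rewrite (fop_single v u e0 d0); first by rewrite wl0 expr0z /locf /= !mul1r.
move=> x ex /(zero_dnok A ex)[[->]//|E|[_]]; last by rewrite hh1 => -[].
move: ex; rewrite ed0E // E h_pred orbF => hx.
have xh : (x < h)%N by move: E; rewrite /hh /=; clear; lia.
by apply/eqP; rewrite -leqn0 leqNgt; apply/negP => /dvdn_leq/(_ hx); rewrite leqNgt xh.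
Qed.

(** This is the origin of the coefficient q at the part h: a bar h has no second end, and the weight
    below it is the 1 of the empty partition. *)
Lemma zero_upper u : [/\ ed n 0 h.-1, dnok h.-1 (tY tau h) & fop v 0 u (tY tau h) = v * u (dn h.-1 (tY tau h))].
Proof.
have e0 : ed n 0 h.-1 by rewrite ed0E // prednK // dvdnn orbT.
have A : h \in newparts tau by apply: h_newparts.
have d0 : dnok h.-1 (tY tau h).
  rewrite dnok_mult prednK //; have := mult_tY n_gt0 core h A; have := mult_tY n_gt0 core h.-1 A.
  rewrite !ltnn eqxx /= !addn0 zero_mult // (ltn_eqF (ltnSn _)) => -> ->.
  by rewrite addn1.
split=> //; rewrite (fop_single v u e0 d0).
  rewrite /locf h_pred andbF mulr1 wl_tY // zero_wl ltnn cz mulr0 if_same subr0.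
  have -> : (h < h.-1)%N = false by rewrite /hh /=; lia.
  have -> : (0 < h.-1)%N by rewrite /hh /=; lia.
  by rewrite !addr0 ?subr0 expr1z.
move=> x ex /(zero_dnok A ex)[[-> ]|<- //|[]]; last by rewrite ltnn.
by rewrite cz.
Qed.

Lemma zero_none u Z : Z \in newparts tau -> Z != h -> Z != h.-1 -> fop v 0 u (tY tau Z) = 0.
Proof.
move=> ZA Zh Zh1; apply: fop_none => x ex /(zero_dnok ZA ex)[[_]|E|[Zlt E]]; first by rewrite cz.
  have := zero_newparts ZA; rewrite cz /= -E ex orbT => /(_ isT)[] H; [case/eqP: Zh | case/eqP: Zh1]; by rewrite -E.
have Z0 : (0 < Z)%N by apply: leq_ltn_trans (newparts_gt n_gt0 ZA).
move: ex; rewrite ed0E // E => /orP[hx|/dvdn_leq]; last by rewrite subn_gt0 Zlt leqNgt ltn_subrL Z0 => /(_ isT).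
have x0 : x = 0%N.
  by apply/eqP; rewrite -leqn0 leqNgt; apply/negP => /dvdn_leq/(_ hx); rewrite leqNgt E leq_subr.
by case/eqP: Zh1; rewrite x0 in E; lia.
Qed.

End Two.

Section Three.
Hypothesis cz : c = 1%N.

Lemma three_one : 1%N \in parts tau.
Proof. by rewrite mem_mult zero_multS ?cz // ed0E // dvdn0. Qed.

Lemma three_dnok : dnok 0 tau.
Proof. by rewrite /dnok three_one dvdn0 orbT. Qed.

Let tau' := dn 0 tau.

Lemma three_ed : ed n 0 0. Proof. by rewrite ed0E // dvdn0. Qed.

(** In weight -1 with d_0 = 1, removing a 0-node leaves [DD] unchanged. *)
Lemma three_core : is_bar_core tau'.
Proof.
apply: DD0_core => //; rewrite (DD_dn n_gt0 _ three_ed three_dnok) // DD_core // wt_ch eqxx.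
by rewrite (ch_dvd tau (dvdn0 h)) chc cz /dd /= mulr0 subr0.
Qed.

Lemma three_ch y : ch tau y = ch tau' y - alpha n 0 y.
Proof. by rewrite (ch_dn n_gt0 _ _ three_ed three_dnok) // addrK. Qed.

Lemma three_ch1 : ch tau' 1 = 0.
Proof.
have := three_ch 1; rewrite chc cz /alpha !bqE //; last by rewrite (ltnW h3).
rewrite mod0n modn_small ?(ltnW h3) //= /hh.
have -> : (1 + 0 == n.*2.+1)%N = false by lia.
have -> : (1 + 1 == n.*2.+1)%N = false by lia.
  by move: (ch _ 1) => z; clear; lia.
exact: ltnW h3.
Qed.

Lemma three_mult y : (0 < y)%N -> mult y tau = (mult y tau' + (y == 1))%N.
Proof.
move=> y0; have := mult_dn three_dnok y0; rewrite -/tau' (gtn_eqF y0).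
by have := three_one; rewrite mem_mult; case: (eqVneq y 1%N) => [->|]; lia.
Qed.

Lemma three_mem Z : Z != h -> ~~ ed n 0 Z -> ~~ ed n 0 Z.-1 -> (Z \in newparts tau) = (Z \in newparts tau').
Proof.
move=> Zh e1 e2; have [Z0|Z0] := posnP Z; first by rewrite Z0 !mem_newparts // ltn0.
rewrite !mem_newparts // three_ch; suff -> : alpha n 0 Z = 0 by rewrite subr0.
rewrite /alpha; move: (W0E Z); rewrite /W; move: e1 e2; rewrite !ed0E // prednK // !negb_or.
move=> /andP[_ /negPf ->] /andP[/negPf -> _]; rewrite andbF => /eqP.
by rewrite mulf_eq0 /= ![bq n _ Z]bqC; rewrite ![bq n Z _]bqC => /eqP.
Qed.

Lemma three_dn x Z Z' : Z \in newparts tau -> Z' \in newparts tau' -> dnok x (tY tau Z) ->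
  (forall y, (0 < y)%N -> (mult y tau + (y == Z) + ((Z < h) && (y == h - Z)) + (y == x)
     + ((h < Z') && (y == Z' - h)) =
    mult y tau' + (y == Z') + ((Z' < h) && (y == h - Z')) + (y == x.+1) + ((h < Z) && (y == Z - h)))%N) ->
  dn x (tY tau Z) = tY tau' Z'.
Proof.
move=> ZA ZA' dx H; apply: hspart_ext => y y0; have := mult_dn dx y0.
have := H y y0; rewrite -(mult_tY n_gt0 core y ZA) -(mult_tY n_gt0 three_core y ZA').
move: (mult y _) (mult y _) (mult y _) (nat_of_bool ((h < Z) && _)%N) (nat_of_bool ((h < Z') && _)%N).
by move: (nat_of_bool (y == x)) (nat_of_bool (y == x.+1)); clear; lia.
Qed.

Lemma three_pred_mem : h.-1 \in newparts tau'.
Proof.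
rewrite mem_newparts //; apply/andP; split; first by rewrite /hh /=; lia.
apply/orP; right; rewrite (ch_opp tau' (y := 1%N)) ?addn1 ?prednK ?dvdnn // three_ch1 oppr0 divn_small //.
Qed.

Lemma three_succ_mem : h.+1 \in newparts tau.
Proof.
rewrite mem_newparts //; apply/andP; split; first by rewrite /hh /=; lia.
by apply/orP; right; rewrite zero_ch1 // dvdS_div // divnn cz.
Qed.

(** Two 0-nodes can be removed: the part 1, or the last node of the part h. Below the latter the
    weight is 1 from the empty partition and -2 from the part 1. *)
Lemma three_h u : fop v 0 u (tY tau h) = u (tY tau' h) + v^-1 * u (tY tau' h.-1).
Proof.
have A : h \in newparts tau by apply: h_newparts.
have A' : h \in newparts tau' by apply: h_newparts.
have e1 : ed n 0 h.-1 by rewrite ed0E // prednK // dvdnn orbT.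
have m1 := mult_tY n_gt0 core 1 A; have mh := mult_tY n_gt0 core h A; have mp := mult_tY n_gt0 core h.-1 A.
rewrite !ltnn eqxx /= !addn0 in m1 mh mp.
have d0 : dnok 0 (tY tau h) by rewrite dnok_mult dvdn0 orbT andbT m1 zero_multS ?three_ed // cz.
have d1 : dnok h.-1 (tY tau h).
  by rewrite dnok_mult prednK // mh addn1 /= mp zero_mult // (ltn_eqF (ltnSn _)).
have hp : (h < h.-1)%N = false by rewrite /hh /=; lia.
have hpl : (h.-1 < h)%N = true by exact: ltnSn.
have hp1 : (1 < h.-1)%N by rewrite /hh /=; lia.
have hph : (h - h.-1 = 1)%N by rewrite /hh /=; lia.
have E0 : dn 0 (tY tau h) = tY tau' h.
  apply: three_dn => // y y0; rewrite three_mult // (gtn_eqF y0) !ltnn /=.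
  by move: (nat_of_bool _) (nat_of_bool _) (mult y _); clear; lia.
have E1 : dn h.-1 (tY tau h) = tY tau' h.-1.
  apply: three_dn => // [|y y0]; first exact: three_pred_mem.
  rewrite three_mult // [h.-1.+1]prednK // !ltnn hp hph hpl /=.
  by move: (mult y _) (y == 1%N) (y == n.*2) (y == h) => a b1 b2 b3; clear; lia.
have E2 : wl 0 h.-1 (tY tau h) = -1.
  by rewrite wl_tY // zero_wl ltnn cz hp hp1 (ltnW hp1).
have l1 : locf v h.-1 (tY tau h) = 1 by rewrite /locf h_pred andbF.
have l0 : locf v 0 (tY tau h) = 1 by [].
rewrite (fop_pair v u (z := 0) (z' := h.-1) _ three_ed d0 e1 d1).
- by rewrite wl0 expr0z l0 l1 E0 E1 E2 exprN1 mul1r mul1r mulr1.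
- by rewrite eq_sym -lt0n; apply: ltnW.
- move=> x ex /(zero_dnok A ex)[[-> _]|<-|[]]; [by left|by right|by rewrite ltnn].
Qed.

(** Here the move is from h to h + 1, so the factor 1 - (-v^2)^b of N_0 appears with b = 1. *)
Lemma three_succ u : v != 0 -> fop v 0 u (tY tau h.+1) = (1 + v ^+ 2) * u (tY tau' h).
Proof.
move=> v0.
have A := three_succ_mem; have A' : h \in newparts tau' by apply: h_newparts.
have e1 : ed n 0 h by rewrite ed0E // dvdnn.
have hS : (h.+1 - h = 1)%N by rewrite subSnn.
have hlt : (h < h.+1)%N by []. have hge : (h.+1 < h)%N = false by rewrite ltnNge leqnSn.
have ms := mult_tY n_gt0 core h.+1 A; have mh := mult_tY n_gt0 core h A.
have m1 := mult_tY n_gt0 core 1 A.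
rewrite hS hlt hge eqxx /= !addn0 in ms mh m1.
have h11 : (h == 1)%N = false by rewrite gtn_eqF // (ltnW h3).
have d0 : dnok h (tY tau h.+1).
  by rewrite dnok_mult dvdnn orbT andbT ms addn1.
have h1lt : (1 < h)%N = true by rewrite (ltnW h3).
have h2 : (h %| 2)%N = false by rewrite gtnNdvd.
have E2 : wl 0 h (tY tau h.+1) = 1.
  by rewrite wl_tY // zero_wl hge hlt hS cz h1lt W0E h2.
have l1 : locf v h (tY tau h.+1) = v^-1 * (1 + v ^+ 2).
  rewrite /locf dvdnn (_ : mult h _ = 0%N) /= ?/beta ?expr1 ?opprK //.
  by move: mh; rewrite h11 (ltn_eqF (ltnSn h)) !addn0 zero_mult.
have E1 : dn h (tY tau h.+1) = tY tau' h.
  apply: three_dn => // y y0; rewrite three_mult // !ltnn hS hge hlt /=.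
  by move: (mult y _) (y == 1%N) (y == h.+1) (y == h) => a b1 b2 b3; clear; lia.
rewrite (fop_single v u e1 d0); first by rewrite E1 E2 l1 expr1z mulVKf.
move=> x ex dx; case: (zero_dnok A ex dx) => [[x0 _]|[->]//|[]]; last by rewrite hge.
move: dx; rewrite dnok_mult x0; move: m1; rewrite zero_multS ?three_ed // cz addn1 => -[->].
by [].
Qed.

Lemma three_other u Z : Z \in newparts tau -> Z != h -> Z != h.+1 ->
  Z \in newparts tau' /\ fop v 0 u (tY tau Z) = u (tY tau' Z).
Proof.
move=> ZA Zh Zh1; have nZ := newparts_gt n_gt0 ZA.
have [e1 e2] : ~~ ed n 0 Z /\ ~~ ed n 0 Z.-1.
  apply/andP; rewrite -negb_or; apply/negP => /(zero_newparts ZA); rewrite cz /=.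
  by case=> E; [rewrite E eqxx in Zh | rewrite E eqxx in Zh1].
have A' : Z \in newparts tau' by rewrite -three_mem.
split=> //.
have Z1 : (1 < Z)%N by apply: leq_ltn_trans nZ.
have nh1 : (h < Z)%N && (1 == Z - h)%N = false by move: Zh1; move: h => H; clear; lia.
have d0 : dnok 0 (tY tau Z).
  rewrite dnok_mult dvdn0 orbT andbT; have := mult_tY n_gt0 core 1 ZA.
  by rewrite nh1 addn0 zero_multS ?three_ed // cz => ->.
rewrite (fop_single v u three_ed d0).
  rewrite wl0 expr0z /locf /= !mul1r; congr u.
  apply: three_dn => // y y0; rewrite three_mult // (gtn_eqF y0).
  move: (nat_of_bool (y == Z)) (nat_of_bool ((Z < h)%N && _)) (nat_of_bool ((h < Z)%N && _)).
  by move: (nat_of_bool _) (mult y _); clear; lia.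
move=> x ex /(zero_dnok ZA ex)[[->]//|E|[Zlt E]]; first by move: e2; rewrite -E ex.
move: ex; rewrite ed0E // E => /orP[hx|/dvdn_leq]; last first.
  by rewrite subn_gt0 Zlt leqNgt ltn_subrL (ltn_trans _ Z1) // => /(_ isT).
by apply/eqP; rewrite -leqn0 leqNgt; apply/negP => /dvdn_leq/(_ hx); rewrite leqNgt E leq_subr.
Qed.

End Three.
End ResidueZero.

(** * The linear algebra of f_0 in weight -1 *)

Section Shift.
Variables (F : fieldType) (v : F) (s : nat).
Hypothesis v0 : v != 0.
Implicit Types (g x : nat -> F) (r k : nat).

(* The action of f_0 on the coefficients in a block of weight -1, when h - 1
   and h are the new parts number s and s + 1 of the core below. *)
Definition shift g k : F :=
  if k == s then g s.+1 + v^-1 * g s else if k == s.+1 then (1 + v ^+ 2) * g s.+1 else g k.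

Definition pair_coef (p r k : nat) : F :=
  (k == r)%:R + v ^+ (if r.+1 == p then 1 else 2)%N * (k == r.+1)%:R.

Let sS k : (k.+1 == k) = false. Proof. by rewrite gtn_eqF. Qed.
Let Ss k : (k == k.+1) = false. Proof. by rewrite ltn_eqF. Qed.
Let sSS k : (k.+2 == k) = false. Proof. by rewrite gtn_eqF. Qed.
Let Sss k : (k == k.+2) = false. Proof. by rewrite ltn_eqF. Qed.

Let bE : ((nat_of_bool false)%:R = 0 :> F) * ((nat_of_bool true)%:R = 1 :> F). Proof. by []. Qed.

(** Writing G' for the two-term vectors of the core below and G for those above, f_0 sends G'(s) to
    (v + 1/v) G(s), G'(s + 1) to G(s) + G(s + 1), and every other G'(r) to G(r). So all G(r) can be
    solved for over C(q + 1/q). *)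
Lemma shift_same k : shift (pair_coef s.+1 s) k = (v + v^-1) * pair_coef s s k.
Proof.
rewrite /shift /pair_coef !eqxx !sS !Ss.
have [->|_] := eqVneq k s; first by rewrite Ss; rewrite ?bE; field.
by have [_|_] := eqVneq k s.+1; rewrite ?bE; [field | ring].
Qed.

Lemma shift_sameK k : v + v^-1 != 0 -> (v + v^-1)^-1 * shift (pair_coef s.+1 s) k = pair_coef s s k.
Proof. by move=> c0; rewrite shift_same mulKf. Qed.

Lemma shift_next k : shift (pair_coef s.+1 s.+1) k = pair_coef s s k + pair_coef s s.+1 k.
Proof.
rewrite /shift /pair_coef !eqxx !sS !Ss !sSS.
have [->|ks] := eqVneq k s; first by rewrite ?Ss ?Sss ?bE; field.
by have [->|ks1] := eqVneq k s.+1; rewrite ?Ss ?bE; ring.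
Qed.

Lemma shift_nextB k : pair_coef s s.+1 k = shift (pair_coef s.+1 s.+1) k + -1 * pair_coef s s k.
Proof. by rewrite shift_next mulN1r addrAC subrr add0r. Qed.

Lemma shift_other r k : r != s -> r != s.+1 -> shift (pair_coef s.+1 r) k = pair_coef s r k.
Proof.
move=> rs rs1; rewrite /shift /pair_coef eqSS (negPf rs) (eq_sym s.+1 r) (negPf rs1) (eq_sym s r) (negPf rs).
rewrite [s.+1 == r.+1]eqSS (eq_sym s r) (negPf rs) (eq_sym r.+1 s).
have [->|ks] := eqVneq k s.
  by rewrite (eq_sym s r) (negPf rs); case: (s == r.+1); rewrite ?bE; field.
have [->|ks1] := eqVneq k s.+1.
  by rewrite (eq_sym s.+1 r) (negPf rs1) eqSS (eq_sym s r) (negPf rs); rewrite ?bE; ring.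
by have [e|_] := eqVneq s r.+1; rewrite // -e (negPf ks); rewrite ?bE; ring.
Qed.

(** The coefficient at position k of the combination of the vectors [pair_coef p r] with
    coefficients x r. *)
Definition stair (p : nat) x k : F := x k + (if k == 0%N then 0 else v ^+ (if k == p then 1 else 2)%N * x k.-1).

(** The preceding three formulas on a linear combination: only the coefficient of index s
    changes. *)
Lemma shift_stair x k :
  shift (stair s.+1 x) k = stair s (fun r => if r == s then x s.+1 + (v + v^-1) * x s else x r) k.
Proof.
rewrite /shift /stair.
have [->|ks] := eqVneq k s.
  rewrite eqxx /= Ss; case: s => [|p] /=; first by field.
  by rewrite Ss; rewrite ?bE; field.
have [->|ks1] := eqVneq k s.+1; first by rewrite eqxx /= eqxx; rewrite ?bE; field.
by case: k ks ks1 => [|k] //= ks ks1; rewrite eqSS in ks1; rewrite (negPf ks1).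
Qed.

End Shift.

(** * Two-term vectors, and the exceptional strings in a block with one bar *)

Section LevelOne.
Variables (R : realType) (n : nat).
Hypothesis n_gt0 : (0 < n)%N.
Local Notation h := (hh n).
Local Notation Cq := {fraction {poly R[i]}}.
Implicit Types (l m tau : hspart n) (i a r s x y z Y Z : nat) (u : hspart n -> Cq).
Local Notation qq := (q : Cq).
Local Notation f := (fop qq).
Local Notation e := (eop qq).
Let v0 := q_neq0 R.
Let vr := @q_root R.

Definition hpos tau : nat := index h (newparts tau).

Lemma hpos_le tau : (hpos tau <= n)%N.
Proof. by rewrite -ltnS -(size_newparts tau) index_mem h_newparts. Qed.

Lemma nth_hpos tau : nth 0%N (newparts tau) (hpos tau) = h.
Proof. by rewrite nth_index // h_newparts. Qed.

Lemma nth_newparts_eq tau r s : (r <= n)%N -> (s <= n)%N ->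
  (nth 0%N (newparts tau) r == nth 0%N (newparts tau) s) = (r == s).
Proof.
move=> rn sn; apply/eqP/eqP => [E|->] //.
have := ltn_newparts n_gt0 tau rn sn; have := ltn_newparts n_gt0 tau sn rn.
by rewrite E ltnn; case: ltngtP.
Qed.

Lemma nth_newparts_h tau r : (r <= n)%N -> (nth 0%N (newparts tau) r == h) = (r == hpos tau).
Proof. by move=> rn; rewrite -{1}(nth_hpos tau) nth_newparts_eq // hpos_le. Qed.

(** On the block, u is a combination over C(q + 1/q) of the two-term vectors; x n = 0 because there
    is none for the last, non-restricted member. Values outside the block are not constrained. *)
Definition InG tau u := exists x : nat -> Cq, [/\ forall r, in_Cqsym (x r), x n = 0 &
  forall r, (r <= n)%N -> u (tt tau r) = stair qq (hpos tau) x r].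

Definition Gd tau r : hspart n -> Cq := fun k =>
  delta Cq (tt tau r) k + qq ^+ (if r.+1 == hpos tau then 1 else 2)%N * delta Cq (tt tau r.+1) k.

Lemma delta_tt tau r s : is_bar_core tau -> (r <= n)%N -> (s <= n)%N ->
  delta Cq (tt tau r) (tt tau s) = (s == r)%:R.
Proof.
move=> core rn sn; rewrite /delta; congr (nat_of_bool _)%:R.
by apply/eqP/eqP => [/(tt_inj n_gt0 core sn rn)|->].
Qed.

Lemma Gd_tt tau r s : is_bar_core tau -> (r < n)%N -> (s <= n)%N ->
  Gd tau r (tt tau s) = pair_coef qq (hpos tau) r s.
Proof. by move=> core rn sn; rewrite /Gd !delta_tt // ltnW. Qed.

Lemma Gd_supp tau r k : is_bar_core tau -> (r < n)%N -> Gd tau r k != 0 -> bar_removal k tau.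
Proof.
move=> core rn; rewrite /Gd; have [kr _|k1] := eqVneq k (tt tau r).
  by rewrite kr; apply: tt_block1 => //; apply: ltnW.
have [kr _|k2] := eqVneq k (tt tau r.+1); first by rewrite kr; apply: tt_block1.
by rewrite /delta (negPf k1) (negPf k2) mulr0 addr0 eqxx.
Qed.

Lemma eq_block1 tau (u1 u2 : hspart n -> Cq) : is_bar_core tau ->
  (forall k, u1 k != 0 -> bar_removal k tau) -> (forall k, u2 k != 0 -> bar_removal k tau) ->
  (forall r, (r <= n)%N -> u1 (tt tau r) = u2 (tt tau r)) -> u1 = u2.
Proof.
move=> core s1 s2 E; apply/funext => k; have [bk|nb] := pselect (bar_removal k tau).
  by have [r rn ->] := block1_tt n_gt0 core bk; apply: E.
have -> : u1 k = 0 by apply/eqP/contraT => /s1.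
by apply/esym/eqP/contraT => /s2.
Qed.

Lemma InG0 tau u : (forall r, (r <= n)%N -> u (tt tau r) = 0) -> InG tau u.
Proof.
move=> H; exists (fun=> 0); split=> // [_|r rn]; first exact: inK0.
by rewrite H // /stair mulr0 if_same addr0.
Qed.

(** The lower ends of i-edges lie in the classes of i and -(i + 1), which have opposite charges in
    weight 0. The charge of i is positive in the first case and not in the second, so it decides the
    class and then Y. *)
Lemma middle_edge_uniq tau i Y Z : is_bar_core tau -> (0 < i < n)%N -> wt i tau = 0 ->
  Y \in newparts tau -> Z \in newparts tau -> ed n i Y -> ed n i Z -> Y = Z.
Proof.
move=> core i0n w0; have [i0 /ltnW ni] := andP i0n; have i0n' : (0 < i <= n)%N by rewrite i0.
have cE y : y \in newparts tau -> ed n i y -> ch tau y = (y %/ h)%N%:Z.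
  rewrite mem_newparts // => /andP[_ /orP[/eqP ->|/eqP //]] /(ed_mid_dvd n_gt0 i0n').
  by rewrite dvdnn.
have ci : ch tau i.+1 = ch tau i.
  by move: w0; rewrite wt_ch gtn_eqF // add0r => /eqP; rewrite mulf_eq0 subr_eq0 => /eqP/esym.
have half y : y \in newparts tau -> ed n i y ->
    (y %% h = i)%N /\ ch tau i = (y %/ h)%N%:Z /\ (0 < y %/ h)%N \/ (y %% h + i = n.*2)%N /\ ch tau i = - (y %/ h)%N%:Z.
  move=> yA ey; have nY := newparts_gt n_gt0 yA; move: (ey); rewrite edE // => /orP[]/eqP E; [left|right]; split=> //.
    split; first by rewrite -cE //; apply: ch_mod; rewrite -E modn_mod.
    by rewrite divn_gt0 // leqNgt; apply/negP => yh; move: E; rewrite modn_small //; lia.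
  by rewrite -cE // -ci; apply: ch_opp; rewrite /dvdn -modnDmr addSn addnC E modnn.
move=> YA ZA eY eZ; have := half _ YA eY; have := half _ ZA eZ.
have YE := divn_eq Y h; have ZE := divn_eq Z h; move: (ch tau i) => c.
move=> [[r1 [d1 p1]]|[r1 d1]] [[r2 [d2 p2]]|[r2 d2]].
- by rewrite YE ZE r1 r2; congr (_ * _ + _)%N; apply/eqP; rewrite -eqz_nat -d1 -d2.
- by move: d1 d2 p1; move: (_ %/ _)%N (_ %/ _)%N => a b; clear; lia.
- by move: d1 d2 p2; move: (_ %/ _)%N (_ %/ _)%N => a b; clear; lia.
rewrite YE ZE; congr (_ * _ + _)%N; last by apply/eqP; rewrite -(eqn_add2r i) r1 r2.
by apply/eqP; rewrite -eqz_nat -eqr_opp -d1 -d2.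
Qed.

Section TwoTerms.
Variables (tau : hspart n) (i Y : nat).
Hypotheses (core : is_bar_core tau) (ni : (i < n)%N) (YA : Y \in newparts tau) (eY : ed n i Y).
Hypothesis wY : (0 < i)%N /\ wt i tau = 0 \/ [/\ i = 0%N, wt i tau = 1 & Y = h.-1].

Lemma two_wt : wt i tau + (dd n i)%:Z = 2.
Proof.
case: wY => [[i0 ->]|[-> -> _]]; last by rewrite /dd.
by rewrite /dd gtn_eqF // (ltn_eqF ni).
Qed.

Lemma two_terms : Y.+1 \in newparts tau /\ exists sg, [/\ is_bar_core sg,
    forall k, f i (delta Cq sg) k != 0 -> bar_removal k tau &
    forall u Z, Z \in newparts tau -> f i u (tY tau Z) =
      if Z == Y then u sg else if Z == Y.+1 then qq ^+ (if Z == h then 1 else 2)%N * u sg else 0].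
Proof.
have ni' : (i <= n)%N by apply: ltnW.
have [YA1 [z [ez dz] H]] : Y.+1 \in newparts tau /\ exists2 z, ed n i z /\ dnok z (tY tau Y) &
    forall u Z, Z \in newparts tau -> f i u (tY tau Z) =
      if Z == Y then u (dn z (tY tau Y)) else if Z == Y.+1 then qq ^+ (if Z == h then 1 else 2)%N * u (dn z (tY tau Y)) else 0.
  case: wY => [[i0 w0]|[i0 w1 YE]].
    have i0n : (0 < i < n)%N by rewrite i0.
    have YA1 : Y.+1 \in newparts tau by rewrite (middle_mem n_gt0 i0n w0 eY).
    have Yh1 : Y.+1 != h.
      have i0n' : (0 < i <= n)%N by rewrite i0.
      by apply: contraFneq (ed_mid_dvdS n_gt0 i0n' eY) => ->; rewrite dvdnn.
    split=> //; have [z [ez dz _]] := middle_lower qq n_gt0 core i0n w0 (fun=> 0) YA eY.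
    exists z => // u Z ZA; have [->|ZY] := eqVneq Z Y.
      have [z' [ez' dz' ->]] := middle_lower qq n_gt0 core i0n w0 u YA eY.
      by rewrite (dn_tY_uniq n_gt0 core ni' two_wt YA ez dz YA ez' dz').
    have [->|ZY1] := eqVneq Z Y.+1.
      have [dY ->] := middle_upper qq n_gt0 core i0n w0 u YA1 eY.
      by rewrite (negPf Yh1) (dn_tY_uniq n_gt0 core ni' two_wt YA ez dz YA1 eY dY).
    have Z0 : (0 < Z)%N by apply: leq_ltn_trans (newparts_gt n_gt0 ZA).
    have N y : y \in newparts tau -> ed n i y -> y = Y.
      by move=> yA ey; apply: (middle_edge_uniq core i0n w0).
    apply: (middle_none qq n_gt0 core i0n w0) => //; apply/negP => eZ; first by rewrite (N Z) // eqxx in ZY.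
    have Z1A : Z.-1 \in newparts tau by rewrite -(middle_mem n_gt0 i0n w0 eZ) prednK.
    by rewrite -(N _ Z1A eZ) prednK // eqxx in ZY1.
  have c0 : ch tau 1 = 0%N%:Z.
    by move: w1; rewrite i0 wt_ch (ch_dvd tau (dvdn0 h)) /=; move: (ch _ _) => z; clear; lia.
  have [ez dz lE] := zero_lower qq n_gt0 core (leq0n 1) c0 erefl (fun=> 0).
  rewrite i0 YE; split; first by rewrite prednK // h_newparts.
  exists 0%N => // u Z ZA; have [->|ZY] := eqVneq Z h.-1.
    by have [_ _ ->] := zero_lower qq n_gt0 core (leq0n 1) c0 erefl u.
  have [Zh|Zh] := eqVneq Z h.-1.+1.
    have {}Zh : Z = h by rewrite Zh prednK.
    rewrite Zh; have [eu du ->] := zero_upper qq n_gt0 core (leq0n 1) c0 erefl u.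
    have w2 := two_wt; rewrite i0 in w2; have pA := YA; rewrite YE in pA.
    by rewrite ?eqxx expr1 (dn_tY_uniq n_gt0 core (leq0n n) w2 pA ez dz (h_newparts n_gt0 tau) eu du).
  by apply: (zero_none qq n_gt0 core (leq0n 1) c0 erefl); rewrite // -(prednK (ltn0Sn n.*2)).
split=> //; exists (dn z (tY tau Y)).
have [sc sE] := dn_tY_core n_gt0 core ni' two_wt YA ez dz; split=> // k.
move/fop_supp=> [x [ex dx /delta_neq0 xE]]; apply/(block1P n_gt0 k core); split=> [y|].
  have := ch_dn n_gt0 y ni' ex dx; rewrite xE sE => /addIr; exact/esym.
rewrite -(dnK dx) xE (DD_up n_gt0 ni' ex); last by rewrite -xE upok_dn.
rewrite (DD_core n_gt0 sc) add0r (wt_dn n_gt0 ni' ni' ez dz) (AA_diag n_gt0 ni').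
have lt := tY_removal n_gt0 core YA; rewrite (block1_wt i lt).
have := two_wt; rewrite PoszM; move: (wt i tau) (dd n i)%:Z => w d E.
have -> : w + 2%Z * d - d = 2 by rewrite -E; ring.
by ring.
Qed.

End TwoTerms.

Section ThreeTerms.
Variable tau : hspart n.
Hypotheses (core : is_bar_core tau) (wtau : wt 0 tau = -1).

Lemma three_chE : ch tau 1 = 1%N%:Z.
Proof. by move: wtau; rewrite wt_ch (ch_dvd tau (dvdn0 h)) eqxx /=; move: (ch _ _) => z; clear; lia. Qed.

Let tau' := dn 0 tau.
Let core' : is_bar_core tau' := three_core n_gt0 core (leqnn 1) three_chE erefl.

Let ch1 : ch tau' 1 = 0%N%:Z := three_ch1 n_gt0 core (leqnn 1) three_chE erefl.

Let phi Z := if (Z == h.-1) || (Z == h) then Z.+1 else Z.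

(** [phi] is increasing on the new parts of tau' because h + 1 is not among them. Hence positions
    are kept, and the position of h goes down by one since h - 1 becomes h. *)
Lemma three_newparts : newparts tau = [seq phi Z | Z <- newparts tau'].
Proof.
have phiA Z : Z \in newparts tau' -> phi Z \in newparts tau.
  move=> ZA; rewrite /phi; have [->|Z1] /= := eqVneq Z h.-1; first exact: h_newparts.
  have [->|Z2] := eqVneq Z h; first exact: (three_succ_mem n_gt0 (leqnn 1) three_chE erefl).
  rewrite (three_mem n_gt0 core (leqnn 1) three_chE erefl) //.
    apply/negP => eZ; have := zero_newparts n_gt0 (leq0n 1) ch1 ZA.
    by rewrite eZ => /(_ isT)[] E; [case/eqP: Z2 | case/eqP: Z1]; exact: E.
  apply/negP => eZ; have := zero_newparts n_gt0 (leq0n 1) ch1 ZA.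
  by rewrite eZ orbT => /(_ isT)[] E; [case/eqP: Z2 | case/eqP: Z1]; exact: E.
have nS : h.+1 \notin newparts tau'.
  apply/negP => HA; have := zero_newparts n_gt0 (leq0n 1) ch1 HA.
  rewrite ed0E // ed0E // dvdnn /= orbT => /(_ isT)[]; first by move/eqP; rewrite gtn_eqF.
  by rewrite /hh /=; move: (n.*2) => N; clear; lia.
have phi_mono : {in newparts tau' &, forall Z Z', (Z < Z')%N -> (phi Z < phi Z')%N}.
  move=> Z Z' ZA ZA' lt; have ne : Z' != h.+1 by apply: contraTneq ZA' => ->.
  rewrite /phi; move: lt ne; rewrite /hh /=; move: (n.*2) => N; clear.
  by case: (eqVneq Z N) => ?; case: (eqVneq Z N.+1) => ?; case: (eqVneq Z' N) => ?; case: (eqVneq Z' N.+1) => ? /=; lia.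
have srt : sorted ltn [seq phi Z | Z <- newparts tau'].
  have := newparts_sorted n_gt0 tau'; rewrite !(sorted_pairwise ltn_trans) pairwise_map.
  move=> H; apply: (sub_in_pairwise _ (allss _) H) => Z Z' ZA ZA' /=; exact: phi_mono.
apply: (irr_sorted_eq ltn_trans ltnn (newparts_sorted n_gt0 tau) srt) => Z; apply/esym.
have su : uniq [seq phi Z | Z <- newparts tau'] by exact: (sorted_uniq ltn_trans ltnn srt).
have sub : {subset [seq phi Z | Z <- newparts tau'] <= newparts tau}.
  by move=> _ /mapP[z zA ->]; apply: phiA.
have sz : (size (newparts tau) <= size [seq phi Z | Z <- newparts tau'])%N by rewrite size_map !size_newparts.
exact: (uniq_min_size su sub sz).2 Z.
Qed.

Let s := hpos tau.

Lemma three_index : [/\ (s < n)%N, nth 0%N (newparts tau') s = h.-1 & hpos tau' = s.+1].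
Proof.
have pA := three_pred_mem n_gt0 core (leqnn 1) three_chE erefl.
have hA : h.-1.+1 \in newparts tau' by rewrite prednK // h_newparts.
have [lt nE] := newparts_succ n_gt0 pA hA; rewrite prednK // in nE.
have sE : s = index h.-1 (newparts tau').
  apply/eqP; rewrite eq_sym -nth_newparts_h ?(ltnW lt) // three_newparts.
  by rewrite (nth_map 0%N) ?size_newparts ?ltnS ?(ltnW lt) // nth_index // /phi eqxx.
split; rewrite sE //; first exact: nth_index.
by apply/eqP; rewrite eq_sym -nth_newparts_h // nE.
Qed.

Lemma three_shift u r : (r <= n)%N -> f 0 u (tt tau r) = shift qq s (fun k => u (tt tau' k)) r.
Proof.
move=> rn; have [sn ns hs] := three_index; have rn' : (r < size (newparts tau'))%N by rewrite size_newparts.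
have nE : nth 0%N (newparts tau) r = phi (nth 0%N (newparts tau') r) by rewrite three_newparts (nth_map 0%N).
have p1 : phi h.-1 = h by rewrite /phi eqxx.
have p2 : phi h = h.+1 by rewrite /phi eqxx orbT.
rewrite /shift /tt nE; have hE : nth 0%N (newparts tau') s.+1 = h by rewrite -hs nth_hpos.
have [->|rs] := eqVneq r s.
  by rewrite hE ns p1 (three_h qq n_gt0 core (leqnn 1) three_chE erefl).
have [->|rs1] := eqVneq r s.+1.
  by rewrite hE p2 (three_succ n_gt0 core (leqnn 1) three_chE erefl _ v0).
have n1 : nth 0%N (newparts tau') r != h.-1 by rewrite -ns nth_newparts_eq // ltnW.
have n2 : nth 0%N (newparts tau') r != h by rewrite nth_newparts_h // hs.
have rA := nth_newparts tau rn; rewrite nE /phi (negPf n1) (negPf n2) /= in rA *.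
have n3 : nth 0%N (newparts tau') r != h.+1.
  apply/eqP => E; have := zero_newparts n_gt0 (leq0n 1) ch1 (nth_newparts tau' rn).
  rewrite E ed0E // ed0E // dvdnn orbT => /(_ isT)[]; first by move/eqP; rewrite gtn_eqF.
  by rewrite /hh /=; move: (n.*2) => N; clear; lia.
by have [_ ->] := three_other qq n_gt0 core (leqnn 1) three_chE erefl u rA n2 n3.
Qed.

End ThreeTerms.
End LevelOne.

(** * The two inductions on the size of the core *)

Section Induction.
Variables (R : realType) (n : nat).
Hypothesis n_gt0 : (0 < n)%N.
Local Notation h := (hh n).
Local Notation Cq := {fraction {poly R[i]}}.
Implicit Types (l m tau : hspart n) (i a r s x y z Y Z : nat) (u : hspart n -> Cq).
Local Notation qq := (q : Cq).
Local Notation f := (fop qq).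
Local Notation e := (eop qq).
Let v0 := q_neq0 R.
Let vr := @q_root R.

Lemma fop_lin i c u1 u2 : f i (fun l => u1 l + c * u2 l) = (fun m => f i u1 m + c * f i u2 m).
Proof.
apply/funext => m; rewrite /fop big_distrr -big_split /=; apply: eq_bigr => x _.
by rewrite mulrDr; congr (_ + _); rewrite mulrCA.
Qed.

Lemma iter_fop_lin a i c u1 u2 : iter a (f i) (fun l => u1 l + c * u2 l) =
  (fun m => iter a (f i) u1 m + c * iter a (f i) u2 m).
Proof. by elim: a => //= a ->; rewrite fop_lin. Qed.

Lemma InG_two tau i u : is_bar_core tau -> (i <= n)%N -> wt i tau + (dd n i)%:Z = 2 ->
  barinv u -> InG tau (f i u).
Proof.
move=> core ni w2 Bu.
have fromY Y : (i < n)%N -> Y \in newparts tau -> ed n i Y ->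
    ((0 < i)%N /\ wt i tau = 0 \/ [/\ i = 0%N, wt i tau = 1 & Y = h.-1]) -> InG tau (f i u).
  move=> ltin YA eY wY; have [YA1 [sg [sc _ H]]] := two_terms R n_gt0 core ltin YA eY wY.
  have [sn sE] := newparts_succ n_gt0 YA YA1; set s := index Y _ in sn sE.
  have nE : nth 0%N (newparts tau) s = Y by rewrite nth_index.
  exists (fun r => if r == s then u sg else 0); split.
  - by move=> r; case: ifP => _; [apply: barinv_core | apply: inK0].
  - by rewrite gtn_eqF.
  have sn' := ltnW sn; move=> r rn; rewrite /stair /tt H ?nth_newparts // -sE -nE !nth_newparts_eq // nth_newparts_h //.
  have [->|rs] := eqVneq r s.
    by case: (s) => [|p]; rewrite ?addr0 //= (ltn_eqF (ltnSn p)) mulr0 addr0.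
  case: r {rn} rs => [|r] rs /=; first by rewrite addr0.
  by rewrite eqSS add0r; case: eqP => _ //; rewrite mulr0.
have [i0|i0] := posnP i.
  have w1 : wt 0 tau = 1 by rewrite i0 /dd /= in w2; apply: (addIr 1); rewrite w2.
  have ch0 : ch tau 1 = 0%N%:Z.
    by move: w1; rewrite wt_ch (ch_dvd tau (dvdn0 h)) /=; move: (ch _ _) => z; clear; lia.
  apply: (fromY h.-1); rewrite ?i0 //; last by right.
    first [exact: (zero_pred_mem n_gt0 (leq0n 1) ch0 erefl) | exact: (zero_pred_mem n_gt0 core (leq0n 1) ch0 erefl) | exact: (zero_pred_mem n_gt0 core ch0 erefl)].
  by rewrite ed0E // prednK // dvdnn orbT.
(* For i = n the weight is a multiple of 4, and wt + 4 = 2 is impossible. *)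
have [iN|iN] := eqVneq i n.
  move: w2; rewrite iN /dd eqxx (gtn_eqF n_gt0) wt_ch (gtn_eqF n_gt0).
  have -> : ch tau n.+1 = - ch tau n by apply: ch_opp; rewrite /hh addSn addnn.
  by move: (ch tau n) => z; clear; lia.
have ltin : (i < n)%N by rewrite ltn_neqAle iN.
have w0 : wt i tau = 0.
  by move: w2; rewrite /dd (gtn_eqF i0) (negPf iN) => w2; apply: (addIr 2); rewrite w2.
have i0n : (0 < i < n)%N by rewrite i0.
have [[Y YA eY]|nY] := pselect (exists2 Y, Y \in newparts tau & ed n i Y).
  by apply: (fromY Y) => //; left.
apply: InG0 => // r rn; have ZA := nth_newparts tau rn; rewrite /tt; set Z := nth _ _ _ in ZA *.
have Z0 : (0 < Z)%N by apply: leq_ltn_trans (newparts_gt n_gt0 ZA).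
apply: (middle_none qq n_gt0 core i0n w0) => //; apply/negP => eZ; apply: nY; first by exists Z.
by exists Z.-1; rewrite // -(middle_mem n_gt0 i0n w0 eZ) prednK.
Qed.

Lemma inK_vV : in_Cqsym (qq + qq^-1).
Proof. by have := inK_sym R 1; rewrite expr1z exprN1. Qed.

Lemma InG_three tau u : is_bar_core tau -> wt 0 tau = -1 -> InG (dn 0 tau) u -> InG tau (f 0 u).
Proof.
move=> core w1 [x [xK xn xE]]; have [sn ns hs] := three_index n_gt0 core w1; set s := hpos tau in sn ns hs.
exists (fun r => if r == s then x s.+1 + (qq + qq^-1) * x s else x r); split.
- by move=> r; case: ifP => _; [apply: inKD; [|apply: inKM; [exact: inK_vV|]] | ].
- by rewrite gtn_eqF.
move=> r rn; rewrite three_shift // -/s -(shift_stair s v0) /shift.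
by do 2?[case: eqP => [_|_]]; rewrite !xE // ?hs // ltnW.
Qed.

(** Applying f_i^a to e_i^a u gives [a]!^2 u, while f_i^a carries each member of the lower block to
    [a]! times the member at the same position. So the coefficients of u are those of e_i^a u
    divided by [a]!. *)
Lemma InG_step tau tau' i a u : is_bar_core tau -> is_bar_core tau' -> (i <= n)%N -> (0 < a)%N ->
  reach i a tau' tau -> wt i tau = - (a%:Z * (dd n i)%:Z) -> (i == 0%N) ==> (1 < a)%N ->
  (forall l, u l != 0 -> bar_removal l tau) -> InG tau' (iter a (e i) u) -> InG tau u.
Proof.
move=> core core' ni a0 rt w ai us [x [xK xn xE]].
have b0 := qfact_neq0 n v0 vr i a; set b := qfact n qq i a in b0.
have bK : in_Cqsym b^-1 by apply/inKV/inK_qfact.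
have hE : hpos tau' = hpos tau.
  apply/eqP; rewrite eq_sym -nth_newparts_h ?hpos_le //.
  by rewrite (step_h R n_gt0 core core' ni a0 rt w ai) ?hpos_le // nth_hpos.
exists (fun r => b^-1 * x r); split=> [r||r rn]; first exact: inKM.
  by rewrite xn mulr0.
have wu l : u l != 0 -> wt i l = - (a%:Z * (dd n i)%:Z).
  by move/us => lt; rewrite (block1_wt i lt).
have fu : f i u = (fun=> 0).
  apply: fop_eq0 => // l /us lt; rewrite (block1_DD n_gt0 core lt) (block1_wt i lt) w.
  have -> : 4 * h%:Z = 2 * h%:Z * 2 by ring.
  rewrite -mulrDr pmulr_rlt0 //; move: ai; rewrite /dd; case: (eqVneq i 0%N) => /= _; first by lia.
  by case: (i == n); lia.
have uE := string_id n_gt0 v0 vr ni wu fu; rewrite stringcE -/b in uE.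
have eE : iter a (e i) u = (fun k => \sum_(s < n.+1) iter a (e i) u (tt tau' s) * delta Cq (tt tau' s) k).
  apply/funext => k; have [bk|nb] := pselect (bar_removal k tau').
    have [s sn ->] := block1_tt n_gt0 core' bk.
    rewrite (bigD1 (Ordinal (sn : (s < n.+1)%N))) //= /delta eqxx mulr1 big1 ?addr0 // => p ps.
    rewrite (_ : (_ == _) = false) ?mulr0 //; apply/negP => /eqP E; case/eqP: ps.
    by apply: val_inj => /=; apply: (tt_inj n_gt0 core') (esym E); rewrite // -ltnS.
  have -> : iter a (e i) u k = 0.
    apply/eqP/contraT => /iter_eop_supp[m rm /us mt]; case: nb.
    exact: (reach_block1 n_gt0 core core' ni rt rm).2.
  rewrite big1 // => s _; rewrite /delta (_ : (k == _) = false) ?mulr0 //.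
  by apply/negP => /eqP E; apply: nb; rewrite E; apply: tt_block1; rewrite // -ltnS.
have itS (c : 'I_n.+1 -> Cq) (w0 : 'I_n.+1 -> hspart n -> Cq) :
    iter a (f i) (fun k => \sum_(s < n.+1) c s * w0 s k) = (fun k => \sum_(s < n.+1) c s * iter a (f i) (w0 s) k).
  elim: (a) => //= p ->; rewrite (fop_sum qq i _ xpredT (fun (s : 'I_n.+1) k => c s * iter p (f i) (w0 s) k)).
  by apply/funext => k; apply: eq_bigr => s _; rewrite fopZ.
have := congr1 (fun g => g (tt tau r)) uE; rewrite eE (itS _ (fun s : 'I_n.+1 => delta Cq (tt tau' s))) /= (bigD1 (Ordinal (rn : (r < n.+1)%N))) //=.
rewrite (step_tt R n_gt0 core core' ni a0 rt w ai rn) delta_tt // eqxx mulr1 big1 ?addr0; last first.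
  move=> s sr; have sn : (s <= n)%N by rewrite -ltnS.
  rewrite (step_tt R n_gt0 core core' ni a0 rt w ai sn) delta_tt // (_ : (r == s) = false) ?mulr0 //.
  by apply: contraNF sr => /eqP E; apply/eqP/val_inj.
rewrite xE // hE -/b => E; have -> : u (tt tau r) = b^-1 * stair qq (hpos tau) x r.
  by apply: (mulfI (expf_neq0 2 b0)); rewrite -E expr2 mulrA mulfK // mulrC.
by rewrite /stair mulrDr; congr (_ + _); case: eqP => _; rewrite ?mulr0 // mulrCA.
Qed.

Lemma barinv_InG tau u : is_bar_core tau -> barinv u -> InG tau u.
Proof.
have [N] := ubnP (sumn tau); elim: N tau u => // N IH tau u tN core; move: u.
apply: (barinv_ind n_gt0).
- by apply: InG0.
- move=> u1 u2 [x1 [K1 n1 E1]] [x2 [K2 n2 E2]]; exists (fun r => x1 r + x2 r).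
  split=> [r||r rn]; [exact: inKD | by rewrite n1 n2 addr0 |].
  by rewrite E1 // E2 // /stair addrACA; congr (_ + _); case: eqP => _; rewrite ?addr0 // mulrDr.
- move=> c u Kc [x [K xn E]]; exists (fun r => c * x r).
  split=> [r||r rn]; [exact: inKM | by rewrite xn mulr0 |].
  by rewrite E // /stair mulrDr; congr (_ + _); case: eqP => _; rewrite ?mulr0 // mulrCA.
- apply: InG0 => // r rn; apply/eqP/contraT => /delta_neq0 E.
  by have [_] := bar_removal_inv (tt_block1 n_gt0 core rn); rewrite E /= addnS.
move=> i u ni Bu Hu.
have [E0|] := pselect (forall r, (r <= n)%N -> f i u (tt tau r) = 0); first exact: InG0.
move/existsNP => [r0] /not_implyP[r0n /eqP u0].
have bt := tt_block1 n_gt0 core r0n.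
have [x [ex dx _]] := fop_supp u0.
have us l : f i u l != 0 -> bar_removal l tau.
  move=> ul; have [cE _ DE] := homog_block Hu ul u0; apply/(block1P n_gt0 l core).
  by rewrite DE (block1_DD n_gt0 core bt); split=> // k; rewrite cE (bar_removal_inv bt).1.
(* After the removal of the i-node x, [DD] is 4h - 2h(wt + d_i), which cannot be negative. *)
have le2 : wt i tau + (dd n i)%:Z <= 2.
  have := DD_ge0 n_gt0 (dn x (tt tau r0)); rewrite (DD_dn n_gt0 ni ex dx) (block1_DD n_gt0 core bt) (block1_wt i bt).
  have -> : 4 * h%:Z = 2 * h%:Z * 2 by ring.
  by rewrite -mulrBr pmulr_rge0 // subr_ge0.
have [w2|w2] := eqVneq (wt i tau + (dd n i)%:Z) 2; first exact: InG_two.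
have [a a0 w] : exists2 a, (0 < a)%N & wt i tau = - (a%:Z * (dd n i)%:Z).
  apply: dd_dvd_wt => //; move: le2 w2; rewrite wt_ch /dd.
  case: (eqVneq i 0%N) => [_|i0] /=; first by move: (_ - _ : int) => c; clear; lia.
  case: (eqVneq i n) => [->|iN]; last by move: (_ - _ : int) => c; clear; lia.
  have -> : ch tau n.+1 = - ch tau n by apply: ch_opp; rewrite /hh addSn addnn.
  by move: (ch tau n) => c; clear; lia.
(* In this case f_0 need not kill the block, and f_0 u cannot be recovered from its image under e_0;
   the induction hypothesis is applied to u itself on the block of [dn 0 tau]. *)
have [/andP[/eqP i0 /eqP a1]|H] := boolP ((i == 0%N) && (a == 1%N)).
  rewrite i0 in us Bu Hu u0 *; have w1 : wt 0 tau = -1 by rewrite -i0 w i0 a1.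
  apply: InG_three => //; apply: IH => //; last exact: (three_core n_gt0 core (leqnn 1) (three_chE w1) erefl).
  have := sumn_up (upok_dn (three_dnok n_gt0 core (leqnn 1) (three_chE w1) erefl)).
  by rewrite dnK ?(three_dnok n_gt0 core (leqnn 1) (three_chE w1) erefl) // => E; rewrite E in tN.
have ai : (i == 0%N) ==> (1 < a)%N by apply/implyP => i0; move: H; rewrite i0 /=; case: a a0 {w} => [|[]].
have [tau' [core' rt _]] := core_step R n_gt0 core ni a0 w.
apply: (InG_step core core' ni a0 rt w ai us); apply: IH => //.
  by move: tN; rewrite (reach_sumn rt) ltnS; apply: leq_trans; rewrite -addn1 leq_add2l.
by apply: barinv_iter_eop => //; apply: barinv_fop.
Qed.

Lemma Gd_two tau i r : is_bar_core tau -> (i < n)%N -> (r <= n)%N -> ed n i (nth 0%N (newparts tau) r) ->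
  ((0 < i)%N /\ wt i tau = 0 \/ [/\ i = 0%N, wt i tau = 1 & nth 0%N (newparts tau) r = h.-1]) ->
  (r < n)%N -> barinv (Gd R tau r).
Proof.
move=> core ltin rn er wY rn'; have YA := nth_newparts tau rn.
have [YA1 [sg [sc su H]]] := two_terms R n_gt0 core ltin YA er wY.
have [sn sE] := newparts_succ n_gt0 YA YA1.
have iE : index (nth 0%N (newparts tau) r) (newparts tau) = r.
  by rewrite index_uniq ?size_newparts // (sorted_uniq ltn_trans ltnn) // newparts_sorted.
rewrite iE in sE; suff -> : Gd R tau r = f i (delta Cq sg) by apply: barinv_fop; [exact: ltnW | exact: barinv_delta_core].
apply: (eq_block1 n_gt0 core) => [k|k|k kn]; [exact: Gd_supp | exact: su |].
rewrite Gd_tt // /tt H ?nth_newparts // -sE !nth_newparts_eq // nth_newparts_h // /pair_coef /delta eqxx.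
have [->|kr] := eqVneq k r; first by rewrite (ltn_eqF (ltnSn r)) mulr0 addr0.
by rewrite add0r; have [->|kr1] := eqVneq k r.+1; rewrite ?mulr0 ?mulr1.
Qed.

Lemma barinv_Gd tau r : is_bar_core tau -> (r < n)%N -> barinv (Gd R tau r).
Proof.
have [N] := ubnP (sumn tau); elim: N tau r => // N IH tau r tN core rn; have rn' := ltnW rn.
(* For the empty core the new parts are n + 1, ..., h, and Y and Y + 1 are joined by a move of
   residue 2n - Y. The weight is 0, or 1 when Y = 2n, so each vector arises from a core by one
   f_i. *)
have [tE|/eqP ne] := eqVneq tau (empty_hspart n).
  have ch0 k : ch tau k = 0 by rewrite tE /ch big_nil.
  set Y := nth 0%N (newparts tau) r; have YA : Y \in newparts tau by apply: nth_newparts.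
  have nY := newparts_gt n_gt0 YA.
  have leh Z : Z \in newparts tau -> (Z <= h)%N.
    rewrite mem_newparts // ch0 => /andP[_ /orP[/eqP -> //|]]; rewrite eq_sym eqz_nat -leqn0 leqNgt.
    by rewrite divn_gt0 // -ltnNge => /ltnW.
  have Yh : (Y < h)%N.
    by apply: leq_trans (leh _ (nth_newparts tau (rn : (r.+1 <= n)%N))); rewrite ltn_newparts.
  have [YE|YE] := eqVneq Y h.-1.
    apply: (@Gd_two tau 0); rewrite // -/Y YE; first by rewrite ed0E // prednK // dvdnn orbT.
    by right; rewrite wt_ch !ch0.
  have Yi : (n < Y < n.*2)%N by rewrite nY /= ltn_neqAle YE /= -ltnS.
  have iE : (0 < n.*2 - Y < n)%N by move: Yi; rewrite -addnn; clear; lia.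
  have [i0 iN] := andP iE; have iN' := ltnW iN; have Y2 : (Y <= n.*2)%N by case/andP: Yi => _ /ltnW.
  apply: (@Gd_two tau (n.*2 - Y)); rewrite // -/Y; last by left; rewrite wt_ch !ch0 (gtn_eqF i0).
  by rewrite edE // modn_small // subnKC // eqxx orbT.
have [i [a [ni a0 w]]] := core_neg R n_gt0 core ne.
have [/andP[/eqP i0 /eqP a1]|H] := boolP ((i == 0%N) && (a == 1%N)).
  have w1 : wt 0 tau = -1 by rewrite -i0 w i0 a1.
  have c1 := three_chE w1; have core' := three_core n_gt0 core (leqnn 1) c1 erefl.
  have d0 := three_dnok n_gt0 core (leqnn 1) c1 erefl.
  have [sn ns hs] := three_index n_gt0 core w1; set s := hpos tau in sn ns hs.
  have tN' : (sumn (dn 0 tau) < N)%N by have := sumn_up (upok_dn d0); rewrite dnK // => E; rewrite E in tN.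
  have B p : (p < n)%N -> barinv (f 0 (Gd R (dn 0 tau) p)) by move=> pn; apply: barinv_fop => //; apply: IH.
  have val p k : (p < n)%N -> (k <= n)%N -> f 0 (Gd R (dn 0 tau) p) (tt tau k) = shift qq s (pair_coef qq s.+1 p) k.
    move=> pn kn; rewrite three_shift // -/s /shift -hs.
    by do 2?[case: eqP => [_|_]]; rewrite !Gd_tt // ?hs // ltnW.
  have sup p k : (p < n)%N -> f 0 (Gd R (dn 0 tau) p) k != 0 -> bar_removal k tau.
    move=> pn /fop_supp[x [ex dx /(Gd_supp n_gt0 core' pn) bx]].
    have r1 : reach 0 1 (dn 0 tau) tau by exists 0%N; rewrite upok_dn // dnK // three_ed.
    have r2 : reach 0 1 (dn x k) k by exists x; rewrite upok_dn // dnK.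
    exact: (reach_block1 n_gt0 core core' (leq0n n) r1 r2).1.
  have two0 : qq + qq^-1 != 0.
    apply/eqP => E; have : qq ^+ 4 == 1; last by rewrite (negPf (vr 3)).
    have E2 : qq ^+ 2 = -1.
      by apply/eqP; rewrite -subr_eq0 opprK -[X in _ + X](divff v0) expr2 -mulrDr E mulr0.
    by rewrite -[4%N]/(2 * 2)%N exprM E2 sqrrN expr1n.
  have Gs : Gd R tau s = (fun k => (qq + qq^-1)^-1 * f 0 (Gd R (dn 0 tau) s) k).
    apply: (eq_block1 n_gt0 core) => [k|k|k kn]; first exact: Gd_supp.
      by rewrite mulf_eq0 negb_or => /andP[_]; apply: sup.
    rewrite (Gd_tt R n_gt0 core sn kn) (val s k sn kn); apply/esym; exact: (shift_sameK s v0 k two0).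
  have Bs : barinv (Gd R tau s).
    by rewrite Gs; apply: barinvZ; [exact/inKV/inK_vV | exact: B].
  have [->|rs] := eqVneq r s; first exact: Bs.
  (* For r = s + 1 the image under f_0 contains an extra copy of the vector of index s, which is
     already known to be bar-invariant and is subtracted. *)
  have [rE|rs1] := eqVneq r s.+1.
    have -> : Gd R tau r = (fun k => f 0 (Gd R (dn 0 tau) r) k + -1 * Gd R tau s k).
      apply: (eq_block1 n_gt0 core) => [k|k|k kn]; first exact: Gd_supp.
        have [->|/sup] := eqVneq (f 0 (Gd R (dn 0 tau) r) k) 0; last by move=> B1 _; apply: B1.
        by rewrite add0r mulN1r oppr_eq0; apply: Gd_supp.
      rewrite (Gd_tt R n_gt0 core rn kn) (Gd_tt R n_gt0 core sn kn) (val r k rn kn) rE; exact: (shift_nextB s v0 k).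
    by apply: barinvD; [exact: B | apply: barinvZ => //; apply: inKN; exact: inK1].
  suff -> : Gd R tau r = f 0 (Gd R (dn 0 tau) r) by apply: B.
  apply: (eq_block1 n_gt0 core) => [k|k|k kn]; [exact: Gd_supp | exact: sup |].
  rewrite (Gd_tt R n_gt0 core rn kn) (val r k rn kn); apply/esym; first [exact: (shift_other v0 k rs rs1) | exact: (shift_other s v0 k rs rs1)].
have ai : (i == 0%N) ==> (1 < a)%N by apply/implyP => i0; move: H; rewrite i0 /=; case: a a0 {w} => [|[]].
have [tau' [core' rt _]] := core_step R n_gt0 core ni a0 w.
have b0 := qfact_neq0 n v0 vr i a.
have hE : hpos tau' = hpos tau.
  apply/eqP; rewrite eq_sym -nth_newparts_h ?hpos_le //.
  by rewrite (step_h R n_gt0 core core' ni a0 rt w ai) ?hpos_le // nth_hpos.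
have -> : Gd R tau r = (fun k => (qfact n qq i a)^-1 * iter a (f i) (Gd R tau' r) k).
  apply/funext => k; rewrite /Gd iter_fop_lin hE.
  rewrite (step_tt R n_gt0 core core' ni a0 rt w ai rn') (step_tt R n_gt0 core core' ni a0 rt w ai rn).
  by rewrite mulrCA -mulrDr mulKf.
apply: barinvZ; first exact/inKV/inK_qfact.
apply: barinv_iter_fop => //; apply: IH => //.
by move: tN; rewrite (reach_sumn rt) ltnS; apply: leq_trans; rewrite -addn1 leq_add2l.
Qed.

End Induction.

(** * The canonical basis vectors on the block *)

Section Canonical.
Variables (R : realType) (n : nat) (n_gt0 : (0 < n)%N) (tau : hspart n).
Hypothesis core : is_bar_core tau.
Local Notation h := (hh n).
Local Notation Cq := {fraction {poly R[i]}}.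
Local Notation qq := (q : Cq).
Implicit Types (r s k : nat).

Lemma Gvec_exists s : (s < n)%N ->
  exists2 v : {malg Cq[hspart n]}, is_canonical (tt tau s) v & forall l, v@_l = Gd R tau s l.
Proof.
move=> sn; have sn' := ltnW sn.
pose v : {malg Cq[hspart n]} :=
  << tt tau s >> + << qq ^+ (if s.+1 == hpos tau then 1 else 2)%N *g tt tau s.+1 >>.
have vE l : v@_l = Gd R tau s l.
  rewrite /v mcoeffD !mcoeffU /Gd /delta ![_ == l]eq_sym; congr (_ + _).
  by case: (l == _); rewrite ?mulr1n ?mulr0n ?mulr1 ?mulr0.
exists v => //; split.
- apply/(barinv_bar_invariant n_gt0); have -> : (fun l => v@_l) = Gd R tau s by apply/funext.
  exact: barinv_Gd.
- by rewrite vE Gd_tt // /pair_coef eqxx (ltn_eqF (ltnSn s)) mulr0 addr0.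
move=> l ls; rewrite vE /Gd /delta (negPf ls) add0r.
case: (l == _); last first.
  by exists 0; rewrite !mulr0 /poly_in_q rmorph0.
by rewrite mulr1; case: ifP => _; [exists 1; rewrite mulr1 expr1 | exists 'X; rewrite -expr2 -poly_in_qX].
Qed.

(** By induction on k, the difference of x k and its expected value 0 or 1 lies in C(q + 1/q) and is
    a polynomial divisible by q, hence it is 0. This determines v on the block, whatever it does
    elsewhere. *)
Lemma canonical_tt s (v : {malg Cq[hspart n]}) r : (s < n)%N -> (r <= n)%N ->
  is_canonical (tt tau s) v -> v@_(tt tau r) = pair_coef qq (hpos tau) s r.
Proof.
move=> sn rn [/(barinv_bar_invariant n_gt0) Bv vs vl].
have [x [xK xn xE]] := barinv_InG n_gt0 core Bv.
have low k : (k <= n)%N -> exists p : {poly R[i]}, v@_(tt tau k) - (k == s)%:R = poly_in_q ('X * p).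
  move=> kn; have [->|ks] := eqVneq k s; first by exists 0; rewrite vs subrr mulr0 /poly_in_q rmorph0.
  have [p pE] : exists p : {poly R[i]}, v@_(tt tau k) = poly_in_q ('X * p).
    by apply: vl; apply: contraNneq ks => /(tt_inj n_gt0 core kn (ltnW sn)) ->.
  by exists p; rewrite pE subr0.
have xs k : (k <= n)%N -> x k = (k == s)%:R.
  elim: k => [|k IH] kn; have [p pE] := low _ kn; have := xE _ kn; rewrite /stair /=.
    rewrite addr0 => vE; apply/eqP; rewrite -subr_eq0 -vE pE.
    have K : in_Cqsym (poly_in_q ('X * p)).
      by rewrite -pE vE; apply: inKB => //; case: (_ == _); [apply: inK1 | apply: inK0].
    by rewrite (inK_poly K) hornerM hornerX mul0r polyC0 /poly_in_q rmorph0.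
  rewrite IH ?(ltnW kn) //; set d := (if k.+1 == _ then _ else _) => vE.
  (* The contribution of x k to the next coefficient carries the factor q^d with d > 0, so it does
     not disturb divisibility by q. *)
  have [t tE] : exists t : {poly R[i]}, qq ^+ d * (k == s)%:R = poly_in_q ('X * t).
    case: (k == s); last by exists 0; rewrite !mulr0 /poly_in_q rmorph0.
    by rewrite mulr1 /d; case: ifP => _; [exists 1; rewrite mulr1 expr1 | exists 'X; rewrite -expr2 -poly_in_qX].
  apply/eqP; rewrite -subr_eq0; have E : x k.+1 - (k.+1 == s)%:R = poly_in_q ('X * (p - t)).
    have -> : poly_in_q ('X * (p - t)) = poly_in_q ('X * p) - poly_in_q ('X * t).
      by rewrite mulrBr /poly_in_q rmorphB.
    by rewrite -pE -tE vE [RHS]addrAC addrK.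
  rewrite E; have K : in_Cqsym (poly_in_q ('X * (p - t))).
    by rewrite -E; apply: inKB => //; case: (_ == _); [apply: inK1 | apply: inK0].
  by rewrite (inK_poly K) hornerM hornerX mul0r polyC0 /poly_in_q rmorph0.
rewrite xE // /stair xs // /pair_coef; congr (_ + _).
case: r rn => [|r] rn /=; first by rewrite mulr0.
rewrite xs ?(ltnW rn) // eqSS; have [->|] := eqVneq r s => //.
by rewrite !mulr0.
Qed.

Lemma dnum_tt r s : (r <= n)%N -> (s < n)%N ->
  dnum R (tt tau r) (tt tau s) =
    if r == s then 1 else if r == s.+1 then (if hh n \in parts (tt tau r) then q else q ^+ 2) else 0.
Proof.
move=> rn sn; have [v0 vc _] := Gvec_exists sn.
(* A canonical vector exists, so the choice does not fall back on the default 0; [canonical_tt]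
   applies to whichever vector is chosen. *)
have Gc : is_canonical (tt tau s) (Gvec R (tt tau s)).
  by rewrite /Gvec; case: xgetP => [w -> //|/(_ v0)].
rewrite /dnum (canonical_tt sn rn Gc) /pair_coef /tt mem_tY_h ?nth_newparts // nth_newparts_h //.
have [->|rs] := eqVneq r s; first by rewrite (ltn_eqF (ltnSn s)) mulr0 addr0.
rewrite add0r; have [->|rs1] := eqVneq r s.+1; last by rewrite mulr0.
by rewrite mulr1; case: ifP => _; rewrite ?expr1.
Qed.

End Canonical.

Theorem theorem5p2 (R : realType) (n : nat) (n_gt0 : (0 < n)%N)
    (tau : hspart n) (tau_core : is_bar_core tau) :
  (exists t : 'I_n.+1 -> hspart n, weight1_enum tau t) /\
  forall t : 'I_n.+1 -> hspart n, weight1_enum tau t ->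
    (forall r : 'I_n.+1, restricted (t r) <-> (r < n)%N) /\
    (forall r s : 'I_n.+1, (s < n)%N ->
       dnum R (t r) (t s) =
         if r == s then 1
         else if (r == s.+1 :> nat) then
           if hh n \in parts (t r) then q else q ^+ 2
         else 0).
Proof.
split; first by exists (fun r => tt tau r); apply: tt_weight1.
move=> t /(weight1_enum_tt n_gt0 tau_core) tE; split=> [r|r s sn]; rewrite !tE.
  by apply: restricted_tt; rewrite // -ltnS.
by rewrite dnum_tt // -ltnS.
Qed.
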